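(* Let $X$ be a complex Banach space, $\alpha>0$, $T\in\mathcal{B}(X)$ a $(C,\alpha)$-bounded operator, and let $\mathfrak f\in A_+^\alpha(\mathbb{T})$ be of spectral synthesis in $A^\alpha(\mathbb{T})$ with respect to $\sigma(T)\cap\mathbb{T}$. Then $$\lim_{n\to\infty}\big\|M_T^\alpha(n)\,\theta_\alpha(\widehat{\mathfrak f})\big\|=0.$$
   Context: For $\gamma\in\mathbb{R}$, $k^\gamma(0)=1$, $k^\gamma(n)=\frac{\gamma(\gamma+1)\cdots(\gamma+n-1)}{n!}$ for $n\ge1$. For $T\in\mathcal{B}(X)$, $\Delta^{-\alpha}\mathcal{T}(n)=\sum_{j=0}^nk^\alpha(n-j)T^j$, $M_T^\alpha(n)=\Delta^{-\alpha}\mathcal{T}(n)/k^{\alpha+1}(n)$; $T$ is $(C,\alpha)$-bounded if $\sup_n\|M_T^\alpha(n)\|<\infty$. For a sequence $f$ on $\mathbb{Z}$: $W_+f(n)=f(n)-f(n+1)$, $W_-f(n)=f(n)-f(n-1)$, $W_\pm^m$ their powers; for $\alpha>0$, $W_+^{-\alpha}f(n)=\sum_{j\ge n}k^\alpha(j-n)f(j)$, $W_-^{-\alpha}f(n)=\sum_{j\le n}k^\alpha(n-j)f(j)$, $W_\pm^\alpha f=W_\pm^mW_\pm^{-(m-\alpha)}f$ with $m=[\alpha]+1$; $W^\alpha f(n)=W_+^\alpha f(n)$ for $n\ge0$, $=W_-^\alpha f(n)$ for $n<0$. $A^\alpha(\mathbb{T})$ is the space of continuous $2\pi$-periodic functions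 $\mathfrak f(t)=\sum_{n\in\mathbb{Z}}\widehat{\mathfrak f}(n)e^{int}$ ($\widehat{\mathfrak f}(n)$ the Fourier coefficients) with $\|\mathfrak f\|_{A^\alpha(\mathbb{T})}=\sum_{n\in\mathbb{Z}}k^{\alpha+1}(|n|)|W^\alpha\widehat{\mathfrak f}(n)|<\infty$; it is a Banach algebra (pointwise product, i.e. convolution of coefficients) with maximal ideal space $\mathbb{T}$. $A_+^\alpha(\mathbb{T})$ is the subalgebra with $\widehat{\mathfrak f}(n)=0$ for $n<0$. For a closed $E\subseteq\mathbb{T}$ (identified with $[0,2\pi)$ via $t\mapsto e^{it}$), $\mathfrak f\in A^\alpha(\mathbb{T})$ is of spectral synthesis with respect to $E$ if for every $\varepsilon>0$ there is $\mathfrak f_\varepsilon\in A^\alpha(\mathbb{T})$ with $\|\mathfrak f-\mathfrak f_\varepsilon\|_{A^\alpha(\mathbb{T})}<\varepsilon$ and $\mathfrak f_\varepsilon=0$ on a neighbourhood of $E$. For $(C,\alpha)$-bounded $T$ and $f$ on $\mathbb{N}_0$ with $\sum_{n\ge0}k^{\alpha+1}(n)|W_+^\alpha f(n)|<\infty$, $\theta_\alpha(f)=\sum_{n=0}^\infty W_+^\alpha f(n)\,\Delta^{-\alpha}\mathcal{T}(n)\in\mathcal{B}(X)$ (norm convergent series); $\theta_\alpha$ is a bounded algebra homomorphism. *)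

(* Defs.v *)
From Stdlib Require Import Reals ZArith Classical ClassicalEpsilon.
Open Scope R_scope.

Record Cx := mkC { re : R; im : R }.
Definition C0 : Cx := mkC 0 0.
Definition C1 : Cx := mkC 1 0.
Definition RtoC (r : R) : Cx := mkC r 0.
Definition Cadd (z w : Cx) : Cx := mkC (re z + re w) (im z + im w).
Definition Copp (z : Cx) : Cx := mkC (- re z) (- im z).
Definition Csub (z w : Cx) : Cx := Cadd z (Copp w).
Definition Cmul (z w : Cx) : Cx :=
  mkC (re z * re w - im z * im w) (re z * im w + im z * re w).
Definition Cnorm (z : Cx) : R := sqrt (re z * re z + im z * im z).
Definition Cexpi (t : R) : Cx := mkC (cos t) (sin t).

Definition Rlim (u : nat -> R) : R :=
  epsilon (inhabits 0) (fun l => Un_cv u l).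
Definition Clim (u : nat -> Cx) : Cx :=
  mkC (Rlim (fun n => re (u n))) (Rlim (fun n => im (u n))).

Fixpoint Csum (f : nat -> Cx) (n : nat) : Cx :=
  match n with O => f O | S p => Cadd (Csum f p) (f (S p)) end.
Definition Csum_Z (f : Z -> Cx) (N : nat) : Cx :=
  Cadd (Csum (fun i => f (Z.of_nat i)) N)
       (Csub (Csum (fun i => f (- Z.of_nat i)%Z) N) (f 0%Z)).
Definition Rsum_Z (f : Z -> R) (N : nat) : R :=
  sum_f_R0 (fun i => f (Z.of_nat i)) N
  + sum_f_R0 (fun i => f (- Z.of_nat i)%Z) N - f 0%Z.
(* a series over Z of nonnegative terms is finite *)
Definition Rsummable_Z (f : Z -> R) : Prop := exists l, Un_cv (Rsum_Z f) l.

Fixpoint kk (g : R) (n : nat) : R :=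
  match n with O => 1 | S p => kk g p * (g + INR p) / INR (S p) end.

(* m = [alpha] + 1 ; note up alpha = floor alpha + 1 *)
Definition mfloor1 (alpha : R) : nat := Z.to_nat (up alpha).

Definition Wp (f : Z -> Cx) (n : Z) : Cx := Csub (f n) (f (n + 1)%Z).
Definition Wm (f : Z -> Cx) (n : Z) : Cx := Csub (f n) (f (n - 1)%Z).
Definition Wp_neg (b : R) (f : Z -> Cx) (n : Z) : Cx :=
  Clim (Csum (fun i => Cmul (RtoC (kk b i)) (f (n + Z.of_nat i)%Z))).
Definition Wm_neg (b : R) (f : Z -> Cx) (n : Z) : Cx :=
  Clim (Csum (fun i => Cmul (RtoC (kk b i)) (f (n - Z.of_nat i)%Z))).
Definition Wp_frac (alpha : R) (f : Z -> Cx) : Z -> Cx :=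
  Nat.iter (mfloor1 alpha) Wp (Wp_neg (INR (mfloor1 alpha) - alpha) f).
Definition Wm_frac (alpha : R) (f : Z -> Cx) : Z -> Cx :=
  Nat.iter (mfloor1 alpha) Wm (Wm_neg (INR (mfloor1 alpha) - alpha) f).
Definition W_frac (alpha : R) (f : Z -> Cx) (n : Z) : Cx :=
  if Z.leb 0 n then Wp_frac alpha f n else Wm_frac alpha f n.

(* ---------- the algebra A^alpha(T), elements given by Fourier coefficients ---------- *)
Definition Aterm (alpha : R) (a : Z -> Cx) (n : Z) : R :=
  kk (alpha + 1) (Z.abs_nat n) * Cnorm (W_frac alpha a n).
(* a = (hat f(n))_n are the Fourier coefficients of a continuous function in A^alpha *)
Definition in_A (alpha : R) (a : Z -> Cx) : Prop :=
  Rsummable_Z (fun n => Cnorm (a n)) /\ Rsummable_Z (Aterm alpha a).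
Definition in_Aplus (alpha : R) (a : Z -> Cx) : Prop :=
  in_A alpha a /\ (forall n, (n < 0)%Z -> a n = C0).
Definition A_norm (alpha : R) (a : Z -> Cx) : R := Rlim (Rsum_Z (Aterm alpha a)).
Definition fval (a : Z -> Cx) (t : R) : Cx :=
  Clim (Csum_Z (fun n => Cmul (a n) (Cexpi (IZR n * t)))).

Definition C_open (U : Cx -> Prop) : Prop :=
  forall z, U z -> exists r, r > 0 /\ forall w, Cnorm (Csub w z) < r -> U w.

Definition spectral_synthesis (alpha : R) (a : Z -> Cx) (E : Cx -> Prop) : Prop :=
  forall eps, eps > 0 -> exists b : Z -> Cx,
    in_A alpha b /\ A_norm alpha (fun n => Csub (a n) (b n)) < eps /\
    exists U : Cx -> Prop, C_open U /\ (forall z, E z -> U z) /\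
      (forall t, U (Cexpi t) -> fval b t = C0).

Record CBanach := {
  car :> Type;
  vzero : car;
  vadd : car -> car -> car;
  vopp : car -> car;
  vscal : Cx -> car -> car;
  vnorm : car -> R;
  vadd_assoc : forall x y z, vadd x (vadd y z) = vadd (vadd x y) z;
  vadd_comm : forall x y, vadd x y = vadd y x;
  vadd_0 : forall x, vadd x vzero = x;
  vadd_opp : forall x, vadd x (vopp x) = vzero;
  vscal_1 : forall x, vscal C1 x = x;
  vscal_assoc : forall a b x, vscal a (vscal b x) = vscal (Cmul a b) x;
  vscal_addv : forall a x y, vscal a (vadd x y) = vadd (vscal a x) (vscal a y);
  vscal_adds : forall a b x, vscal (Cadd a b) x = vadd (vscal a x) (vscal b x);
  vnorm_ge0 : forall x, 0 <= vnorm x;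
  vnorm_eq0 : forall x, vnorm x = 0 -> x = vzero;
  vnorm_scal : forall a x, vnorm (vscal a x) = Cnorm a * vnorm x;
  vnorm_triangle : forall x y, vnorm (vadd x y) <= vnorm x + vnorm y;
  vcomplete : forall u : nat -> car,
    (forall eps, eps > 0 -> exists N, forall m n, (m >= N)%nat -> (n >= N)%nat ->
       vnorm (vadd (u m) (vopp (u n))) < eps) ->
    exists l, forall eps, eps > 0 -> exists N, forall n, (n >= N)%nat ->
       vnorm (vadd (u n) (vopp l)) < eps
}.

Arguments vzero {c}. Arguments vadd {c}. Arguments vopp {c}.
Arguments vscal {c}. Arguments vnorm {c}.

Definition vsub {X : CBanach} (x y : X) : X := vadd x (vopp y).
Fixpoint vsum {X : CBanach} (f : nat -> X) (n : nat) : X :=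
  match n with O => f O | S p => vadd (vsum f p) (f (S p)) end.
Definition vconv {X : CBanach} (u : nat -> X) (l : X) : Prop :=
  forall eps, eps > 0 -> exists N, forall n, (n >= N)%nat -> vnorm (vsub (u n) l) < eps.

Definition bounded_op {X : CBanach} (T : X -> X) : Prop :=
  (forall x y, T (vadd x y) = vadd (T x) (T y)) /\
  (forall a x, T (vscal a x) = vscal a (T x)) /\
  (exists M, forall x, vnorm (T x) <= M * vnorm x).

Definition in_spectrum {X : CBanach} (T : X -> X) (lam : Cx) : Prop :=
  ~ exists S : X -> X, bounded_op S /\
      forall x, S (vsub (T x) (vscal lam x)) = x /\
                vsub (T (S x)) (vscal lam (S x)) = x.

Definition DeltaT {X : CBanach} (alpha : R) (T : X -> X) (n : nat) (x : X) : X :=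
  vsum (fun j => vscal (RtoC (kk alpha (n - j))) (Nat.iter j T x)) n.
Definition MT {X : CBanach} (alpha : R) (T : X -> X) (n : nat) (x : X) : X :=
  vscal (RtoC (/ kk (alpha + 1) n)) (DeltaT alpha T n x).
Definition Cesaro_bounded {X : CBanach} (alpha : R) (T : X -> X) : Prop :=
  exists K, forall n x, vnorm (MT alpha T n x) <= K * vnorm x.

(* Main.v *)
From Stdlib Require Import Reals ZArith.
From Stdlib Require Import Lra Lia Psatz Classical ClassicalEpsilon FunctionalExtensionality.
From Coquelicot Require Compactness.
Require Import Defs.
Open Scope R_scope.

(** Let [b] be the coefficients of an element of the algebra. The Cesàro sum of
    order [n] applied to [theta b] is the convolution of [kk alpha] with the
    sequence [s_n = sum_k b(k) T^(n+k)], [k >= -n], up to an error controlled by the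
    negative coefficients of [b], hence by the distance from [b] to the analytic
    part of the algebra. It is therefore enough to show [s_n -> 0] in norm when
    the function [f] of [b] vanishes near the unitary spectrum. Abel summation
    identifies [s_n] with a limit, as [r -> 1-], of the Fourier coefficients of
    [f(t) (1 - r exp(-it) T)^(-1)], and these functions are equicontinuous
    because the resolvent is uniformly bounded off the zero set of [f]; the
    Riemann-Lebesgue argument (shift by half a period) then applies. Integrals
    are replaced by averages over roots of unity. *)

(** Two obstacles shape the argument: [T] need not be invertible, and its powers may grow
    polynomially, so a two-sided sum over [b] cannot be applied to [T] and the [s_n] need not
    converge absolutely. Truncation at [k >= -n] removes the first. Factors [r^j] remove the second;
    their limit is the value given by theta because [r T] is Cesàro bounded uniformly in [r], which
    rests on the positivity of the coefficients of [((1 - r z)/(1 - z))^alpha]. No resolvent is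
    constructed: compactness gives a lower bound for [1 - r exp(-it) T] outside the zero set of [f],
    and it is applied to Neumann partial sums, which solve the resolvent equation up to a small
    residual; on the zero set the factor [f] is 0. Fractional differences enter only through their
    inversion formula: on nonnegative indices it turns the theta series into a power series in [T],
    on negative ones it bounds the sum of the absolute values of the coefficients by the algebra
    norm. Every estimate is a constant independent of [x] times [vnorm x], which makes the
    convergence one in operator norm. *)

Section FiniteSums.

Variables (G : Type) (add : G -> G -> G).
Hypothesis addC : forall x y, add x y = add y x.
Hypothesis addA : forall x y z, add x (add y z) = add (add x y) z.

(** One set of summation identities serves reals, complex scalars and vectors; [sum_f_R0] and [Csum]
    are convertible to instances of it. *)
Fixpoint gsum (f : nat -> G) (n : nat) : G :=
  match n with O => f O | S p => add (gsum f p) (f (S p)) end.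

Lemma gsum_ext f g n :
  (forall i, (i <= n)%nat -> f i = g i) -> gsum f n = gsum g n.
Proof.
induction n as [|n IH]; intros H; simpl.
- now apply H.
- rewrite IH, H; auto; intros; apply H; lia.
Qed.

Lemma gsum_add f g n :
  gsum (fun i => add (f i) (g i)) n = add (gsum f n) (gsum g n).
Proof.
induction n as [|n IH]; simpl; auto.
rewrite IH, <- !addA. f_equal. rewrite !addA. f_equal. apply addC.
Qed.

Lemma gsum_recl f n : gsum f (S n) = add (f O) (gsum (fun i => f (S i)) n).
Proof.
induction n as [|n IH]; auto.
change (gsum f (S (S n))) with (add (gsum f (S n)) (f (S (S n)))).
rewrite IH. simpl. now rewrite addA.
Qed.

Lemma gsum_cat f m n :
  gsum f (S m + n) = add (gsum f m) (gsum (fun i => f (S m + i)%nat) n).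
Proof.
induction n as [|n IH].
- now rewrite Nat.add_0_r; simpl; rewrite Nat.add_0_r.
- rewrite Nat.add_succ_r.
  change (gsum f (S (S m + n))) with (add (gsum f (S m + n)) (f (S (S m + n)))).
  rewrite IH, <- addA. simpl. now rewrite Nat.add_succ_r.
Qed.

Lemma gsum_rev f n : gsum f n = gsum (fun i => f (n - i)%nat) n.
Proof.
induction n as [|n IH]; auto.
rewrite (gsum_recl (fun i => f (S n - i)%nat)).
change (gsum f (S n)) with (add (gsum f n) (f (S n))).
rewrite addC, IH. reflexivity.
Qed.

Lemma gsum_exchange (F : nat -> nat -> G) m n :
  gsum (fun i => gsum (fun j => F i j) n) m
  = gsum (fun j => gsum (fun i => F i j) m) n.
Proof.
induction m as [|m IH]; simpl; auto.
now rewrite IH, <- gsum_add.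
Qed.

Lemma gsum_triangle (F : nat -> nat -> G) n :
  gsum (fun j => gsum (fun i => F i j) j) n
  = gsum (fun i => gsum (fun k => F i (i + k)%nat) (n - i)) n.
Proof.
induction n as [|n IH]; auto.
change (gsum (fun j => gsum (fun i => F i j) j) (S n))
  with (add (gsum (fun j => gsum (fun i => F i j) j) n)
            (add (gsum (fun i => F i (S n)) n) (F (S n) (S n)))).
change (gsum (fun i => gsum (fun k => F i (i + k)%nat) (S n - i)) (S n))
  with (add (gsum (fun i => gsum (fun k => F i (i + k)%nat) (S n - i)) n)
            (gsum (fun k => F (S n) (S n + k)%nat) (S n - S n))).
rewrite IH, Nat.sub_diag, addA.
change (gsum (fun k => F (S n) (S n + k)%nat) 0) with (F (S n) (S n + 0)%nat).
rewrite Nat.add_0_r. f_equal. rewrite <- gsum_add.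
apply gsum_ext; intros i Hi.
replace (S n - i)%nat with (S (n - i)) by lia. simpl.
do 2 f_equal; lia.
Qed.

End FiniteSums.

Lemma gsum_morph (G H : Type) (addG : G -> G -> G) (addH : H -> H -> H)
  (phi : G -> H) (Hphi : forall x y, phi (addG x y) = addH (phi x) (phi y)) f n :
  phi (gsum G addG f n) = gsum H addH (fun i => phi (f i)) n.
Proof. induction n as [|n IH]; simpl; auto. now rewrite Hphi, IH. Qed.

Section Convolution.

Variables (S M : Type) (sadd smul : S -> S -> S) (madd : M -> M -> M)
  (act : S -> M -> M).
Hypothesis saddC : forall x y, sadd x y = sadd y x.
Hypothesis saddA : forall x y z, sadd x (sadd y z) = sadd (sadd x y) z.
Hypothesis maddC : forall x y, madd x y = madd y x.
Hypothesis maddA : forall x y z, madd x (madd y z) = madd (madd x y) z.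
Hypothesis actDl : forall a b x, act (sadd a b) x = madd (act a x) (act b x).
Hypothesis actDr : forall a x y, act a (madd x y) = madd (act a x) (act a y).
Hypothesis actA : forall a b x, act a (act b x) = act (smul a b) x.

Definition gconv (c : nat -> S) (v : nat -> M) (n : nat) : M :=
  gsum M madd (fun j => act (c (n - j)%nat) (v j)) n.

Lemma gconv_ext c c' v v' n :
  (forall i, (i <= n)%nat -> c i = c' i) ->
  (forall i, (i <= n)%nat -> v i = v' i) -> gconv c v n = gconv c' v' n.
Proof.
intros Hc Hv. apply gsum_ext; intros i Hi. rewrite Hc, Hv; auto; lia.
Qed.

Definition gsconv (c d : nat -> S) (n : nat) : S :=
  gsum S sadd (fun j => smul (c (n - j)%nat) (d j)) n.

(** Both sides are the coefficients of a product of three power series. Two sorts are needed because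
    the last factor may have vector coefficients. *)
Lemma gconv_assoc c d v n :
  gconv c (gconv d v) n = gconv (gsconv c d) v n.
Proof.
unfold gconv at 1 2.
transitivity (gsum M madd (fun j => gsum M madd
   (fun i => act (smul (c (n - j)%nat) (d (j - i)%nat)) (v i)) j) n).
- apply gsum_ext; intros j Hj.
  rewrite (gsum_morph M M madd madd (act (c (n - j)%nat))) by auto.
  apply gsum_ext; intros; apply actA.
- rewrite gsum_triangle with
    (F := fun i j => act (smul (c (n - j)%nat) (d (j - i)%nat)) (v i)) by auto.
  unfold gconv; apply gsum_ext; intros i Hi.
  unfold gsconv.
  rewrite (gsum_morph S M sadd madd (fun a => act a (v i))) by auto.
  apply gsum_ext; intros k Hk.
  replace (n - (i + k))%nat with (n - i - k)%nat by lia.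
  now replace (i + k - i)%nat with k by lia.
Qed.

End Convolution.

(** * Complex numbers *)

Lemma Cx_eq z w : re z = re w -> im z = im w -> z = w.
Proof. destruct z, w; simpl; intros; subst; auto. Qed.

Lemma Cx_ring : ring_theory C0 C1 Cadd Cmul Csub Copp eq.
Proof. split; intros; apply Cx_eq; simpl; ring. Qed.

Add Ring Cx_ring : Cx_ring.

Lemma Cnorm_ge0 z : 0 <= Cnorm z.
Proof. apply sqrt_pos. Qed.

Lemma Cnorm_sqr z : Cnorm z * Cnorm z = re z * re z + im z * im z.
Proof. apply sqrt_sqrt; nra. Qed.

Lemma Cnorm_le_sqr z M :
  0 <= M -> re z * re z + im z * im z <= M * M -> Cnorm z <= M.
Proof.
intros HM H. pose proof (Cnorm_ge0 z). pose proof (Cnorm_sqr z). nra.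
Qed.

Lemma Cnorm_mul z w : Cnorm (Cmul z w) = Cnorm z * Cnorm w.
Proof.
unfold Cnorm. rewrite <- sqrt_mult by nra. f_equal. simpl. ring.
Qed.

Lemma Cnorm_add z w : Cnorm (Cadd z w) <= Cnorm z + Cnorm w.
Proof.
pose proof (Cnorm_ge0 z); pose proof (Cnorm_ge0 w).
apply Cnorm_le_sqr; [lra|]. simpl.
assert (re z * re w + im z * im w <= Cnorm z * Cnorm w).
{ rewrite <- Cnorm_mul. pose proof (Cnorm_ge0 (Cmul z w)) as H1.
  pose proof (Cnorm_sqr (Cmul z w)) as H2; simpl in H2.
  assert (0 <= (re z * im w - im z * re w)^2) by apply pow2_ge_0.
  apply Rnot_lt_le; intros Hlt.
  assert (Cnorm (Cmul z w) * Cnorm (Cmul z w) <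
    (re z * re w + im z * im w) * (re z * re w + im z * im w)) by nra.
  nra. }
pose proof (Cnorm_sqr z); pose proof (Cnorm_sqr w). nra.
Qed.

Lemma Cnorm_RtoC r : Cnorm (RtoC r) = Rabs r.
Proof.
unfold Cnorm; simpl. replace (r * r + 0 * 0) with (Rsqr r) by (unfold Rsqr; ring).
apply sqrt_Rsqr_abs.
Qed.

Lemma Cnorm_opp z : Cnorm (Copp z) = Cnorm z.
Proof. unfold Cnorm; simpl; f_equal; ring. Qed.

Lemma Cnorm_C0 : Cnorm C0 = 0.
Proof. change C0 with (RtoC 0). rewrite Cnorm_RtoC. apply Rabs_R0. Qed.

Lemma Cnorm_C1 : Cnorm C1 = 1.
Proof. change C1 with (RtoC 1). rewrite Cnorm_RtoC. apply Rabs_R1. Qed.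

Lemma Cnorm_eq0 z : Cnorm z = 0 -> z = C0.
Proof.
intros H. pose proof (Cnorm_sqr z) as E. rewrite H in E.
apply Cx_eq; simpl; nra.
Qed.

Lemma Cnorm_Cexpi t : Cnorm (Cexpi t) = 1.
Proof.
unfold Cnorm; simpl.
replace (cos t * cos t + sin t * sin t) with 1; [apply sqrt_1|].
pose proof (sin2_cos2 t); unfold Rsqr in *; lra.
Qed.

Lemma Rabs_re_le z : Rabs (re z) <= Cnorm z.
Proof.
unfold Cnorm. rewrite <- sqrt_Rsqr_abs. apply sqrt_le_1_alt. unfold Rsqr; nra.
Qed.

Lemma Rabs_im_le z : Rabs (im z) <= Cnorm z.
Proof.
unfold Cnorm. rewrite <- sqrt_Rsqr_abs. apply sqrt_le_1_alt. unfold Rsqr; nra.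
Qed.

Lemma Cnorm_le_abs z : Cnorm z <= Rabs (re z) + Rabs (im z).
Proof.
pose proof (Rabs_pos (re z)); pose proof (Rabs_pos (im z)).
apply Cnorm_le_sqr; [lra|].
assert (E : forall r, r * r = Rabs r * Rabs r)
  by (intros r; rewrite <- Rabs_mult, Rabs_pos_eq; nra).
rewrite (E (re z)), (E (im z)). nra.
Qed.

Lemma RtoC_add a b : RtoC (a + b) = Cadd (RtoC a) (RtoC b).
Proof. apply Cx_eq; simpl; ring. Qed.

Lemma RtoC_mul a b : RtoC (a * b) = Cmul (RtoC a) (RtoC b).
Proof. apply Cx_eq; simpl; ring. Qed.

Lemma RtoC_1 : RtoC 1 = C1.
Proof. reflexivity. Qed.

Lemma RtoC_0 : RtoC 0 = C0.
Proof. reflexivity. Qed.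

Lemma Cx_complete (u : nat -> Cx) :
  (forall eps, eps > 0 -> exists N, forall m n, (m >= N)%nat -> (n >= N)%nat ->
     Cnorm (Cadd (u m) (Copp (u n))) < eps) ->
  exists l, forall eps, eps > 0 -> exists N, forall n, (n >= N)%nat ->
     Cnorm (Cadd (u n) (Copp l)) < eps.
Proof.
intros H.
assert (Hr : Cauchy_crit (fun n => re (u n))).
{ intros eps He; destruct (H eps He) as [N HN]; exists N; intros m n Hm Hn.
  unfold Rdist. apply Rle_lt_trans with (2 := HN m n Hm Hn).
  apply (Rabs_re_le (Cadd (u m) (Copp (u n)))). }
assert (Hi : Cauchy_crit (fun n => im (u n))).
{ intros eps He; destruct (H eps He) as [N HN]; exists N; intros m n Hm Hn.
  unfold Rdist. apply Rle_lt_trans with (2 := HN m n Hm Hn).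
  apply (Rabs_im_le (Cadd (u m) (Copp (u n)))). }
destruct (R_complete _ Hr) as [a Ha], (R_complete _ Hi) as [b Hb].
exists (mkC a b); intros eps He.
destruct (Ha (eps / 2)) as [N1 H1]; [lra|].
destruct (Hb (eps / 2)) as [N2 H2]; [lra|].
exists (N1 + N2)%nat; intros n Hn.
eapply Rle_lt_trans; [apply Cnorm_le_abs|]; simpl.
specialize (H1 n ltac:(lia)); specialize (H2 n ltac:(lia)).
unfold Rdist, Rminus in *. lra.
Qed.

(** Viewing the scalars as a Banach space lets the vector lemmas on series serve complex series as
    well. It ends with [Defined] so that its operations reduce to those of [Cx]. *)
Definition CxB : CBanach.
Proof.
refine {| car := Cx; vzero := C0; vadd := Cadd; vopp := Copp; vscal := Cmul;
          vnorm := Cnorm |}; try (intros; ring).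
- apply Cnorm_ge0.
- apply Cnorm_eq0.
- apply Cnorm_mul.
- apply Cnorm_add.
- apply Cx_complete.
Defined.

(** * Vectors *)

(* The square-zero extension of the scalars by a module is a commutative ring,
   so [ring] there decides identities between vectors. *)
Definition sqz (X : CBanach) : Type := (Cx * car X)%type.
Definition sqz_c {X : CBanach} (c : Cx) : sqz X := (c, vzero).
Definition sqz_v {X : CBanach} (x : X) : sqz X := (C0, x).
Definition sqz_add {X : CBanach} (p q : sqz X) : sqz X :=
  (Cadd (fst p) (fst q), vadd (snd p) (snd q)).
Definition sqz_mul {X : CBanach} (p q : sqz X) : sqz X :=
  (Cmul (fst p) (fst q), vadd (vscal (fst p) (snd q)) (vscal (fst q) (snd p))).
Definition sqz_opp {X : CBanach} (p : sqz X) : sqz X :=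
  (Copp (fst p), vopp (snd p)).
Definition sqz_sub {X : CBanach} (p q : sqz X) : sqz X := sqz_add p (sqz_opp q).

Section VectorBasics.

Variable X : CBanach.

Lemma vadd_cancel_l (x y z : X) : vadd x y = vadd x z -> y = z.
Proof.
intros H. assert (E : vadd (vopp x) (vadd x y) = vadd (vopp x) (vadd x z)) by now rewrite H.
rewrite !vadd_assoc, (vadd_comm _ (vopp x)), vadd_opp in E.
now rewrite !(vadd_comm _ vzero), !vadd_0 in E.
Qed.

Lemma vscal_0l (x : X) : vscal C0 x = vzero.
Proof.
apply (vadd_cancel_l (vscal C0 x)). rewrite vadd_0, <- vscal_adds.
f_equal. ring.
Qed.

Lemma vscal_0r c : vscal c (vzero : X) = vzero.
Proof.
apply (vadd_cancel_l (vscal c vzero)). rewrite vadd_0, <- vscal_addv.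
now rewrite vadd_0.
Qed.

Lemma vopp_scal (x : X) : vopp x = vscal (Copp C1) x.
Proof.
apply (vadd_cancel_l x). rewrite vadd_opp.
transitivity (vadd (vscal C1 x) (vscal (Copp C1) x)); [|now rewrite vscal_1].
rewrite <- vscal_adds. rewrite <- (vscal_0l x). f_equal. ring.
Qed.

Lemma vadd_0l (x : X) : vadd vzero x = x.
Proof. rewrite vadd_comm. apply vadd_0. Qed.

Lemma vaddACA (x y z t : X) :
  vadd (vadd x y) (vadd z t) = vadd (vadd x z) (vadd y t).
Proof.
rewrite <- !vadd_assoc. f_equal. rewrite !vadd_assoc. f_equal. apply vadd_comm.
Qed.

Lemma sqz_ring : ring_theory (sqz_c C0 : sqz X) (sqz_c C1) sqz_add sqz_mul sqz_sub sqz_opp eq.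
Proof.
split; unfold sqz_c, sqz_add, sqz_mul, sqz_sub, sqz_opp; simpl.
- intros [a x]; simpl; f_equal; [ring|apply vadd_0l].
- intros [a x] [b y]; simpl; f_equal; [ring|apply vadd_comm].
- intros [a x] [b y] [c z]; simpl; f_equal; [ring|apply vadd_assoc].
- intros [a x]; simpl; f_equal; [ring|].
  now rewrite vscal_1, vscal_0r, vadd_0.
- intros [a x] [b y]; simpl; f_equal; [ring|apply vadd_comm].
- intros [a x] [b y] [c z]; simpl; f_equal; [ring|].
  rewrite !vscal_addv, !vscal_assoc, vadd_assoc.
  rewrite (Rmul_comm Cx_ring c a), (Rmul_comm Cx_ring c b). reflexivity.
- intros [a x] [b y] [c z]; simpl; f_equal; [ring|].
  rewrite !vscal_addv, !vscal_adds. apply vaddACA.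
- reflexivity.
- intros [a x]; simpl; f_equal; [ring|apply vadd_opp].
Qed.

Lemma sqz_inj (x y : X) : sqz_v x = sqz_v y -> x = y.
Proof. now injection 1. Qed.

Lemma sqz_vadd (x y : X) : sqz_v (vadd x y) = sqz_add (sqz_v x) (sqz_v y).
Proof. unfold sqz_v, sqz_add; simpl; f_equal; ring. Qed.

Lemma sqz_vopp (x : X) : sqz_v (vopp x) = sqz_opp (sqz_v x).
Proof. unfold sqz_v, sqz_opp; simpl; f_equal; ring. Qed.

Lemma sqz_vscal c (x : X) : sqz_v (vscal c x) = sqz_mul (sqz_c c) (sqz_v x).
Proof.
unfold sqz_v, sqz_c, sqz_mul; simpl; f_equal; [ring|].
now rewrite vscal_0l, vadd_0.
Qed.

Lemma sqz_v0 : sqz_v (vzero : X) = sqz_c C0.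
Proof. reflexivity. Qed.

Lemma sqz_cadd c d : sqz_c (Cadd c d) = sqz_add (sqz_c c) (sqz_c d : sqz X).
Proof. unfold sqz_c, sqz_add; simpl. now rewrite vadd_0. Qed.

Lemma sqz_cmul c d : sqz_c (Cmul c d) = sqz_mul (sqz_c c) (sqz_c d : sqz X).
Proof. unfold sqz_c, sqz_mul; simpl. now rewrite !vscal_0r, vadd_0. Qed.

Lemma sqz_copp c : sqz_c (Copp c) = sqz_opp (sqz_c c : sqz X).
Proof.
unfold sqz_c, sqz_opp; simpl. now rewrite vopp_scal, vscal_0r.
Qed.

End VectorBasics.

Ltac vector_push :=
  apply sqz_inj; unfold vsub, Csub;
  repeat rewrite ?sqz_vadd, ?sqz_vopp, ?sqz_vscal, ?sqz_v0,
    ?sqz_cadd, ?sqz_cmul, ?sqz_copp.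

Ltac vring := vector_push; ring.

(** * Finite real sums, then sums and series of vectors *)

Lemma sum_f_R0_recl (f : nat -> R) n :
  sum_f_R0 f (S n) = f O + sum_f_R0 (fun i => f (S i)) n.
Proof. exact (gsum_recl R Rplus (fun x y z => eq_sym (Rplus_assoc x y z)) f n). Qed.

Lemma sum_f_R0_cat (f : nat -> R) m n :
  sum_f_R0 f (S m + n) = sum_f_R0 f m + sum_f_R0 (fun i => f (S m + i)%nat) n.
Proof. exact (gsum_cat R Rplus (fun x y z => eq_sym (Rplus_assoc x y z)) f m n). Qed.

Lemma sum_f_R0_rev (f : nat -> R) n :
  sum_f_R0 f n = sum_f_R0 (fun i => f (n - i)%nat) n.
Proof.
exact (gsum_rev R Rplus Rplus_comm (fun x y z => eq_sym (Rplus_assoc x y z)) f n).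
Qed.

Lemma sum_f_R0_triangle (F : nat -> nat -> R) n :
  sum_f_R0 (fun j => sum_f_R0 (fun i => F i j) j) n
  = sum_f_R0 (fun i => sum_f_R0 (fun k => F i (i + k)%nat) (n - i)) n.
Proof.
exact (gsum_triangle R Rplus Rplus_comm (fun x y z => eq_sym (Rplus_assoc x y z)) F n).
Qed.

Lemma sum_f_R0_mono (f : nat -> R) m n :
  (forall i, 0 <= f i) -> (m <= n)%nat -> sum_f_R0 f m <= sum_f_R0 f n.
Proof.
intros Hf. induction 1 as [|n Hmn IH]; [lra|].
simpl. specialize (Hf (S n)). lra.
Qed.

Lemma sum_f_R0_ge0 (f : nat -> R) n :
  (forall i, (i <= n)%nat -> 0 <= f i) -> 0 <= sum_f_R0 f n.
Proof.
induction n as [|n IH]; intros Hf; simpl; [now apply Hf|].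
specialize (IH ltac:(intros; apply Hf; lia)). specialize (Hf (S n) ltac:(lia)). lra.
Qed.

Lemma sum_f_R0_scal c (f : nat -> R) n :
  sum_f_R0 (fun i => c * f i) n = c * sum_f_R0 f n.
Proof. induction n as [|n IH]; simpl; [|rewrite IH]; ring. Qed.

Lemma sum_f_R0_le (f g : nat -> R) n :
  (forall i, (i <= n)%nat -> f i <= g i) -> sum_f_R0 f n <= sum_f_R0 g n.
Proof. intros H. now apply sum_Rle. Qed.

Lemma sum_f_R0_tail (f : nat -> R) M :
  (forall i, 0 <= f i) -> (forall N, sum_f_R0 f N <= M) ->
  forall eps, eps > 0 -> exists N0, forall N L, (N0 <= N)%nat -> (N <= L)%nat ->
    sum_f_R0 f L - sum_f_R0 f N < eps.
Proof.
intros Hf HM eps He.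
assert (Hg : Un_growing (sum_f_R0 f)) by (intros n; simpl; specialize (Hf (S n)); lra).
destruct (growing_cv _ Hg) as [l Hl].
{ exists M; intros y [n ->]; apply HM. }
destruct (Hl eps He) as [N0 HN0]; exists N0; intros N L HN HL.
pose proof (growing_ineq _ _ Hg Hl L). specialize (HN0 N HN).
unfold Rdist in HN0. rewrite Rabs_minus_sym in HN0.
pose proof (Rle_abs (l - sum_f_R0 f N)). lra.
Qed.

Section Vectors.

Variable X : CBanach.

Add Ring sqz_ring_inst : (sqz_ring X).

Lemma vnorm_vzero : vnorm (vzero : X) = 0.
Proof. rewrite <- (vscal_0l X vzero), vnorm_scal, Cnorm_C0. ring. Qed.

Lemma vnorm_opp (x : X) : vnorm (vopp x) = vnorm x.
Proof. rewrite vopp_scal, vnorm_scal, Cnorm_opp, Cnorm_C1. ring. Qed.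

Lemma vnorm_vsub (x y : X) : vnorm (vsub x y) <= vnorm x + vnorm y.
Proof. unfold vsub. rewrite <- (vnorm_opp y). apply vnorm_triangle. Qed.

Lemma vsub_sym (x y : X) : vnorm (vsub x y) = vnorm (vsub y x).
Proof.
rewrite <- (vnorm_opp (vsub x y)). f_equal. vring.
Qed.

Lemma vsub_triangle (y x z : X) :
  vnorm (vsub x z) <= vnorm (vsub x y) + vnorm (vsub y z).
Proof.
replace (vsub x z) with (vadd (vsub x y) (vsub y z)) by vring.
apply vnorm_triangle.
Qed.

Lemma vnorm_le_sub (y x : X) : vnorm x <= vnorm (vsub x y) + vnorm y.
Proof.
replace x with (vadd (vsub x y) y) at 1 by vring. apply vnorm_triangle.
Qed.

Lemma vsub_eq0 (x y : X) : vnorm (vsub x y) = 0 -> x = y.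
Proof.
intros H. apply vnorm_eq0 in H. replace x with (vadd (vsub x y) y) by vring.
rewrite H. vring.
Qed.

Lemma vsub_self (x : X) : vsub x x = vzero.
Proof. vring. Qed.

Lemma vsumE (f : nat -> X) n : vsum f n = gsum X vadd f n.
Proof. induction n as [|n IH]; simpl; auto. now rewrite IH. Qed.

Lemma vsum_ext (f g : nat -> X) n :
  (forall i, (i <= n)%nat -> f i = g i) -> vsum f n = vsum g n.
Proof. rewrite !vsumE. exact (gsum_ext X vadd f g n). Qed.

Lemma vsum_add (f g : nat -> X) n :
  vsum (fun i => vadd (f i) (g i)) n = vadd (vsum f n) (vsum g n).
Proof. rewrite !vsumE. exact (gsum_add X vadd (vadd_comm X) (vadd_assoc X) f g n). Qed.

Lemma vsum_scal c (f : nat -> X) n :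
  vsum (fun i => vscal c (f i)) n = vscal c (vsum f n).
Proof.
induction n as [|n IH]; simpl; auto. now rewrite IH, vscal_addv.
Qed.

Lemma vsum_sub (f g : nat -> X) n :
  vsum (fun i => vsub (f i) (g i)) n = vsub (vsum f n) (vsum g n).
Proof. induction n as [|n IH]; simpl; auto. rewrite IH. vring. Qed.

Lemma vsum_scal_vec (f : nat -> Cx) (x : X) n :
  vsum (fun i => vscal (f i) x) n = vscal (Csum f n) x.
Proof. induction n as [|n IH]; simpl; auto. now rewrite IH, vscal_adds. Qed.

Lemma vsum_exchange (F : nat -> nat -> X) m n :
  vsum (fun i => vsum (fun j => F i j) n) m
  = vsum (fun j => vsum (fun i => F i j) m) n.
Proof.
rewrite !vsumE.
rewrite (gsum_ext _ _ _ _ m (fun i _ => vsumE (fun j => F i j) n)).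
rewrite (gsum_ext _ _ _ _ n (fun j _ => vsumE (fun i => F i j) m)).
exact (gsum_exchange X vadd (vadd_comm X) (vadd_assoc X) F m n).
Qed.

Lemma vsum_triangle (F : nat -> nat -> X) n :
  vsum (fun j => vsum (fun i => F i j) j) n
  = vsum (fun i => vsum (fun k => F i (i + k)%nat) (n - i)) n.
Proof.
rewrite !vsumE.
rewrite (gsum_ext _ _ _ _ n (fun j _ => vsumE (fun i => F i j) j)).
rewrite (gsum_ext _ _ _ _ n (fun i _ => vsumE (fun k => F i (i + k)%nat) (n - i))).
exact (gsum_triangle X vadd (vadd_comm X) (vadd_assoc X) F n).
Qed.

Lemma vsum_recl (f : nat -> X) n :
  vsum f (S n) = vadd (f O) (vsum (fun i => f (S i)) n).
Proof. rewrite !vsumE. exact (gsum_recl X vadd (vadd_assoc X) f n). Qed.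

Lemma vsum_cat (f : nat -> X) m n :
  vsum f (S m + n) = vadd (vsum f m) (vsum (fun i => f (S m + i)%nat) n).
Proof. rewrite !vsumE. exact (gsum_cat X vadd (vadd_assoc X) f m n). Qed.

Lemma vsum_norm (f : nat -> X) n :
  vnorm (vsum f n) <= sum_f_R0 (fun i => vnorm (f i)) n.
Proof.
induction n as [|n IH]; simpl; [lra|].
eapply Rle_trans; [apply vnorm_triangle|]. lra.
Qed.

Lemma vsum_norm_le (f : nat -> X) (g : nat -> R) n :
  (forall i, (i <= n)%nat -> vnorm (f i) <= g i) ->
  vnorm (vsum f n) <= sum_f_R0 g n.
Proof.
intros H. eapply Rle_trans; [apply vsum_norm|]. now apply sum_f_R0_le.
Qed.

Lemma vsum_zero (f : nat -> X) n :
  (forall i, (i <= n)%nat -> f i = vzero) -> vsum f n = vzero.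
Proof.
induction n as [|n IH]; intros H; simpl; auto.
rewrite IH, H; auto. apply vadd_0.
Qed.

Definition vser (u : nat -> X) (l : X) : Prop := vconv (vsum u) l.

Lemma vconv_le (u : nat -> X) l M :
  vconv u l -> (exists N, forall n, (n >= N)%nat -> vnorm (u n) <= M) -> vnorm l <= M.
Proof.
intros Hu [N HN]. apply Rnot_lt_le; intros Hlt.
destruct (Hu (vnorm l - M)) as [N1 H1]; [lra|].
specialize (H1 (N + N1)%nat ltac:(lia)). specialize (HN (N + N1)%nat ltac:(lia)).
pose proof (vnorm_le_sub (u (N + N1)%nat) l) as H. rewrite vsub_sym in H. lra.
Qed.

Lemma vconv_sub (u v : nat -> X) l k :
  vconv u l -> vconv v k -> vconv (fun n => vsub (u n) (v n)) (vsub l k).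
Proof.
intros Hu Hv eps He.
destruct (Hu (eps / 2)) as [N1 H1]; [lra|].
destruct (Hv (eps / 2)) as [N2 H2]; [lra|].
exists (N1 + N2)%nat; intros n Hn.
replace (vsub (vsub (u n) (v n)) (vsub l k))
  with (vsub (vsub (u n) l) (vsub (v n) k)) by vring.
eapply Rle_lt_trans; [apply vnorm_vsub|].
specialize (H1 n ltac:(lia)); specialize (H2 n ltac:(lia)). lra.
Qed.

Lemma vconv_unique (u : nat -> X) l k : vconv u l -> vconv u k -> l = k.
Proof.
intros Hl Hk. apply vsub_eq0. apply Rle_antisym; [|apply vnorm_ge0].
apply (vconv_le _ _ _ (vconv_sub _ _ _ _ Hl Hk)). exists O; intros n _.
rewrite vsub_self, vnorm_vzero. lra.
Qed.

Lemma vconv_const (x : X) : vconv (fun _ => x) x.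
Proof. intros eps He; exists O; intros n _. rewrite vsub_self, vnorm_vzero; lra. Qed.

Lemma vconv_ext (u v : nat -> X) l :
  (forall n, u n = v n) -> vconv u l -> vconv v l.
Proof.
intros H Hu eps He. destruct (Hu eps He) as [N HN]; exists N; intros n Hn.
rewrite <- H; auto.
Qed.

Lemma vser_sub (u v : nat -> X) l k :
  vser u l -> vser v k -> vser (fun n => vsub (u n) (v n)) (vsub l k).
Proof.
intros Hu Hv. apply vconv_ext with (2 := vconv_sub _ _ _ _ Hu Hv).
intros n. now rewrite vsum_sub.
Qed.

Lemma vser_abs (u : nat -> X) M :
  (forall N, sum_f_R0 (fun i => vnorm (u i)) N <= M) ->
  exists l, vser u l /\ vnorm l <= M.
Proof.
intros HM.
assert (Hl : exists l, vser u l).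
{ apply vcomplete. intros eps He.
  destruct (sum_f_R0_tail _ M (fun i => vnorm_ge0 _ (u i)) HM eps He) as [N0 HN].
  exists N0.
  assert (K : forall m n, (N0 <= n)%nat -> (n <= m)%nat ->
    vnorm (vadd (vsum u m) (vopp (vsum u n))) < eps).
  { intros m n Hn Hm. eapply Rle_lt_trans; [|exact (HN n m Hn Hm)].
    destruct (Nat.eq_dec n m) as [->|Hne].
    - fold (vsub (vsum u m) (vsum u m)). rewrite vsub_self, vnorm_vzero. lra.
    - replace m with (S n + (m - S n))%nat by lia.
      set (p := (m - S n)%nat).
      assert (E := sum_f_R0_cat
        (fun i => vnorm (u i)) n p).
      rewrite E, vsum_cat.
      replace (vadd (vadd (vsum u n) (vsum (fun i => u (S n + i)%nat) p)) (vopp (vsum u n)))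
        with (vsum (fun i => u (S n + i)%nat) p) by vring.
      pose proof (vsum_norm (fun i => u (S n + i)%nat) p). lra. }
  intros m n Hm Hn. destruct (Nat.le_ge_cases n m) as [Hle|Hle].
  - apply K; lia.
  - fold (vsub (vsum u m) (vsum u n)). rewrite vsub_sym. apply K; lia. }
destruct Hl as [l Hl]; exists l; split; auto.
apply (vconv_le _ _ _ Hl). exists O; intros n _.
eapply Rle_trans; [apply vsum_norm|]; auto.
Qed.

Lemma vser_norm_le (u : nat -> X) l M :
  vser u l -> (forall N, sum_f_R0 (fun i => vnorm (u i)) N <= M) -> vnorm l <= M.
Proof.
intros Hu HM. apply (vconv_le _ _ _ Hu). exists O; intros n _.
eapply Rle_trans; [apply vsum_norm|]; auto.
Qed.

End Vectors.

Arguments vser {X}.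

Lemma CsumE (f : nat -> Cx) : Csum f = @vsum CxB f.
Proof.
extensionality n. induction n as [|n IH]; simpl; auto. now rewrite IH.
Qed.

(** [Rlim] is an [epsilon] choice and carries information only once a limit is known to exist;
    uniqueness of limits then pins it down. *)
Lemma Clim_spec (u : nat -> CxB) (l : CxB) : vconv u l -> Clim u = l.
Proof.
intros H.
assert (U : forall (v : nat -> R) k, Un_cv v k -> Rlim v = k).
{ intros v k Hv. apply (UL_sequence v); auto. unfold Rlim.
  apply epsilon_spec. now exists k. }
apply Cx_eq; simpl; apply U; intros eps He; destruct (H eps He) as [N HN];
  exists N; intros n Hn; eapply Rle_lt_trans; [|exact (HN n Hn)| |exact (HN n Hn)];
  [apply (Rabs_re_le (Csub (u n) l))|apply (Rabs_im_le (Csub (u n) l))].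
Qed.

(** * Cesàro numbers *)

Definition rconv (c d : nat -> R) (n : nat) : R :=
  sum_f_R0 (fun j => c (n - j)%nat * d j) n.

Lemma rconv_ext c c' d d' n :
  (forall i, (i <= n)%nat -> c i = c' i) ->
  (forall i, (i <= n)%nat -> d i = d' i) -> rconv c d n = rconv c' d' n.
Proof. exact (gconv_ext R R Rplus Rmult c c' d d' n). Qed.

Lemma rconv_assoc c d e n : rconv c (rconv d e) n = rconv (rconv c d) e n.
Proof.
apply (gconv_assoc R R Rplus Rmult Rplus Rmult); intros; ring.
Qed.

Lemma rconv_comm c d n : rconv c d n = rconv d c n.
Proof.
unfold rconv.
assert (E := sum_f_R0_rev
  (fun j => c (n - j)%nat * d j) n).
rewrite E.
apply sum_eq; intros i Hi. replace (n - (n - i))%nat with i by lia. ring.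
Qed.

Lemma rconv_pow r c d n :
  rconv (fun i => r ^ i * c i) (fun i => r ^ i * d i) n = r ^ n * rconv c d n.
Proof.
unfold rconv. rewrite <- sum_f_R0_scal. apply sum_eq; intros i Hi.
replace (r ^ n) with (r ^ (n - i) * r ^ i); [ring|].
rewrite <- pow_add. f_equal; lia.
Qed.

Lemma rconv_scal_l a c d n : rconv (fun i => a * c i) d n = a * rconv c d n.
Proof.
unfold rconv. rewrite <- sum_f_R0_scal. apply sum_eq; intros; ring.
Qed.

Lemma rconv_scal_r a c d n : rconv c (fun i => a * d i) n = a * rconv c d n.
Proof.
unfold rconv. rewrite <- sum_f_R0_scal. apply sum_eq; intros; ring.
Qed.

Lemma rconv_deriv c d n :
  INR n * rconv c d n
  = rconv (fun i => INR i * c i) d n + rconv c (fun i => INR i * d i) n.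
Proof.
unfold rconv. rewrite <- sum_f_R0_scal, <- plus_sum. apply sum_eq; intros i Hi.
rewrite minus_INR by lia. ring.
Qed.

Lemma kk_step g n : INR (S n) * kk g (S n) = (g + INR n) * kk g n.
Proof.
change (kk g (S n)) with (kk g n * (g + INR n) / INR (S n)).
field. apply not_0_INR; lia.
Qed.

Lemma INR_S_inv x n : 0 <= INR (S n) * x -> 0 <= x.
Proof. intros H. pose proof (lt_0_INR (S n) ltac:(lia)). nra. Qed.

Lemma kk_ge0 g n : 0 <= g -> 0 <= kk g n.
Proof.
intros Hg. induction n as [|n IH]; [simpl; lra|].
apply (INR_S_inv _ n). rewrite kk_step. pose proof (pos_INR n). nra.
Qed.

Lemma kk_pos g n : 0 < g -> 0 < kk g n.
Proof.
intros Hg. induction n as [|n IH]; [simpl; lra|].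
pose proof (kk_step g n) as E. pose proof (lt_0_INR (S n) ltac:(lia)).
pose proof (pos_INR n). assert (0 < (g + INR n) * kk g n) by nra. nra.
Qed.

Lemma kk_1 n : kk 1 n = 1.
Proof.
induction n as [|n IH]; auto. apply Rmult_eq_reg_l with (INR (S n)).
- rewrite kk_step, IH, S_INR. ring.
- apply not_0_INR; lia.
Qed.

Lemma kk_0_S n : kk 0 (S n) = 0.
Proof.
induction n as [|n IH]; [simpl; field|].
apply Rmult_eq_reg_l with (INR (S (S n))).
- rewrite kk_step, IH. ring.
- apply not_0_INR; lia.
Qed.

(* The generating function of [kk g] is [(1 - z)^(-g)], the solution of
   [(1 - z) y' = g y], and both sides below satisfy the equation for [a + b]. *)
Lemma kk_conv a b n : rconv (kk a) (kk b) n = kk (a + b) n.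
Proof.
induction n as [|n IH]; [unfold rconv; simpl; ring|].
apply Rmult_eq_reg_l with (INR (S n)); [|apply not_0_INR; lia].
rewrite kk_step, <- IH, rconv_deriv.
unfold rconv at 1.
rewrite (tech5 (fun j => INR (S n - j) * kk a (S n - j) * kk b j)).
assert (E := sum_f_R0_recl
  (fun j => kk a (S n - j) * (INR j * kk b j)) n).
unfold rconv at 1. rewrite E.
rewrite Nat.sub_diag. change (INR 0) with 0.
replace (sum_f_R0 (fun l => INR (S n - l) * kk a (S n - l) * kk b l) n)
  with (sum_f_R0 (fun j => (a + INR (n - j)) * (kk a (n - j) * kk b j)) n).
2:{ apply sum_eq; intros i Hi. replace (S n - i)%nat with (S (n - i)) by lia.
    rewrite kk_step. ring. }
replace (sum_f_R0 (fun i => kk a (S n - S i) * (INR (S i) * kk b (S i))) n)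
  with (sum_f_R0 (fun j => (b + INR j) * (kk a (n - j) * kk b j)) n).
2:{ apply sum_eq; intros i Hi. rewrite kk_step. simpl (S n - S i)%nat. ring. }
unfold rconv. rewrite <- sum_f_R0_scal.
rewrite !Rmult_0_l, Rmult_0_r, Rplus_0_r, Rplus_0_l, <- plus_sum.
apply sum_eq; intros i Hi. rewrite minus_INR by lia. ring.
Qed.

Lemma kk_sum a n : sum_f_R0 (kk a) n = kk (a + 1) n.
Proof.
rewrite <- kk_conv, rconv_comm. unfold rconv. apply sum_eq; intros i Hi.
rewrite kk_1. ring.
Qed.

Lemma kk_le_param g h n : 0 <= g -> g <= h -> kk g n <= kk h n.
Proof.
intros Hg Hh. induction n as [|n IH]; [simpl; lra|].
pose proof (lt_0_INR (S n) ltac:(lia)).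
apply Rmult_le_reg_l with (INR (S n)); auto. rewrite !kk_step.
pose proof (kk_ge0 g n Hg). pose proof (pos_INR n). nra.
Qed.

Lemma kk_le_index g m n : 1 <= g -> (m <= n)%nat -> kk g m <= kk g n.
Proof.
intros Hg. induction 1 as [|n Hmn IH]; [lra|].
apply Rle_trans with (1 := IH).
pose proof (lt_0_INR (S n) ltac:(lia)).
apply Rmult_le_reg_l with (INR (S n)); auto. rewrite kk_step, S_INR.
pose proof (kk_ge0 g n). pose proof (pos_INR n). nra.
Qed.

(** Factor by factor, [|i - g| <= i + g]. *)
Lemma kk_opp_abs g n : 0 <= g -> Rabs (kk (- g) n) <= kk g n.
Proof.
intros Hg. induction n as [|n IH]; [simpl; rewrite Rabs_R1; lra|].
pose proof (lt_0_INR (S n) ltac:(lia)).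
apply Rmult_le_reg_l with (INR (S n)); auto.
rewrite <- (Rabs_pos_eq (INR (S n))) at 1 by lra.
rewrite <- Rabs_mult, !kk_step, Rabs_mult.
pose proof (pos_INR n). pose proof (Rabs_pos (kk (- g) n)).
apply Rmult_le_compat; auto; [apply Rabs_pos|].
apply Rabs_le; lra.
Qed.

(** The quotient [g / (g + n)] tends to 0: this is what makes any fixed initial segment negligible
    in a Cesàro mean. *)
Lemma kk_ratio g n : kk g n * (g + INR n) = g * kk (g + 1) n.
Proof.
induction n as [|n IH]; [simpl; ring|].
apply Rmult_eq_reg_l with (INR (S n)); [|apply not_0_INR; lia].
rewrite <- Rmult_assoc, kk_step.
replace (INR (S n) * (g * kk (g + 1) (S n)))
  with (g * (INR (S n) * kk (g + 1) (S n))) by ring.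
rewrite kk_step, S_INR.
replace (g * ((g + 1 + INR n) * kk (g + 1) n))
  with ((g * kk (g + 1) n) * (g + 1 + INR n)) by ring.
rewrite <- IH. ring.
Qed.

(** The equation [z y' = g (z / (1 - z)) y] satisfied by [(1 - z)^(-g)], read on coefficients; it is
    used for [g] of either sign. *)
Lemma kk_deriv g n :
  INR n * kk g n = g * rconv (fun i => match i with O => 0 | S _ => 1 end) (kk g) n.
Proof.
destruct n as [|n]; [unfold rconv; simpl; ring|].
rewrite kk_step, Rmult_comm, kk_ratio, <- kk_sum. f_equal.
unfold rconv. rewrite tech5, Nat.sub_diag, Rmult_0_l, Rplus_0_r.
apply sum_eq; intros i Hi. replace (S n - i)%nat with (S (n - i)) by lia. ring.
Qed.

(* Coefficients of [((1 - r z) / (1 - z))^g]. *)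
Definition abel_coef (g r : R) : nat -> R :=
  rconv (kk g) (fun i => r ^ i * kk (- g) i).

(* Logarithmic differentiation:
   [p'/p = g (1/(1 - z) - r/(1 - r z))] has nonnegative coefficients. *)
Lemma abel_coef_ge0 g r n : 0 <= g -> 0 <= r <= 1 -> 0 <= abel_coef g r n.
Proof.
intros Hg Hr.
set (s := fun i => match i with O => 0 | S _ => 1 end).
assert (D : forall n, INR n * abel_coef g r n
  = g * rconv (fun i => (1 - r ^ i) * s i) (abel_coef g r) n).
{ clear n; intros n. unfold abel_coef at 1. rewrite rconv_deriv.
  rewrite (rconv_ext _ (fun i => g * rconv s (kk g) i)
    _ (fun i => r ^ i * kk (- g) i) n (fun i _ => kk_deriv g i)) by auto.
  rewrite rconv_scal_l, <- rconv_assoc.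
  rewrite (rconv_ext (kk g) (kk g) _
    (fun i => - g * rconv (fun i => r ^ i * s i) (fun i => r ^ i * kk (- g) i) i) n);
    auto.
  2:{ intros i _. rewrite rconv_pow. pose proof (kk_deriv (- g) i) as E.
      fold s in E.
      replace (INR i * (r ^ i * kk (- g) i)) with (r ^ i * (INR i * kk (- g) i)) by ring.
      rewrite E. ring. }
  rewrite rconv_scal_r, (rconv_assoc (kk g)).
  rewrite (rconv_ext (rconv (kk g) (fun i => r ^ i * s i))
    (rconv (fun i => r ^ i * s i) (kk g)) (fun i => r ^ i * kk (- g) i)
    (fun i => r ^ i * kk (- g) i) n (fun i _ => rconv_comm _ _ i)) by auto.
  rewrite <- rconv_assoc. fold (abel_coef g r).
  replace (g * rconv s (abel_coef g r) n + - g * rconv (fun i => r ^ i * s i) (abel_coef g r) n)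
    with (g * (rconv s (abel_coef g r) n - rconv (fun i => r ^ i * s i) (abel_coef g r) n))
    by ring.
  f_equal. unfold rconv. rewrite <- minus_sum. apply sum_eq; intros; ring. }
induction n as [n IH] using lt_wf_ind.
destruct n as [|n]; [unfold abel_coef, rconv; simpl; lra|].
apply (INR_S_inv _ n). rewrite D. apply Rmult_le_pos; auto.
(* The unknown coefficient of index [S n] drops out since [s 0 = 0]; only earlier ones, nonnegative
   by induction, remain. *)
unfold rconv. rewrite tech5, Nat.sub_diag. unfold s at 2.
rewrite Rmult_0_r, Rmult_0_l, Rplus_0_r.
apply sum_f_R0_ge0; intros i Hi.
replace (S n - i)%nat with (S (n - i)) by lia. unfold s.
assert (r ^ S (n - i) <= 1) by (rewrite <- (pow1 (S (n - i))); now apply pow_incr).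
specialize (IH i ltac:(lia)). nra.
Qed.

(** As power series, [((1 - r z)/(1 - z))^g (1 - r z)^(-g-1) = (1 - z)^(-g) / (1 - r z)], and the
    coefficients [r^i] of the last factor are at most those of [1 / (1 - z)]. *)
Lemma abel_coef_conv g r n :
  0 <= g -> 0 <= r <= 1 ->
  rconv (abel_coef g r) (fun i => r ^ i * kk (g + 1) i) n <= kk (g + 1) n.
Proof.
intros Hg Hr. unfold abel_coef. rewrite <- rconv_assoc, <- kk_conv.
unfold rconv at 1 3. apply sum_f_R0_le; intros i Hi.
apply Rmult_le_compat_l; [now apply kk_ge0|].
rewrite rconv_pow, kk_conv. replace (- g + (g + 1)) with 1 by ring.
rewrite kk_1, Rmult_1_r. rewrite <- (pow1 i). now apply pow_incr.
Qed.

(** * Fractional summation and differences on one-sided sequences *)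

Definition shift (F : nat -> Cx) (n : nat) : nat -> Cx := fun i => F (n + i)%nat.

(** The fractional sum of order [g] on a half-line. Both halves of a two-sided sequence reduce to
    it, the negative one by reflection. *)
Definition Iop (g : R) (F : nat -> Cx) (n : nat) : Cx :=
  Clim (Csum (fun i => Cmul (RtoC (kk g i)) (F (n + i)%nat))).

(** The bound is explicit because it becomes [A_norm] in the final estimates. *)
Definition wsumm_by (g : R) (F : nat -> Cx) (M : R) : Prop :=
  forall N, sum_f_R0 (fun i => kk g i * Cnorm (F i)) N <= M.

Definition wsumm (g : R) (F : nat -> Cx) : Prop := exists M, wsumm_by g F M.

Lemma Iop_shift g F n i : Iop g (shift F n) i = Iop g F (n + i).
Proof.
unfold Iop, shift. do 2 f_equal. extensionality j. now rewrite Nat.add_assoc.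
Qed.

Lemma Iop_unique g F n l :
  @vser CxB (fun i => Cmul (RtoC (kk g i)) (F (n + i)%nat)) l -> Iop g F n = l.
Proof. intros H. unfold Iop. rewrite CsumE. now apply Clim_spec. Qed.

Lemma Iop_spec_by g F n M :
  0 <= g -> wsumm_by g (shift F n) M ->
  @vser CxB (fun i => Cmul (RtoC (kk g i)) (F (n + i)%nat)) (Iop g F n)
  /\ Cnorm (Iop g F n) <= M.
Proof.
intros Hg HM.
destruct (vser_abs CxB (fun i => Cmul (RtoC (kk g i)) (F (n + i)%nat)) M) as [l [H1 H2]].
{ intros N. eapply Rle_trans; [|apply (HM N)]. right.
  apply sum_eq; intros i Hi. simpl.
  now rewrite Cnorm_mul, Cnorm_RtoC, Rabs_pos_eq by now apply kk_ge0. }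
now rewrite (Iop_unique _ _ _ _ H1).
Qed.

Lemma Iop_spec g F n :
  0 <= g -> wsumm g (shift F n) ->
  @vser CxB (fun i => Cmul (RtoC (kk g i)) (F (n + i)%nat)) (Iop g F n).
Proof. intros Hg [M HM]. now apply (Iop_spec_by g F n M). Qed.

Lemma wsumm_le g h F : 0 <= g -> g <= h -> wsumm h F -> wsumm g F.
Proof.
intros Hg Hh [M HM]; exists M; intros N. eapply Rle_trans; [|apply (HM N)].
apply sum_f_R0_le; intros i _. apply Rmult_le_compat_r; [apply Cnorm_ge0|].
now apply kk_le_param.
Qed.

(** For [g >= 1] the weights [kk g] increase, so dropping initial terms and lowering indices can
    only decrease the sum. *)
Lemma wsumm_by_shift g F n M : 1 <= g -> wsumm_by g F M -> wsumm_by g (shift F n) M.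
Proof.
intros Hg HM N. eapply Rle_trans; [|apply (HM (n + N)%nat)].
assert (Hpos : forall i, 0 <= kk g i * Cnorm (F i))
  by (intros; apply Rmult_le_pos; [apply kk_ge0; lra|apply Cnorm_ge0]).
apply Rle_trans with (sum_f_R0 (fun i => kk g (n + i) * Cnorm (F (n + i)%nat)) N).
{ apply sum_f_R0_le; intros i _. apply Rmult_le_compat_r; [apply Cnorm_ge0|].
  apply kk_le_index; auto; lia. }
destruct n as [|n]; [simpl; lra|].
assert (E := sum_f_R0_cat
  (fun i => kk g i * Cnorm (F i)) n N).
rewrite E.
pose proof (sum_f_R0_ge0 (fun i => kk g i * Cnorm (F i)) n (fun i _ => Hpos i)). lra.
Qed.

Lemma wsumm_shift g F n : 1 <= g -> wsumm g F -> wsumm g (shift F n).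
Proof. intros Hg [M HM]; exists M. now apply wsumm_by_shift. Qed.

Lemma wsumm_shift_le g h F n :
  0 <= g -> g <= h -> 1 <= h -> wsumm h F -> wsumm g (shift F n).
Proof. intros. apply wsumm_le with h; auto. now apply wsumm_shift. Qed.

Lemma wsumm_sub g F H :
  0 <= g -> wsumm g F -> wsumm g H -> wsumm g (fun n => Csub (F n) (H n)).
Proof.
intros Hg [M HM] [P HP]; exists (M + P); intros N.
eapply Rle_trans; [|apply Rplus_le_compat; [apply (HM N)|apply (HP N)]].
rewrite <- plus_sum. apply sum_f_R0_le; intros i _.
rewrite <- Rmult_plus_distr_l. apply Rmult_le_compat_l; [now apply kk_ge0|].
apply (vnorm_vsub CxB).
Qed.

Lemma Iop_sub g F H n :
  0 <= g -> wsumm g (shift F n) -> wsumm g (shift H n) ->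
  Iop g (fun n => Csub (F n) (H n)) n = Csub (Iop g F n) (Iop g H n).
Proof.
intros Hg HF HH. apply Iop_unique.
pose proof (vser_sub CxB _ _ _ _ (Iop_spec g F n Hg HF) (Iop_spec g H n Hg HH)) as E.
eapply vconv_ext; [|exact E]. intros N. apply vsum_ext; intros i _.
unfold vsub; simpl. unfold Csub. ring.
Qed.

Lemma Un_cv_sum (a : nat -> nat -> R) (b : nat -> R) P :
  (forall i, Un_cv (a i) (b i)) ->
  Un_cv (fun L => sum_f_R0 (fun i => a i L) P) (sum_f_R0 b P).
Proof.
intros H. induction P as [|P IH]; simpl; auto. now apply CV_plus.
Qed.

Lemma Un_cv_const c : Un_cv (fun _ => c) c.
Proof. intros eps He; exists O; intros. now rewrite Rdist_eq. Qed.

Lemma Un_cv_vnorm (X : CBanach) (u : nat -> X) l :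
  vconv u l -> Un_cv (fun n => vnorm (u n)) (vnorm l).
Proof.
intros H eps He. destruct (H eps He) as [N HN]; exists N; intros n Hn.
specialize (HN n Hn). unfold Rdist. apply Rabs_def1.
- pose proof (vnorm_le_sub X l (u n)). lra.
- pose proof (vnorm_le_sub X (u n) l) as E. rewrite vsub_sym in E. lra.
Qed.

(** The rectangle of summation lies in the triangle [i + l <= P + L], and on each antidiagonal the
    weights add up to [kk (g + h)] by [kk_conv]. *)
Lemma kk_double_sum_le g h (f : nat -> R) P L :
  0 <= g -> 0 <= h -> (forall i, 0 <= f i) ->
  sum_f_R0 (fun i => kk g i * sum_f_R0 (fun l => kk h l * f (i + l)%nat) L) P
  <= sum_f_R0 (fun n => kk (g + h) n * f n) (P + L).
Proof.
intros Hg Hh Hf.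
replace (sum_f_R0 (fun n => kk (g + h) n * f n) (P + L)) with
  (sum_f_R0 (fun n => sum_f_R0 (fun i => kk g i * (kk h (n - i) * f n)) n) (P + L)).
2:{ apply sum_eq; intros n _. rewrite Rplus_comm, <- kk_conv.
    unfold rconv. rewrite Rmult_comm, <- sum_f_R0_scal.
    apply sum_eq; intros; ring. }
assert (E := sum_f_R0_triangle
  (fun i n => kk g i * (kk h (n - i) * f n)) (P + L)).
rewrite E.
assert (Hpos : forall i l, 0 <= kk g i * (kk h (i + l - i) * f (i + l)%nat)).
{ intros. repeat apply Rmult_le_pos; auto; now apply kk_ge0. }
apply Rle_trans with (sum_f_R0 (fun i => sum_f_R0 (fun l =>
  kk g i * (kk h (i + l - i) * f (i + l)%nat)) (P + L - i)) P).
- apply sum_f_R0_le; intros i Hi. rewrite <- sum_f_R0_scal.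
  eapply Rle_trans; [|apply sum_f_R0_mono with (m := L); [apply Hpos|lia]].
  right; apply sum_eq; intros l _. now replace (i + l - i)%nat with l by lia.
- apply sum_f_R0_mono; [|lia]. intros i; apply sum_f_R0_ge0; intros; apply Hpos.
Qed.

(** The finite double sum inequality, after a limit in the inner index. Thus [Iop h] is a
    contraction from the weight [kk (g + h)] to the weight [kk g]. *)
Lemma Iop_bound g h F M :
  0 <= g -> 0 <= h -> (forall i, wsumm h (shift F i)) -> wsumm_by (g + h) F M ->
  wsumm_by g (Iop h F) M.
Proof.
intros Hg Hh Hs HM P.
apply (@Rle_cv_lim
  (fun L => sum_f_R0 (fun i => kk g i * Cnorm (@vsum CxB
      (fun l => Cmul (RtoC (kk h l)) (F (i + l)%nat)) L)) P)
  (fun _ => M)); [|apply Un_cv_sum|apply Un_cv_const].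
- intros L. eapply Rle_trans; [|apply (HM (P + L)%nat)].
  eapply Rle_trans; [|apply kk_double_sum_le; auto; intros; apply Cnorm_ge0].
  apply sum_f_R0_le; intros i _. apply Rmult_le_compat_l; [now apply kk_ge0|].
  apply (vsum_norm_le CxB). intros l _. simpl.
  rewrite Cnorm_mul, Cnorm_RtoC, Rabs_pos_eq by now apply kk_ge0. lra.
- intros i. apply CV_mult; [apply Un_cv_const|].
  exact (Un_cv_vnorm CxB _ _ (Iop_spec h F i Hh (Hs i))).
Qed.

(** The tail of [F] beyond [N], without reindexing: what remains of a fractional sum once the
    indices up to [N] are taken out. *)
Definition cut (N : nat) (F : nat -> Cx) : nat -> Cx :=
  fun n => if Nat.leb n N then C0 else F n.

Lemma cut_norm_le N F n : Cnorm (cut N F n) <= Cnorm (F n).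
Proof.
unfold cut. destruct (Nat.leb n N); [rewrite Cnorm_C0; apply Cnorm_ge0|lra].
Qed.

Lemma cut_sum (k : nat -> R) F N L :
  sum_f_R0 (fun i => k i * Cnorm (cut N F i)) (N + L)
  = sum_f_R0 (fun i => k i * Cnorm (F i)) (N + L) - sum_f_R0 (fun i => k i * Cnorm (F i)) N.
Proof.
induction L as [|L IH].
- rewrite Nat.add_0_r.
  rewrite (sum_eq _ (fun _ => 0)).
  + rewrite sum_eq_R0; auto; ring.
  + intros i Hi. unfold cut. destruct (Nat.leb_spec i N); [|lia].
    rewrite Cnorm_C0; ring.
- rewrite Nat.add_succ_r, !tech5, IH. unfold cut.
  destruct (Nat.leb_spec (S (N + L)) N); [lia|]. ring.
Qed.

Lemma Iop_cut h F N i :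
  0 <= h -> wsumm h (shift F i) -> (i <= N)%nat ->
  Cadd (Csum (fun l => Cmul (RtoC (kk h l)) (F (i + l)%nat)) (N - i)) (Iop h (cut N F) i)
  = Iop h F i.
Proof.
intros Hh Hs Hi.
assert (Hc : wsumm h (shift (cut N F) i)).
{ destruct Hs as [M HM]; exists M; intros P. eapply Rle_trans; [|apply (HM P)].
  apply sum_f_R0_le; intros l _. apply Rmult_le_compat_l; [now apply kk_ge0|].
  unfold shift; apply cut_norm_le. }
pose proof (vser_sub CxB _ _ _ _ (Iop_spec h F i Hh Hs) (Iop_spec h _ i Hh Hc)) as E1.
assert (E2 : @vser CxB
  (fun l => @vsub CxB (Cmul (RtoC (kk h l)) (F (i + l)%nat))
                 (Cmul (RtoC (kk h l)) (cut N F (i + l)%nat)))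
  (@vsum CxB (fun l => Cmul (RtoC (kk h l)) (F (i + l)%nat)) (N - i))).
{ intros eps He. exists (N - i)%nat; intros n Hn.
  replace n with (N - i + (n - (N - i)))%nat by lia.
  generalize (n - (N - i))%nat; intros p; clear n Hn.
  replace (@vsum CxB (fun l => @vsub CxB (Cmul (RtoC (kk h l)) (F (i + l)%nat))
                 (Cmul (RtoC (kk h l)) (cut N F (i + l)%nat))) (N - i + p))
    with (@vsum CxB (fun l => Cmul (RtoC (kk h l)) (F (i + l)%nat)) (N - i)).
  - rewrite vsub_self, vnorm_vzero; auto.
  - symmetry. induction p as [|p IH].
    + rewrite Nat.add_0_r. apply vsum_ext; intros l Hl. unfold cut.
      destruct (Nat.leb_spec (i + l) N); [|lia]. unfold vsub; simpl. ring.
    + rewrite Nat.add_succ_r. cbn [vsum]. rewrite IH. unfold cut.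
      destruct (Nat.leb_spec (i + S (N - i + p)) N); [lia|].
      rewrite vsub_self. apply vadd_0. }
rewrite CsumE. rewrite <- (vconv_unique CxB _ _ _ E1 E2).
unfold vsub; simpl. ring.
Qed.

(** Semigroup law. With all indices cut at [N], exchanging sums over a triangle gives exactly the
    partial sum of order [g + h]; the rest is the same expression for the tail [cut N F], which
    [Iop_bound] makes small. *)
Lemma Iop_comp g h F :
  0 <= g -> 0 <= h -> (forall i, wsumm h (shift F i)) -> wsumm (g + h) F ->
  @vser CxB (fun i => Cmul (RtoC (kk g i)) (Iop h F i)) (Iop (g + h) F 0).
Proof.
intros Hg Hh Hs [M HM] eps He.
assert (Hgh : 0 <= g + h) by lra.
destruct (Iop_spec (g + h) F 0 Hgh (ex_intro _ M HM) (eps / 2)) as [N1 H1]; [lra|].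
destruct (sum_f_R0_tail (fun i => kk (g + h) i * Cnorm (F i)) M) with (eps := eps / 2)
  as [N2 H2]; auto; try lra.
{ intros. apply Rmult_le_pos; [now apply kk_ge0|apply Cnorm_ge0]. }
exists (N1 + N2)%nat; intros N HN.
assert (E : @vsum CxB (fun i => Cmul (RtoC (kk g i)) (Iop h F i)) N
  = @vadd CxB (@vsum CxB (fun n => Cmul (RtoC (kk (g + h) n)) (F n)) N)
         (@vsum CxB (fun i => Cmul (RtoC (kk g i)) (Iop h (cut N F) i)) N)).
{ rewrite (vsum_ext CxB _ (fun i => @vadd CxB
    (@vsum CxB (fun l => Cmul (Cmul (RtoC (kk g i)) (RtoC (kk h l))) (F (i + l)%nat)) (N - i))
    (Cmul (RtoC (kk g i)) (Iop h (cut N F) i)))).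
  - rewrite vsum_add. f_equal.
    rewrite <- (vsum_ext CxB (fun i => @vsum CxB (fun l =>
      Cmul (Cmul (RtoC (kk g i)) (RtoC (kk h (i + l - i)))) (F (i + l)%nat)) (N - i))).
    2:{ intros i Hi. apply vsum_ext; intros l Hl.
        now replace (i + l - i)%nat with l by lia. }
    rewrite <- (vsum_triangle CxB (fun i n =>
      Cmul (Cmul (RtoC (kk g i)) (RtoC (kk h (n - i)))) (F n))).
    apply vsum_ext; intros n Hn.
    rewrite (vsum_scal_vec CxB (fun i => Cmul (RtoC (kk g i)) (RtoC (kk h (n - i)))) (F n)).
    simpl. f_equal. rewrite (Rplus_comm g h), <- kk_conv.
    unfold rconv. change (Csum ?f n) with (gsum Cx Cadd f n).
    change (sum_f_R0 ?f n) with (gsum R Rplus f n).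
    rewrite (gsum_morph R Cx Rplus Cadd RtoC RtoC_add).
    apply gsum_ext; intros i Hi. rewrite RtoC_mul. ring.
  - intros i Hi. rewrite <- (Iop_cut h F N i) by auto. rewrite CsumE.
    simpl. rewrite (vsum_ext CxB (fun l => Cmul (Cmul (RtoC (kk g i)) (RtoC (kk h l)))
       (F (i + l)%nat)) (fun l => @vscal CxB (RtoC (kk g i)) (Cmul (RtoC (kk h l))
       (F (i + l)%nat)))).
    + rewrite vsum_scal. simpl. ring.
    + intros l _. simpl. ring. }
rewrite E.
assert (B : Cnorm (@vsum CxB (fun i => Cmul (RtoC (kk g i)) (Iop h (cut N F) i)) N) <= eps / 2).
{ eapply Rle_trans; [apply (vsum_norm CxB)|].
  rewrite (sum_eq _ (fun i => kk g i * Cnorm (Iop h (cut N F) i))).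
  2:{ intros i _. simpl.
      now rewrite Cnorm_mul, Cnorm_RtoC, Rabs_pos_eq by now apply kk_ge0. }
  apply Iop_bound; auto.
  - intros i. destruct (Hs i) as [P HP]; exists P; intros L.
    eapply Rle_trans; [|apply (HP L)].
    apply sum_f_R0_le; intros l _. apply Rmult_le_compat_l; [now apply kk_ge0|].
    unfold shift; apply cut_norm_le.
  - intros L. apply Rle_trans with (sum_f_R0 (fun i => kk (g + h) i * Cnorm (cut N F i)) (N + L)).
    + apply sum_f_R0_mono; [|lia]. intros.
      apply Rmult_le_pos; [now apply kk_ge0|apply Cnorm_ge0].
    + rewrite cut_sum. apply Rlt_le. apply H2; lia. }
specialize (H1 N ltac:(lia)).
eapply Rle_lt_trans with (Cnorm (@vsub CxB (@vsum CxB
   (fun n => Cmul (RtoC (kk (g + h) n)) (F n)) N) (Iop (g + h) F 0)) +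
   Cnorm (@vsum CxB (fun i => Cmul (RtoC (kk g i)) (Iop h (cut N F) i)) N)).
- set (A := @vsum CxB _ N). set (B0 := @vsum CxB _ N).
  replace (@vsub CxB (@vadd CxB A B0) (Iop (g + h) F 0))
    with (Cadd (@vsub CxB A (Iop (g + h) F 0)) B0) by (unfold vsub; simpl; ring).
  apply Cnorm_add.
- simpl in H1. simpl. lra.
Qed.

Definition diff (F : nat -> Cx) : nat -> Cx := fun n => Csub (F n) (F (S n)).

Definition null_seq (F : nat -> Cx) : Prop :=
  forall eps, eps > 0 -> exists N, forall n, (n >= N)%nat -> Cnorm (F n) < eps.

Lemma null_seq_diff F : null_seq F -> null_seq (diff F).
Proof.
intros H eps He. destruct (H (eps / 2)) as [N HN]; [lra|].
exists N; intros n Hn. unfold diff.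
eapply Rle_lt_trans; [apply (vnorm_vsub CxB)|]. simpl.
pose proof (HN n Hn). pose proof (HN (S n) ltac:(lia)). lra.
Qed.

Lemma null_seq_iter_diff m F : null_seq F -> null_seq (Nat.iter m diff F).
Proof. intros H. induction m; simpl; auto. now apply null_seq_diff. Qed.

Lemma iter_diff_shift m F n i :
  Nat.iter m diff (shift F n) i = Nat.iter m diff F (n + i)%nat.
Proof.
revert i. induction m as [|m IH]; intros i; simpl; auto.
unfold diff at 1 3. now rewrite !IH, Nat.add_succ_r.
Qed.

Lemma Iop_1_diff F n : null_seq F -> Iop 1 (diff F) n = F n.
Proof.
intros H. apply Iop_unique. intros eps He. destruct (H eps He) as [N HN].
exists N; intros p Hp.
assert (E : @vsum CxB (fun i => Cmul (RtoC (kk 1 i)) (diff F (n + i)%nat)) p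
  = Csub (F n) (F (S (n + p)))).
{ clear. induction p as [|p IH]; cbn [vsum].
  - unfold diff. rewrite Nat.add_0_r, kk_1. simpl. rewrite RtoC_1. ring.
  - rewrite IH, kk_1. unfold diff. simpl. rewrite RtoC_1, !Nat.add_succ_r. ring. }
rewrite E. unfold vsub; simpl.
replace (Cadd (Csub (F n) (F (S (n + p)))) (Copp (F n)))
  with (Copp (F (S (n + p)))) by ring.
rewrite Cnorm_opp. apply HN; lia.
Qed.

Lemma Iop_0 F n : Iop 0 F n = F n.
Proof.
apply Iop_unique. intros eps He. exists O; intros p _.
assert (E : @vsum CxB (fun i => Cmul (RtoC (kk 0 i)) (F (n + i)%nat)) p = F n).
{ induction p as [|p IH]; cbn [vsum].
  - rewrite Nat.add_0_r. simpl. rewrite RtoC_1. ring.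
  - rewrite IH, kk_0_S. simpl. rewrite RtoC_0. ring. }
rewrite E, vsub_self, vnorm_vzero. lra.
Qed.

(** A sum of order 1 undoes one difference by telescoping to the limit 0; the semigroup law adds
    these up to order [m]. *)
Lemma Iop_iter_diff m : forall G,
  null_seq G -> wsumm (INR m) (Nat.iter m diff G) ->
  G O = Iop (INR m) (Nat.iter m diff G) O.
Proof.
induction m as [|m IH]; intros G HG Hw; [now rewrite Iop_0|].
set (H := Nat.iter m diff G). change (Nat.iter (S m) diff G) with (diff H) in *.
assert (E : Iop 1 (diff H) = H).
{ extensionality n. now apply Iop_1_diff, null_seq_iter_diff. }
pose proof (pos_INR m). rewrite S_INR in *.
assert (Hs : forall i, wsumm 1 (shift (diff H) i))
  by (intros; apply wsumm_shift_le with (INR m + 1); auto; lra).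
rewrite (IH G); auto.
- fold H. apply Iop_unique.
  pose proof (Iop_comp (INR m) 1 (diff H) ltac:(lra) ltac:(lra) Hs Hw) as K.
  now rewrite E in K.
- destruct Hw as [M HM]. exists M. fold H. rewrite <- E. apply Iop_bound; auto; lra.
Qed.

(** For [b <= 1] the weights are at most 1, so the value at [n] is bounded by a tail of a convergent
    series. *)
Lemma Iop_null b F :
  0 <= b -> b <= 1 -> wsumm 1 F -> null_seq (Iop b F).
Proof.
intros Hb0 Hb [M HM] eps He.
destruct (sum_f_R0_tail (fun i => kk 1 i * Cnorm (F i)) M) with (eps := eps / 2)
  as [N HN]; auto; try lra.
{ intros i. rewrite kk_1, Rmult_1_l. apply Cnorm_ge0. }
exists (S N); intros n Hn. apply Rle_lt_trans with (eps / 2); [|lra].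
apply (Iop_spec_by b F n); auto. intros L.
apply Rle_trans with (sum_f_R0 (fun i => kk 1 i * Cnorm (F (n + i)%nat)) L).
{ apply sum_f_R0_le; intros i _. apply Rmult_le_compat_r; [apply Cnorm_ge0|].
  now apply kk_le_param. }
destruct n as [|n]; [lia|].
specialize (HN n (S n + L)%nat ltac:(lia) ltac:(lia)).
assert (E := sum_f_R0_cat
  (fun i => kk 1 i * Cnorm (F i)) n L).
rewrite E in HN.
rewrite (sum_eq _ (fun i => kk 1 (S n + i) * Cnorm (F (S n + i)%nat)));
  [lra|]. intros; now rewrite !kk_1.
Qed.

(** Two consecutive tail sums differ by [F n]. *)
Lemma Iop_1_inj F : wsumm 1 F -> (forall n, Iop 1 F n = C0) -> forall n, F n = C0.
Proof.
intros HF H0 n.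
pose proof (Iop_spec 1 F n ltac:(lra) (wsumm_shift 1 F n ltac:(lra) HF)) as H1.
pose proof (Iop_spec 1 F (S n) ltac:(lra) (wsumm_shift 1 F (S n) ltac:(lra) HF)) as H2.
rewrite H0 in H1, H2.
assert (H3 : @vser CxB (fun i => Cmul (RtoC (kk 1 i)) (F (n + i)%nat)) (F n)).
{ intros eps He. destruct (H2 eps He) as [N HN]. exists (S N); intros p Hp.
  destruct p as [|p]; [lia|]. specialize (HN p ltac:(lia)).
  rewrite (vsum_recl CxB).
  rewrite (vsum_ext CxB _ (fun i => Cmul (RtoC (kk 1 i)) (F (S n + i)%nat))).
  2:{ intros i _. now rewrite !kk_1, Nat.add_succ_r. }
  set (V := @vsum CxB _ p) in *.
  replace (@vsub CxB _ (F n)) with (@vsub CxB V C0); auto.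
  unfold vsub; simpl. rewrite Nat.add_0_r, RtoC_1. ring. }
exact (vconv_unique CxB _ _ _ H3 H1).
Qed.

Lemma Iop_inj b F :
  0 <= b -> b <= 1 -> wsumm 1 F -> (forall n, Iop b F n = C0) -> forall n, F n = C0.
Proof.
intros Hb0 Hb HF H0. apply Iop_1_inj; auto. intros n.
rewrite <- (Nat.add_0_r n), <- Iop_shift.
assert (K := Iop_comp (1 - b) b (shift F n) ltac:(lra) Hb0).
replace (1 - b + b) with 1 in K by ring.
apply (fun H => vconv_unique CxB _ _ _ (K H (wsumm_shift 1 F n ltac:(lra) HF))).
- intros i. replace (shift (shift F n) i) with (shift F (n + i)).
  + apply wsumm_shift_le with 1; auto; lra.
  + unfold shift; extensionality j. now rewrite Nat.add_assoc.
- intros eps He; exists O; intros p _. rewrite (vsum_zero CxB).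
  + rewrite vsub_self, vnorm_vzero. lra.
  + intros i _. rewrite Iop_shift, H0. simpl. ring.
Qed.

(* The difference of order [m] of [I^b F] is inverted by [I^m = I^b I^alpha],
   and [I^b] is injective on summable sequences since [I^(1-b) I^b = I^1]. *)
Lemma fractional_reconstruction m alpha b F :
  0 < alpha -> 0 <= b -> b <= 1 -> b + alpha = INR m ->
  wsumm 1 F -> wsumm (alpha + 1) (Nat.iter m diff (Iop b F)) ->
  forall n, F n = Iop alpha (Nat.iter m diff (Iop b F)) n.
Proof.
intros Ha Hb0 Hb Hm HF Hw.
set (w := Nat.iter m diff (Iop b F)) in *.
assert (Hm1 : 1 <= INR m).
{ destruct m as [|m]; [simpl in Hm; lra|]. rewrite S_INR.
  pose proof (pos_INR m). lra. }
assert (HF' : wsumm 1 (Iop alpha w)).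
{ destruct Hw as [M HM]; exists M. apply Iop_bound; try lra.
  - intros i. apply wsumm_shift_le with (alpha + 1); try lra. now exists M.
  - now rewrite Rplus_comm. }
assert (E : forall n, Csub (F n) (Iop alpha w n) = C0).
{ apply (Iop_inj b); auto.
  { apply (wsumm_sub 1 F (Iop alpha w)); auto; lra. }
  intros n. rewrite Iop_sub; auto.
  2, 3: apply wsumm_shift_le with 1; auto; lra.
  (* Both are the sum of order [m] of [w] at [n]: one by inverting [m] differences of the null
     sequence [Iop b F], the other by the semigroup law [b + alpha = m]. *)
  replace (Iop b (Iop alpha w) n) with (Iop b F n); [unfold Csub; ring|].
  transitivity (Iop (INR m) (shift w n) 0).
  - assert (Es : shift w n = Nat.iter m diff (shift (Iop b F) n)).
    { extensionality i. rewrite iter_diff_shift. reflexivity. }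
    rewrite Es. rewrite <- Iop_iter_diff.
    + unfold shift. now rewrite Nat.add_0_r.
    + intros eps He. destruct (Iop_null b F Hb0 Hb HF eps He) as [N HN].
      exists N; intros i Hi. apply HN. lia.
    + rewrite <- Es. apply wsumm_shift_le with (alpha + 1); auto; lra.
  - symmetry. apply Iop_unique. rewrite <- Hm.
    eapply vconv_ext; [|apply (Iop_comp b alpha (shift w n)); auto; try lra].
    + intros p. apply vsum_ext; intros i _. now rewrite Iop_shift.
    + intros i. replace (shift (shift w n) i) with (shift w (n + i)).
      * apply wsumm_shift_le with (alpha + 1); auto; lra.
      * unfold shift; extensionality j. now rewrite Nat.add_assoc.
    + rewrite Hm. apply wsumm_shift_le with (alpha + 1); auto; lra. }
intros n. specialize (E n). apply (vsub_eq0 CxB).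
change (Cnorm (Csub (F n) (Iop alpha w n)) = 0). rewrite E. apply Cnorm_C0.
Qed.

(** * The algebra of absolutely Cesàro-summable coefficient sequences *)

Definition pos_part (f : Z -> Cx) : nat -> Cx := fun i => f (Z.of_nat i).
(** Starts at -1, so that the differences [Wm] at negative integers see this half only. *)
Definition neg_part (f : Z -> Cx) : nat -> Cx := fun i => f (- Z.of_nat (S i))%Z.

Lemma iter_Wp m g n :
  Nat.iter m Wp g (Z.of_nat n) = Nat.iter m diff (pos_part g) n.
Proof.
revert n. induction m as [|m IH]; intros n; simpl; auto.
unfold diff, Wp. rewrite <- !IH. do 2 f_equal. lia.
Qed.

Lemma iter_Wm m g n :
  Nat.iter m Wm g (- Z.of_nat (S n))%Z = Nat.iter m diff (neg_part g) n.
Proof.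
revert n. induction m as [|m IH]; intros n; simpl Nat.iter; auto.
unfold diff, Wm. rewrite <- !IH. do 2 f_equal. lia.
Qed.

Lemma W_frac_pos alpha f n :
  W_frac alpha f (Z.of_nat n)
  = Nat.iter (mfloor1 alpha) diff (Iop (INR (mfloor1 alpha) - alpha) (pos_part f)) n.
Proof.
unfold W_frac. destruct (Z.leb_spec 0 (Z.of_nat n)); [|lia].
unfold Wp_frac. rewrite iter_Wp. f_equal. extensionality i.
unfold pos_part at 1, Wp_neg, Iop. do 2 f_equal. extensionality j.
unfold pos_part. do 2 f_equal. lia.
Qed.

Lemma W_frac_neg alpha f n :
  W_frac alpha f (- Z.of_nat (S n))%Z
  = Nat.iter (mfloor1 alpha) diff (Iop (INR (mfloor1 alpha) - alpha) (neg_part f)) n.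
Proof.
unfold W_frac. destruct (Z.leb_spec 0 (- Z.of_nat (S n))); [lia|].
unfold Wm_frac. rewrite iter_Wm. f_equal. extensionality i.
unfold neg_part at 1, Wm_neg, Iop. do 2 f_equal. extensionality j.
unfold neg_part. do 2 f_equal. lia.
Qed.

(** The value 1 is attained when [alpha] is an integer, hence the closed condition [b <= 1] in the
    lemmas on [Iop b]. *)
Lemma mfloor1_spec alpha : 0 < alpha -> 0 <= INR (mfloor1 alpha) - alpha <= 1.
Proof.
intros Ha. destruct (archimed alpha) as [H1 H2]. unfold mfloor1.
assert (0 < up alpha)%Z by (apply lt_IZR; lra).
rewrite INR_IZR_INZ, Z2Nat.id by lia. lra.
Qed.

Lemma Rsum_Z_S (f : Z -> R) N :
  Rsum_Z f (S N) = sum_f_R0 (fun i => f (Z.of_nat i)) (S N)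
                 + sum_f_R0 (fun i => f (- Z.of_nat (S i))%Z) N.
Proof.
unfold Rsum_Z.
assert (E := sum_f_R0_recl
  (fun i => f (- Z.of_nat i)%Z) N).
rewrite E.
change (- Z.of_nat 0)%Z with 0%Z. ring.
Qed.

Lemma Rsum_Z_0 (f : Z -> R) : Rsum_Z f 0 = f 0%Z.
Proof. unfold Rsum_Z; simpl. ring. Qed.

Lemma Rsum_Z_growing (f : Z -> R) : (forall n, 0 <= f n) -> Un_growing (Rsum_Z f).
Proof.
intros Hf n. unfold Rsum_Z. rewrite !tech5.
pose proof (Hf (Z.of_nat (S n))). pose proof (Hf (- Z.of_nat (S n))%Z). lra.
Qed.

Lemma Rsummable_Z_bound (f : Z -> R) l :
  (forall n, 0 <= f n) -> Un_cv (Rsum_Z f) l ->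
  forall N, sum_f_R0 (fun i => f (Z.of_nat i)) N
            + sum_f_R0 (fun i => f (- Z.of_nat (S i))%Z) N <= l.
Proof.
intros Hf Hl N. pose proof (growing_ineq _ _ (Rsum_Z_growing f Hf) Hl (S N)) as H.
rewrite Rsum_Z_S, tech5 in H. pose proof (Hf (Z.of_nat (S N))). lra.
Qed.

Lemma Rsummable_Z_le (f : Z -> R) M :
  (forall n, 0 <= f n) -> (forall N, Rsum_Z f N <= M) -> Rsummable_Z f.
Proof.
intros Hf HM. destruct (growing_cv _ (Rsum_Z_growing f Hf)) as [l Hl]; [|now exists l].
exists M; intros y [n ->]; apply HM.
Qed.

Lemma Rsum_Z_le (f g : Z -> R) N :
  (forall n, 0 <= f n) -> (forall n, f n <= g n) -> Rsum_Z f N <= Rsum_Z g N.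
Proof.
intros Hf H. destruct N as [|N]; [rewrite !Rsum_Z_0; auto|].
rewrite !Rsum_Z_S. apply Rplus_le_compat; apply sum_f_R0_le; auto.
Qed.

Lemma Rsum_Z_add (f g : Z -> R) N :
  Rsum_Z (fun n => f n + g n) N = Rsum_Z f N + Rsum_Z g N.
Proof. unfold Rsum_Z. rewrite !plus_sum. ring. Qed.

Lemma Rsummable_Z_add_le (f g h : Z -> R) :
  (forall n, 0 <= f n) -> (forall n, 0 <= g n) -> (forall n, 0 <= h n) ->
  (forall n, h n <= f n + g n) -> Rsummable_Z f -> Rsummable_Z g -> Rsummable_Z h.
Proof.
intros Hf Hg Hh H [l Hl] [k Hk]. apply Rsummable_Z_le with (l + k); auto. intros N.
eapply Rle_trans; [apply Rsum_Z_le with (2 := H); auto|]. rewrite Rsum_Z_add.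
pose proof (growing_ineq _ _ (Rsum_Z_growing f Hf) Hl N).
pose proof (growing_ineq _ _ (Rsum_Z_growing g Hg) Hk N). lra.
Qed.

Lemma iter_diff_sub m F H n :
  Nat.iter m diff (fun i => Csub (F i) (H i)) n
  = Csub (Nat.iter m diff F n) (Nat.iter m diff H n).
Proof.
revert n. induction m as [|m IH]; intros n; simpl; auto.
unfold diff at 1 3 5. rewrite !IH. unfold Csub. ring.
Qed.

Section AlgebraNorm.

Variable alpha : R.
Hypothesis Halpha : 0 < alpha.

Lemma Aterm_ge0 a n : 0 <= Aterm alpha a n.
Proof. apply Rmult_le_pos; [apply kk_ge0; lra|apply Cnorm_ge0]. Qed.

Lemma pos_part_wsumm a : Rsummable_Z (fun n => Cnorm (a n)) -> wsumm 1 (pos_part a).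
Proof.
intros [l Hl]. exists l; intros N.
pose proof (Rsummable_Z_bound _ _ (fun n => Cnorm_ge0 (a n)) Hl N) as H.
pose proof (sum_f_R0_ge0 (fun i => Cnorm (a (- Z.of_nat (S i))%Z)) N
  (fun i _ => Cnorm_ge0 _)).
rewrite (sum_eq _ (fun i => Cnorm (a (Z.of_nat i)))).
- lra.
- intros i _. rewrite kk_1. unfold pos_part. ring.
Qed.

Lemma neg_part_wsumm a : Rsummable_Z (fun n => Cnorm (a n)) -> wsumm 1 (neg_part a).
Proof.
intros [l Hl]. exists l; intros N.
pose proof (Rsummable_Z_bound _ _ (fun n => Cnorm_ge0 (a n)) Hl N) as H.
pose proof (sum_f_R0_ge0 (fun i => Cnorm (a (Z.of_nat i))) N
  (fun i _ => Cnorm_ge0 _)).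
rewrite (sum_eq _ (fun i => Cnorm (a (- Z.of_nat (S i))%Z))).
- lra.
- intros i _. rewrite kk_1. unfold neg_part. ring.
Qed.

Lemma W_frac_sub a b n :
  in_A alpha a -> in_A alpha b ->
  W_frac alpha (fun n => Csub (a n) (b n)) n
  = Csub (W_frac alpha a n) (W_frac alpha b n).
Proof.
intros [Ha _] [Hb _]. pose proof (mfloor1_spec alpha Halpha) as Hm.
assert (E : forall F H k, wsumm 1 F -> wsumm 1 H ->
  Nat.iter (mfloor1 alpha) diff
    (Iop (INR (mfloor1 alpha) - alpha) (fun i => Csub (F i) (H i))) k
  = Csub (Nat.iter (mfloor1 alpha) diff (Iop (INR (mfloor1 alpha) - alpha) F) k)
         (Nat.iter (mfloor1 alpha) diff (Iop (INR (mfloor1 alpha) - alpha) H) k)).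
{ intros F H k HF HH. rewrite <- iter_diff_sub. f_equal. extensionality i.
  apply Iop_sub; try lra; apply wsumm_shift_le with 1; auto; lra. }
destruct (Z.le_gt_cases 0 n) as [Hn|Hn].
- rewrite <- (Z2Nat.id n) by auto. rewrite !W_frac_pos.
  apply (E (pos_part a) (pos_part b)); now apply pos_part_wsumm.
- replace n with (- Z.of_nat (S (Z.to_nat (- n) - 1)))%Z by lia.
  rewrite !W_frac_neg.
  apply (E (neg_part a) (neg_part b)); now apply neg_part_wsumm.
Qed.

Lemma in_A_sub a b :
  in_A alpha a -> in_A alpha b -> in_A alpha (fun n => Csub (a n) (b n)).
Proof.
intros Ha Hb. split.
- apply (Rsummable_Z_add_le (fun n => Cnorm (a n)) (fun n => Cnorm (b n))).
  all: try (intros; apply Cnorm_ge0).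
  + intros n. apply (vnorm_vsub CxB).
  + apply Ha.
  + apply Hb.
- apply (Rsummable_Z_add_le (Aterm alpha a) (Aterm alpha b)).
  all: try (intros; apply Aterm_ge0).
  + intros n. unfold Aterm. rewrite W_frac_sub by auto.
    rewrite <- Rmult_plus_distr_l. apply Rmult_le_compat_l; [apply kk_ge0; lra|].
    apply (vnorm_vsub CxB).
  + apply Ha.
  + apply Hb.
Qed.

Lemma A_norm_bound a :
  Rsummable_Z (Aterm alpha a) ->
  wsumm_by (alpha + 1) (fun n => W_frac alpha a (Z.of_nat n)) (A_norm alpha a)
  /\ wsumm_by (alpha + 1) (fun n => W_frac alpha a (- Z.of_nat (S n))%Z) (A_norm alpha a).
Proof.
intros HA.
(* Summability makes the [epsilon] choice in [A_norm] a genuine limit. *)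
assert (Hl : Un_cv (Rsum_Z (Aterm alpha a)) (A_norm alpha a))
  by exact (epsilon_spec (inhabits 0) _ HA).
pose proof (Rsummable_Z_bound _ _ (Aterm_ge0 a) Hl) as H.
split; intros N; specialize (H N);
  pose proof (sum_f_R0_ge0 (fun i => Aterm alpha a (Z.of_nat i)) N
    (fun i _ => Aterm_ge0 a _));
  pose proof (sum_f_R0_ge0 (fun i => Aterm alpha a (- Z.of_nat (S i))%Z) N
    (fun i _ => Aterm_ge0 a _)).
- rewrite (sum_eq _ (fun i => Aterm alpha a (Z.of_nat i))); [lra|].
  intros i _. unfold Aterm. now rewrite Zabs2Nat.id.
- eapply Rle_trans with (sum_f_R0 (fun i => Aterm alpha a (- Z.of_nat (S i))%Z) N); [|lra].
  apply sum_f_R0_le; intros i _. unfold Aterm.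
  (* The norm weighs the integer [-(i+1)] by index [i+1], the half-line sequence by index [i];
     monotonicity of the weights absorbs the offset. *)
  apply Rmult_le_compat_r; [apply Cnorm_ge0|]. apply kk_le_index; [lra|lia].
Qed.

(** This is what identifies the theta series, written with fractional differences, with a power
    series whose coefficients are those of [a]. *)
Lemma W_frac_reconstruction a n :
  in_A alpha a ->
  a (Z.of_nat n) = Iop alpha (fun k => W_frac alpha a (Z.of_nat k)) n.
Proof.
intros [H1 H2]. pose proof (mfloor1_spec alpha Halpha) as Hm.
assert (E : (fun k => W_frac alpha a (Z.of_nat k)) = Nat.iter (mfloor1 alpha) diff
   (Iop (INR (mfloor1 alpha) - alpha) (pos_part a)))
  by (extensionality k; apply W_frac_pos).
rewrite E. apply (fractional_reconstruction (mfloor1 alpha) alpha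
  (INR (mfloor1 alpha) - alpha) (pos_part a)); try lra.
- now apply pos_part_wsumm.
- rewrite <- E. eexists. now apply A_norm_bound.
Qed.

(** The negative coefficients are a fractional sum of order [alpha] of their differences, and such a
    sum lowers the weight from [kk (alpha + 1)] to [kk 1 = 1]. *)
Lemma neg_part_A_norm a N :
  in_A alpha a -> sum_f_R0 (fun i => Cnorm (neg_part a i)) N <= A_norm alpha a.
Proof.
intros [H1 H2]. pose proof (mfloor1_spec alpha Halpha) as Hm.
assert (E : (fun k => W_frac alpha a (- Z.of_nat (S k))%Z) = Nat.iter (mfloor1 alpha) diff
   (Iop (INR (mfloor1 alpha) - alpha) (neg_part a)))
  by (extensionality k; apply W_frac_neg).
destruct (A_norm_bound a H2) as [_ Hb].
assert (R := fractional_reconstruction (mfloor1 alpha) alpha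
  (INR (mfloor1 alpha) - alpha) (neg_part a) Halpha ltac:(lra) ltac:(lra) ltac:(lra)
  (neg_part_wsumm a H1)).
rewrite <- E in R. specialize (R (ex_intro _ _ Hb)).
assert (B := Iop_bound 1 alpha (fun k => W_frac alpha a (- Z.of_nat (S k))%Z)
  (A_norm alpha a) ltac:(lra) ltac:(lra)).
rewrite (Rplus_comm 1) in B.
eapply Rle_trans; [|apply (B ltac:(intros; apply wsumm_shift_le with (alpha + 1);
  try lra; eexists; exact Hb) Hb N)].
right; apply sum_eq; intros i _. rewrite kk_1, R. ring.
Qed.

End AlgebraNorm.

(** * Convolution of scalars with vectors *)

Definition Ccv (c d : nat -> Cx) (n : nat) : Cx :=
  Csum (fun j => Cmul (c (n - j)%nat) (d j)) n.

Lemma Ccv_comm c d n : Ccv c d n = Ccv d c n.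
Proof.
unfold Ccv. change Csum with (gsum Cx Cadd).
rewrite gsum_rev by (intros; ring).
apply gsum_ext; intros i Hi. replace (n - (n - i))%nat with i by lia. ring.
Qed.

Definition vcv {X : CBanach} (c : nat -> Cx) (v : nat -> X) (n : nat) : X :=
  vsum (fun j => vscal (c (n - j)%nat) (v j)) n.

Definition rcv {X : CBanach} (c : nat -> R) (v : nat -> X) (n : nat) : X :=
  vcv (fun i => RtoC (c i)) v n.

Section VectorConvolution.

Variable X : CBanach.

Add Ring sqz_ring_inst2 : (sqz_ring X).

Lemma vcv_ext c c' (v v' : nat -> X) n :
  (forall i, (i <= n)%nat -> c i = c' i) ->
  (forall i, (i <= n)%nat -> v i = v' i) -> vcv c v n = vcv c' v' n.
Proof.
intros Hc Hv. apply vsum_ext; intros i Hi. rewrite Hc, Hv; auto; lia.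
Qed.

Lemma vcv_assoc c d (v : nat -> X) n : vcv c (vcv d v) n = vcv (Ccv c d) v n.
Proof.
assert (E : forall c (v : nat -> X), vcv c v = gconv Cx X vadd vscal c v)
  by (intros; extensionality m; apply vsumE).
rewrite !E. apply (gconv_assoc Cx X Cadd Cmul vadd vscal); intros; try ring.
- apply vadd_comm.
- apply vadd_assoc.
- apply vscal_adds.
- apply vscal_addv.
- apply vscal_assoc.
Qed.

Lemma vcv_add c (v w : nat -> X) n :
  vcv c (fun i => vadd (v i) (w i)) n = vadd (vcv c v n) (vcv c w n).
Proof.
unfold vcv. rewrite <- vsum_add. apply vsum_ext; intros; apply vscal_addv.
Qed.

Lemma rcv_assoc c d (v : nat -> X) n : rcv c (rcv d v) n = rcv (rconv c d) v n.
Proof.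
transitivity (vcv (Ccv (fun i => RtoC (c i)) (fun i => RtoC (d i))) v n).
- apply (vcv_assoc (fun i => RtoC (c i)) (fun i => RtoC (d i))).
- apply vcv_ext; auto. intros i _. unfold Ccv, rconv.
  change (Csum ?f i) with (gsum Cx Cadd f i).
  change (sum_f_R0 ?f i) with (gsum R Rplus f i).
  rewrite (gsum_morph R Cx Rplus Cadd RtoC RtoC_add).
  apply gsum_ext; intros. now rewrite RtoC_mul.
Qed.

Lemma rcv_pow r c (v : nat -> X) n :
  rcv (fun i => r ^ i * c i) (fun i => vscal (RtoC (r ^ i)) (v i)) n
  = vscal (RtoC (r ^ n)) (rcv c v n).
Proof.
unfold rcv, vcv. rewrite <- vsum_scal. apply vsum_ext; intros i Hi.
rewrite !vscal_assoc. f_equal. rewrite <- !RtoC_mul. f_equal.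
replace (r ^ n) with (r ^ (n - i) * r ^ i); [ring|].
rewrite <- pow_add. f_equal; lia.
Qed.

Lemma rcv_kk_0 (v : nat -> X) n : rcv (kk 0) v n = v n.
Proof.
unfold rcv, vcv. destruct n as [|n]; cbn [vsum].
- simpl. apply vscal_1.
- rewrite vsum_zero.
  + rewrite Nat.sub_diag, vadd_0l. apply vscal_1.
  + intros i Hi. replace (S n - i)%nat with (S (n - i)) by lia.
    rewrite kk_0_S. apply vscal_0l.
Qed.

(** The kernels of orders [g] and [-g] are inverse to each other under convolution; this recovers
    the powers of [T] from its Cesàro sums. *)
Lemma rcv_kk_inv g (v : nat -> X) n : rcv (kk (- g)) (rcv (kk g) v) n = v n.
Proof.
rewrite rcv_assoc, <- (rcv_kk_0 v). apply vcv_ext; auto.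
intros i _. rewrite kk_conv. do 2 f_equal. ring.
Qed.

Lemma rcv_norm_le c c' (v : nat -> X) (u : nat -> R) n :
  (forall i, (i <= n)%nat -> Rabs (c i) <= c' i) ->
  (forall i, (i <= n)%nat -> vnorm (v i) <= u i) ->
  vnorm (rcv c v n) <= rconv c' u n.
Proof.
intros Hc Hv. apply vsum_norm_le; intros i Hi.
rewrite vnorm_scal, Cnorm_RtoC.
apply Rmult_le_compat; auto using Rabs_pos, vnorm_ge0.
apply Hc; lia.
Qed.

End VectorConvolution.

(** Partial sums of the binomial series of [(1 - r)^(-q)]; each induction step brings in one more
    geometric series through [kk_sum]. *)
Lemma kk_geometric_nat r q : 0 <= r < 1 -> forall N,
  sum_f_R0 (fun j => r ^ j * kk (INR q) j) N <= (/ (1 - r)) ^ q.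
Proof.
intros Hr. assert (Hi : 0 < / (1 - r)) by (apply Rinv_0_lt_compat; lra).
induction q as [|q IH]; intros N.
- simpl. right. destruct N as [|N]; [simpl; ring|].
  assert (E := sum_f_R0_recl
    (fun j => r ^ j * kk 0 j) N).
  rewrite E.
  rewrite sum_eq_R0; [simpl; ring|]. intros i _. rewrite kk_0_S. ring.
- rewrite S_INR.
  rewrite (sum_eq _ (fun n => sum_f_R0 (fun j => r ^ n * kk (INR q) j) n)).
  2:{ intros i _. now rewrite <- kk_sum, sum_f_R0_scal. }
  assert (E := sum_f_R0_triangle
    (fun j n => r ^ n * kk (INR q) j) N).
  rewrite E.
  simpl pow. apply Rle_trans with (sum_f_R0 (fun j => / (1 - r) * (r ^ j * kk (INR q) j)) N).
  + apply sum_f_R0_le; intros i _.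
    rewrite (sum_eq _ (fun k => (r ^ i * kk (INR q) i) * r ^ k)).
    2:{ intros. rewrite pow_add. ring. }
    rewrite sum_f_R0_scal, Rmult_comm.
    assert (0 <= r ^ i * kk (INR q) i)
      by (apply Rmult_le_pos; [apply pow_le; lra|apply kk_ge0, pos_INR]).
    apply Rmult_le_compat_r; auto.
    rewrite tech3 by lra. unfold Rdiv.
    assert (0 <= r ^ S (N - i)) by (apply pow_le; lra). nra.
  + rewrite sum_f_R0_scal. apply Rmult_le_compat_l; auto; lra.
Qed.

Lemma kk_geometric r g : 0 <= r < 1 -> 0 <= g ->
  exists M, forall N, sum_f_R0 (fun j => r ^ j * kk g j) N <= M.
Proof.
intros Hr Hg. destruct (INR_unbounded g) as [q Hq].
exists ((/ (1 - r)) ^ q); intros N. eapply Rle_trans; [|now apply kk_geometric_nat].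
apply sum_f_R0_le; intros i _. apply Rmult_le_compat_l; [apply pow_le; lra|].
apply kk_le_param; lra.
Qed.

Lemma pow_one_sub_le r j : 0 <= r <= 1 -> 0 <= 1 - r ^ j <= INR j * (1 - r).
Proof.
intros Hr. induction j as [|j IH]; [simpl; lra|].
rewrite S_INR. simpl pow.
assert (0 <= r ^ j) by (apply pow_le; lra). pose proof (pos_INR j). nra.
Qed.

(* The iterated limit [J -> oo], then [r -> 1-]. *)
Definition abel_lim {X : CBanach} (u : R -> nat -> X) (l : X) : Prop :=
  forall eps, eps > 0 -> exists r0, r0 < 1 /\ forall r, r0 < r < 1 ->
    exists J0, forall J, (J >= J0)%nat -> vnorm (vsub (u r J) l) < eps.

(** * Rules for Abel limits *)

Section AbelLimit.

Variable X : CBanach.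

Add Ring sqz_ring_inst3 : (sqz_ring X).

Lemma abel_lim_add (u v : R -> nat -> X) l k :
  abel_lim u l -> abel_lim v k ->
  abel_lim (fun r J => vadd (u r J) (v r J)) (vadd l k).
Proof.
intros Hu Hv eps He.
destruct (Hu (eps / 2)) as [r1 [R1 H1]]; [lra|].
destruct (Hv (eps / 2)) as [r2 [R2 H2]]; [lra|].
exists (Rmax r1 r2). split; [now apply Rmax_lub_lt|]. intros r Hr.
pose proof (Rmax_l r1 r2); pose proof (Rmax_r r1 r2).
destruct (H1 r) as [J1 K1]; [lra|]. destruct (H2 r) as [J2 K2]; [lra|].
exists (J1 + J2)%nat; intros J HJ.
replace (vsub (vadd (u r J) (v r J)) (vadd l k))
  with (vadd (vsub (u r J) l) (vsub (v r J) k)) by vring.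
eapply Rle_lt_trans; [apply vnorm_triangle|].
specialize (K1 J ltac:(lia)); specialize (K2 J ltac:(lia)). lra.
Qed.

Lemma abel_lim_bounded_op (S : X -> X) (u : R -> nat -> X) l :
  bounded_op S -> abel_lim u l -> abel_lim (fun r J => S (u r J)) (S l).
Proof.
intros [SA [SS [M HM]]] Hu eps He.
assert (HP : 0 < Rabs M + 1) by (pose proof (Rabs_pos M); lra).
destruct (Hu (eps / (Rabs M + 1))) as [r0 [R0 H0]]; [now apply Rdiv_lt_0_compat|].
exists r0; split; auto. intros r Hr. destruct (H0 r Hr) as [J0 K0].
exists J0; intros J HJ. specialize (K0 J HJ).
replace (vsub (S (u r J)) (S l)) with (S (vsub (u r J) l)).
2:{ unfold vsub. now rewrite SA, !vopp_scal, SS. }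
pose proof (vnorm_ge0 X (vsub (u r J) l)). pose proof (Rle_abs M).
apply Rle_lt_trans with ((Rabs M + 1) * vnorm (vsub (u r J) l));
  [eapply Rle_trans; [apply HM|nra]|].
apply Rlt_le_trans with ((Rabs M + 1) * (eps / (Rabs M + 1))); [nra|].
right; field; lra.
Qed.

Lemma abel_lim_pow n (u : R -> nat -> X) l :
  abel_lim u l -> abel_lim (fun r J => vscal (RtoC (r ^ n)) (u r J)) l.
Proof.
intros Hu eps He.
destruct (Hu (eps / 2)) as [r0 [R0 H0]]; [lra|].
(* Since [1 - r^n <= n (1 - r)], the factor [r^n] moves the limit by at most [(1 - r) C]. *)
set (C := INR n * vnorm l).
assert (HC : 0 <= C) by (apply Rmult_le_pos; [apply pos_INR|apply vnorm_ge0]).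
assert (HD : 0 < eps / (2 * (C + 1))) by (apply Rdiv_lt_0_compat; lra).
exists (Rmax (Rmax r0 0) (1 - eps / (2 * (C + 1)))). split.
{ apply Rmax_lub_lt; [apply Rmax_lub_lt|]; lra. }
intros r Hr.
pose proof (Rmax_l (Rmax r0 0) (1 - eps / (2 * (C + 1)))).
pose proof (Rmax_r (Rmax r0 0) (1 - eps / (2 * (C + 1)))).
pose proof (Rmax_l r0 0); pose proof (Rmax_r r0 0).
destruct (H0 r) as [J0 K0]; [lra|]. exists J0; intros J HJ. specialize (K0 J HJ).
replace (vsub (vscal (RtoC (r ^ n)) (u r J)) l)
  with (vsub (vscal (RtoC (r ^ n)) (vsub (u r J) l)) (vscal (RtoC (1 - r ^ n)) l)).
2:{ replace (RtoC (1 - r ^ n)) with (Csub C1 (RtoC (r ^ n)))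
      by (apply Cx_eq; simpl; ring). vring. }
eapply Rle_lt_trans; [apply vnorm_vsub|]. rewrite !vnorm_scal, !Cnorm_RtoC.
destruct (pow_one_sub_le r n ltac:(lra)) as [P1 P2].
assert (0 <= r ^ n) by (apply pow_le; lra).
rewrite !Rabs_pos_eq by lra.
pose proof (vnorm_ge0 X (vsub (u r J) l)). pose proof (vnorm_ge0 X l).
assert (E1 : (1 - r ^ n) * vnorm l <= (1 - r) * C).
{ unfold C. replace ((1 - r) * (INR n * vnorm l)) with (INR n * (1 - r) * vnorm l) by ring.
  now apply Rmult_le_compat_r. }
assert (E2 : (1 - r) * C <= eps / (2 * (C + 1)) * (C + 1)) by nra.
assert (E3 : eps / (2 * (C + 1)) * (C + 1) = eps / 2) by (field; lra).
nra.
Qed.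

Lemma abel_lim_const (x : X) : abel_lim (fun _ _ => x) x.
Proof.
intros eps He. exists 0; split; [lra|]. intros r _; exists O; intros J _.
rewrite vsub_self, vnorm_vzero. lra.
Qed.

Lemma abel_lim_vsum (u : nat -> R -> nat -> X) (l : nat -> X) n :
  (forall i, abel_lim (u i) (l i)) ->
  abel_lim (fun r J => vsum (fun i => u i r J) n) (vsum l n).
Proof.
intros H. induction n as [|n IH]; simpl; auto. now apply abel_lim_add.
Qed.

Lemma abel_lim_shift p (u : R -> nat -> X) l :
  abel_lim (fun r J => u r (p + J)%nat) l -> abel_lim u l.
Proof.
intros H eps He. destruct (H eps He) as [r0 [R0 H0]]. exists r0; split; auto.
intros r Hr. destruct (H0 r Hr) as [J0 K0]. exists (p + J0)%nat; intros J HJ.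
replace J with (p + (J - p))%nat by lia. apply K0; lia.
Qed.

Lemma abel_lim_ext (u v : R -> nat -> X) l :
  (forall r J, u r J = v r J) -> abel_lim u l -> abel_lim v l.
Proof.
intros E H eps He. destruct (H eps He) as [r0 [R0 H0]]. exists r0; split; auto.
intros r Hr. destruct (H0 r Hr) as [J0 K0]. exists J0; intros J HJ.
rewrite <- E; auto.
Qed.

Lemma abel_lim_norm_le (u : R -> nat -> X) l M d :
  0 < d -> abel_lim u l ->
  (forall r, 1 - d < r < 1 -> exists J0, forall J, (J >= J0)%nat -> vnorm (u r J) <= M) ->
  vnorm l <= M.
Proof.
intros Hd Hu H. apply Rnot_lt_le; intros Hlt.
destruct (Hu (vnorm l - M)) as [r0 [R0 H0]]; [lra|].
set (r := (Rmax r0 (1 - d) + 1) / 2).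
assert (Hm : Rmax r0 (1 - d) < 1) by (apply Rmax_lub_lt; lra).
pose proof (Rmax_l r0 (1 - d)); pose proof (Rmax_r r0 (1 - d)).
destruct (H0 r) as [J1 K1]; [unfold r; lra|].
destruct (H r) as [J2 K2]; [unfold r; lra|].
specialize (K1 (J1 + J2)%nat ltac:(lia)); specialize (K2 (J1 + J2)%nat ltac:(lia)).
pose proof (vnorm_le_sub X (u r (J1 + J2)%nat) l) as E. rewrite vsub_sym in E. lra.
Qed.

End AbelLimit.

(** * Cesàro bounded operators *)

Lemma bounded_op_iter (X : CBanach) (T : X -> X) n :
  bounded_op T -> bounded_op (fun x => Nat.iter n T x).
Proof.
intros [TA [TS [M HM]]]. induction n as [|n [IA [IS [P HP]]]]; simpl.
- repeat split; auto. exists 1; intros; lra.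
- repeat split.
  + intros. now rewrite IA, TA.
  + intros. now rewrite IS, TS.
  + exists (Rabs M * P). intros x. eapply Rle_trans; [apply HM|].
    pose proof (Rle_abs M). pose proof (Rabs_pos M).
    pose proof (vnorm_ge0 X (Nat.iter n T x)). specialize (HP x). nra.
Qed.

Section CesaroBounded.

Variables (X : CBanach) (alpha : R) (T : X -> X) (K : R).
Hypothesis Halpha : 0 < alpha.
Hypothesis HT : bounded_op T.
Hypothesis HK : 0 <= K.
Hypothesis HDelta : forall n x,
  vnorm (DeltaT alpha T n x) <= K * kk (alpha + 1) n * vnorm x.

Add Ring sqz_ring_inst4 : (sqz_ring X).

(** Convolving the Cesàro sums with [kk (- alpha)] gives back [T^n]. Any polynomial order serves:
    the bound is used against [r^n] with [r < 1], or at a fixed [n]. *)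
Lemma power_growth n x :
  vnorm (Nat.iter n T x) <= K * kk (2 * alpha + 1) n * vnorm x.
Proof.
rewrite <- (rcv_kk_inv X alpha (fun j => Nat.iter j T x) n).
eapply Rle_trans; [apply rcv_norm_le with (c' := kk alpha)
  (u := fun i => K * vnorm x * kk (alpha + 1) i)|].
- intros; apply kk_opp_abs; lra.
- intros i _. eapply Rle_trans; [apply HDelta|]. lra.
- rewrite rconv_scal_r, kk_conv. replace (alpha + (alpha + 1)) with (2 * alpha + 1) by ring.
  lra.
Qed.

Definition DeltaT_r (r : R) (n : nat) (x : X) : X :=
  rcv (kk alpha) (fun j => vscal (RtoC (r ^ j)) (Nat.iter j T x)) n.

(* [r T] inherits the Cesàro bound of [T]: its Cesàro sums are convolutions of
   those of [T] with the nonnegative sequence [abel_coef]. *)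
Lemma DeltaT_r_bound r n x :
  0 <= r <= 1 -> vnorm (DeltaT_r r n x) <= K * kk (alpha + 1) n * vnorm x.
Proof.
intros Hr.
assert (E : DeltaT_r r n x = rcv (abel_coef alpha r)
    (fun m => vscal (RtoC (r ^ m)) (DeltaT alpha T m x)) n).
{ unfold abel_coef. rewrite <- rcv_assoc. apply vcv_ext; auto. intros i _.
  etransitivity; [|symmetry; apply rcv_pow]. f_equal. symmetry.
  apply (rcv_kk_inv X alpha (fun j => Nat.iter j T x)). }
rewrite E.
eapply Rle_trans; [apply rcv_norm_le with (c' := abel_coef alpha r)
  (u := fun i => K * vnorm x * (r ^ i * kk (alpha + 1) i))|].
- intros i _. rewrite Rabs_pos_eq; [lra|]. apply abel_coef_ge0; lra.
- intros i _. assert (0 <= r ^ i) by (apply pow_le; lra).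
  rewrite vnorm_scal, Cnorm_RtoC, Rabs_pos_eq by auto.
  specialize (HDelta i x). nra.
- rewrite rconv_scal_r.
  pose proof (abel_coef_conv alpha r n ltac:(lra) Hr).
  pose proof (Rmult_le_pos _ _ HK (vnorm_ge0 X x)). nra.
Qed.

(** The constant depends on [n], so this handles finitely many indices; the others are left to the
    uniform bound [DeltaT_r_bound]. *)
Lemma DeltaT_r_near n x : exists C, 0 <= C /\ forall r, 0 <= r <= 1 ->
  vnorm (vsub (DeltaT_r r n x) (DeltaT alpha T n x)) <= (1 - r) * C.
Proof.
exists (sum_f_R0 (fun j => kk alpha (n - j) * (INR j * vnorm (Nat.iter j T x))) n).
split.
{ apply sum_f_R0_ge0; intros. pose proof (kk_ge0 alpha (n - i) ltac:(lra)).
  pose proof (pos_INR i). pose proof (vnorm_ge0 X (Nat.iter i T x)).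
  repeat apply Rmult_le_pos; auto. }
intros r Hr. unfold DeltaT_r, DeltaT, rcv, vcv. rewrite <- vsum_sub, <- sum_f_R0_scal.
apply vsum_norm_le; intros j _.
replace (vsub _ _) with (vscal (Cmul (RtoC (kk alpha (n - j))) (RtoC (r ^ j - 1)))
  (Nat.iter j T x)).
2:{ replace (RtoC (r ^ j - 1)) with (Csub (RtoC (r ^ j)) C1) by (apply Cx_eq; simpl; ring).
    vring. }
rewrite vnorm_scal, Cnorm_mul, !Cnorm_RtoC, Rabs_minus_sym.
destruct (pow_one_sub_le r j Hr) as [P1 P2].
rewrite !Rabs_pos_eq by (auto; apply kk_ge0; lra).
pose proof (kk_ge0 alpha (n - j) ltac:(lra)). pose proof (vnorm_ge0 X (Nat.iter j T x)).
replace ((1 - r) * (kk alpha (n - j) * (INR j * vnorm (Nat.iter j T x))))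
  with (kk alpha (n - j) * (INR j * (1 - r)) * vnorm (Nat.iter j T x)) by ring.
apply Rmult_le_compat_r; auto. now apply Rmult_le_compat_l.
Qed.

Lemma sum_split_le (f g : nat -> R) N J :
  (forall i, f i <= g i) -> (N <= J)%nat ->
  sum_f_R0 f J <= sum_f_R0 f N + (sum_f_R0 g J - sum_f_R0 g N).
Proof.
intros H. induction 1 as [|J HJ IH]; [lra|]. rewrite !tech5. specialize (H (S J)). lra.
Qed.

(** Expanding the Cesàro sums of [r T] and exchanging the order over the triangle, [(r T)^j]
    receives the part of [Iop alpha w j] coming from indices up to [J]; the tail beyond [J] is
    missing. *)
Lemma theta_sum_r w r x J :
  (forall i, wsumm alpha (shift w i)) ->
  vsub (vsum (fun j => vscal (Cmul (RtoC (r ^ j)) (Iop alpha w j)) (Nat.iter j T x)) J)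
       (vsum (fun n => vscal (w n) (DeltaT_r r n x)) J)
  = vsum (fun j => vscal (Cmul (RtoC (r ^ j)) (Iop alpha (cut J w) j)) (Nat.iter j T x)) J.
Proof.
intros Hs.
rewrite (vsum_ext X (fun n => vscal (w n) (DeltaT_r r n x))
  (fun n => vsum (fun j => vscal (Cmul (RtoC (r ^ j)) (Cmul (RtoC (kk alpha (n - j))) (w n)))
     (Nat.iter j T x)) n)).
2:{ intros n _. unfold DeltaT_r, rcv, vcv. rewrite <- vsum_scal.
    apply vsum_ext; intros j _. vring. }
rewrite (vsum_triangle X (fun j n =>
  vscal (Cmul (RtoC (r ^ j)) (Cmul (RtoC (kk alpha (n - j))) (w n))) (Nat.iter j T x))).
rewrite <- vsum_sub. apply vsum_ext; intros j Hj.
rewrite <- (Iop_cut alpha w J j) by (auto; lra).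
rewrite (vsum_ext X _ (fun k => vscal (Cmul (RtoC (r ^ j)) (Cmul (RtoC (kk alpha k)) (w (j + k)%nat)))
  (Nat.iter j T x))).
2:{ intros k _. now replace (j + k - j)%nat with k by lia. }
rewrite vsum_scal_vec.
replace (Csum (fun k => Cmul (RtoC (r ^ j)) (Cmul (RtoC (kk alpha k)) (w (j + k)%nat))) (J - j))
  with (Cmul (RtoC (r ^ j)) (Csum (fun l => Cmul (RtoC (kk alpha l)) (w (j + l)%nat)) (J - j))).
- vring.
- rewrite !CsumE. symmetry. exact (vsum_scal CxB (RtoC (r ^ j)) _ _).
Qed.

Lemma wsumm_cut w N eps :
  (forall L, (N <= L)%nat -> sum_f_R0 (fun i => kk (alpha + 1) i * Cnorm (w i)) L
     - sum_f_R0 (fun i => kk (alpha + 1) i * Cnorm (w i)) N <= eps) ->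
  wsumm_by (alpha + 1) (cut N w) eps.
Proof.
intros H L.
apply Rle_trans with (sum_f_R0 (fun i => kk (alpha + 1) i * Cnorm (cut N w i)) (N + L)).
- apply sum_f_R0_mono; [|lia]. intros.
  apply Rmult_le_pos; [apply kk_ge0; lra|apply Cnorm_ge0].
- rewrite cut_sum. apply H; lia.
Qed.

(** At fixed [r], truncation at [J] costs a tail of [w] times a sum of [r^j] against the growth of
    [T^j], which is finite. As [r] tends to 1, the Cesàro sums of [r T] converge to those of [T]
    index by index under a common majorant. *)
Lemma theta_abel_lim w x y :
  wsumm (alpha + 1) w ->
  vser (fun n => vscal (w n) (DeltaT alpha T n x)) y ->
  abel_lim (fun r J => vsum (fun j =>
    vscal (Cmul (RtoC (r ^ j)) (Iop alpha w j)) (Nat.iter j T x)) J) y.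
Proof.
intros Hw Hy eps He. destruct (Hw) as [M HM].
set (g := fun i => kk (alpha + 1) i * Cnorm (w i)).
assert (Hg : forall i, 0 <= g i)
  by (intros; apply Rmult_le_pos; [apply kk_ge0; lra|apply Cnorm_ge0]).
assert (Hs : forall i, wsumm alpha (shift w i))
  by (intros; apply wsumm_shift_le with (alpha + 1); auto; lra).
pose proof (vnorm_ge0 X x) as Hx.
assert (HKx : 0 <= K * vnorm x) by now apply Rmult_le_pos.
(* [c * g n] dominates the [n]-th term for [r T] minus that for [T], each bounded by
   [K * vnorm x * g n]; the 1 keeps [c] positive. *)
set (c := 2 * (K * vnorm x) + 1).
assert (Hc : 0 < eps / (4 * c)) by (apply Rdiv_lt_0_compat; unfold c; lra).
destruct (sum_f_R0_tail g M Hg HM _ Hc) as [N0 HN0].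
assert (HC : exists C, 0 <= C /\ forall r, 0 <= r <= 1 ->
  sum_f_R0 (fun n => Cnorm (w n) * vnorm (vsub (DeltaT_r r n x) (DeltaT alpha T n x))) N0
  <= (1 - r) * C).
{ induction N0 as [|N IH] in |- *; simpl.
  - destruct (DeltaT_r_near 0 x) as [C [C0 HC]]. exists (Cnorm (w O) * C).
    pose proof (Cnorm_ge0 (w O)). split; [nra|]. intros r Hr.
    specialize (HC r Hr). nra.
  - destruct IH as [C' [C'0 HC']]. destruct (DeltaT_r_near (S N) x) as [C [C0 HC]].
    exists (C' + Cnorm (w (S N)) * C). pose proof (Cnorm_ge0 (w (S N))). split; [nra|].
    intros r Hr. specialize (HC r Hr). specialize (HC' r Hr). nra. }
destruct HC as [C [C0 HC]].
assert (HD : 0 < eps / (4 * (C + 1))) by (apply Rdiv_lt_0_compat; lra).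
exists (Rmax 0 (1 - eps / (4 * (C + 1)))). split; [apply Rmax_lub_lt; lra|].
intros r Hr.
pose proof (Rmax_l 0 (1 - eps / (4 * (C + 1)))).
pose proof (Rmax_r 0 (1 - eps / (4 * (C + 1)))).
destruct (kk_geometric r (2 * alpha + 1) ltac:(lra) ltac:(lra)) as [G HG].
assert (G0 : 0 <= G).
{ eapply Rle_trans; [|apply (HG O)]. simpl. lra. }
(* [G], hence [e], depends on [r]; this is harmless since the inner limit in [J] is taken at fixed
   [r]. *)
set (e := K * vnorm x * G + 1). assert (He0 : 0 < e) by (unfold e; nra).
assert (Hce : 0 < eps / (4 * e)) by (apply Rdiv_lt_0_compat; lra).
destruct (sum_f_R0_tail g M Hg HM _ Hce) as [N1 HN1].
destruct (Hy (eps / 4)) as [N2 HN2]; [lra|].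
exists (N0 + N1 + N2)%nat. intros J HJ.
set (A := vsum (fun j => vscal (Cmul (RtoC (r ^ j)) (Iop alpha w j)) (Nat.iter j T x)) J).
set (B := vsum (fun n => vscal (w n) (DeltaT_r r n x)) J).
set (D := vsum (fun n => vscal (w n) (DeltaT alpha T n x)) J).
assert (E1 : vnorm (vsub A B) <= eps / 4).
{ unfold A, B. rewrite theta_sum_r by auto.
  apply Rle_trans with (sum_f_R0 (fun j => eps / (4 * e) * (K * vnorm x)
    * (r ^ j * kk (2 * alpha + 1) j)) J).
  - apply vsum_norm_le; intros j Hj. rewrite vnorm_scal, Cnorm_mul, Cnorm_RtoC.
    assert (0 <= r ^ j) by (apply pow_le; lra). rewrite Rabs_pos_eq by auto.
    assert (Hi : Cnorm (Iop alpha (cut J w) j) <= eps / (4 * e)).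
    { apply Iop_spec_by; [lra|]. intros L.
      apply Rle_trans with (sum_f_R0 (fun i => kk (alpha + 1) i
         * Cnorm (shift (cut J w) j i)) L).
      - apply sum_f_R0_le; intros i _. apply Rmult_le_compat_r; [apply Cnorm_ge0|].
        apply kk_le_param; lra.
      - apply wsumm_by_shift; [lra|]. apply wsumm_cut. intros P HP.
        apply Rlt_le, HN1; lia. }
    pose proof (power_growth j x). pose proof (Cnorm_ge0 (Iop alpha (cut J w) j)).
    pose proof (vnorm_ge0 X (Nat.iter j T x)).
    replace (eps / (4 * e) * (K * vnorm x) * (r ^ j * kk (2 * alpha + 1) j))
      with (r ^ j * (eps / (4 * e)) * (K * kk (2 * alpha + 1) j * vnorm x)) by ring.
    apply Rmult_le_compat; auto; [now apply Rmult_le_pos|].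
    now apply Rmult_le_compat_l.
  - rewrite sum_f_R0_scal. specialize (HG J).
    apply Rle_trans with (eps / (4 * e) * (K * vnorm x) * G).
    + apply Rmult_le_compat_l; auto. apply Rmult_le_pos; lra.
    + apply Rle_trans with (eps / (4 * e) * e); [|right; field; lra].
      rewrite Rmult_assoc. apply Rmult_le_compat_l; [lra|]. unfold e; lra. }
assert (E2 : vnorm (vsub B D) <= eps / 2).
{ unfold B, D. rewrite <- vsum_sub.
  apply Rle_trans with (sum_f_R0 (fun n => Cnorm (w n) *
     vnorm (vsub (DeltaT_r r n x) (DeltaT alpha T n x))) J).
  - apply vsum_norm_le; intros n _. rewrite <- vnorm_scal. right. f_equal. vring.
  - eapply Rle_trans; [apply sum_split_le with (g := fun n => c * g n) (N := N0)|]; [|lia|].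
    + intros n. unfold g. rewrite Rmult_comm.
      replace (c * (kk (alpha + 1) n * Cnorm (w n)))
        with (c * kk (alpha + 1) n * Cnorm (w n)) by ring.
      apply Rmult_le_compat_r; [apply Cnorm_ge0|].
      eapply Rle_trans; [apply vnorm_vsub|].
      pose proof (DeltaT_r_bound r n x ltac:(lra)). specialize (HDelta n x).
      pose proof (kk_ge0 (alpha + 1) n ltac:(lra)). unfold c. nra.
    + rewrite !sum_f_R0_scal. specialize (HC r ltac:(lra)).
      specialize (HN0 N0 J ltac:(lia) ltac:(lia)).
      assert (Q1 : (1 - r) * C <= eps / (4 * (C + 1)) * (C + 1)) by nra.
      assert (Q2 : eps / (4 * (C + 1)) * (C + 1) = eps / 4) by (field; lra).
      assert (Q3 : c * (eps / (4 * c)) = eps / 4) by (field; unfold c; lra).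
      assert (Q4 : c * (sum_f_R0 g J - sum_f_R0 g N0) <= c * (eps / (4 * c)))
        by (apply Rmult_le_compat_l; [unfold c|]; lra).
      lra. }
specialize (HN2 J ltac:(lia)). fold D in HN2.
pose proof (vsub_triangle X B A y). pose proof (vsub_triangle X D B y). lra.
Qed.

(** Zero at index 0, because [b 0] is already counted in the part [k >= 0]. *)
Definition neg_coef (b : Z -> Cx) (i : nat) : Cx :=
  match i with O => C0 | S _ => b (- Z.of_nat i)%Z end.

(* The coefficient [sum_k b(k) T^(n+k)] over [k >= -n], where [y] stands for
   the part [k >= 0] at [n = 0]. *)
Definition orbit_coef (b : Z -> Cx) (y x : X) (n : nat) : X :=
  vadd (Nat.iter n T y) (vcv (neg_coef b) (fun j => Nat.iter j T x) n).

Lemma iter_T_scal n c x : Nat.iter n T (vscal c x) = vscal c (Nat.iter n T x).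
Proof. apply (bounded_op_iter X T n HT). Qed.

(** The terms with [j <= n] are the finitely many negative coefficients, whose factors [r^j] tend to
    1. The others are [(r T)^(n+1)] applied to the Abel sums of theta. The order is [S n] so that
    the first block is not empty. *)
Lemma orbit_coef_abel_lim b x y n :
  in_A alpha b ->
  vser (fun n => vscal (W_frac alpha b (Z.of_nat n)) (DeltaT alpha T n x)) y ->
  abel_lim (fun r J => vsum (fun j => vscal (Cmul (b (Z.of_nat j - Z.of_nat (S n))%Z)
     (RtoC (r ^ j))) (Nat.iter j T x)) J) (orbit_coef b y x (S n)).
Proof.
intros Hb Hy. apply (abel_lim_shift X (S n)).
assert (L1 : abel_lim (fun r (J : nat) => vsum (fun j => vscal (RtoC (r ^ j))
    (vscal (b (Z.of_nat j - Z.of_nat (S n))%Z) (Nat.iter j T x))) n)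
   (vsum (fun j => vscal (b (Z.of_nat j - Z.of_nat (S n))%Z) (Nat.iter j T x)) n)).
{ apply (abel_lim_vsum X (fun j r (J : nat) => vscal (RtoC (r ^ j))
    (vscal (b (Z.of_nat j - Z.of_nat (S n))%Z) (Nat.iter j T x)))).
  intros j. apply (abel_lim_pow X j (fun _ _ => _)). apply abel_lim_const. }
assert (L2 := theta_abel_lim (fun n => W_frac alpha b (Z.of_nat n)) x y).
specialize (L2 (ex_intro _ _ (proj1 (A_norm_bound alpha Halpha b (proj2 Hb)))) Hy).
apply (abel_lim_bounded_op X _ _ _ (bounded_op_iter X T (S n) HT)) in L2.
apply (abel_lim_pow X (S n)) in L2.
pose proof (abel_lim_add X _ _ _ _ L2 L1) as L. clear L1 L2.
replace (orbit_coef b y x (S n)) with (vadd (Nat.iter (S n) T y)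
  (vsum (fun j => vscal (b (Z.of_nat j - Z.of_nat (S n))%Z) (Nat.iter j T x)) n)).
2:{ unfold orbit_coef. f_equal. unfold vcv. cbn [vsum].
    rewrite Nat.sub_diag. cbn [neg_coef]. rewrite vscal_0l, vadd_0.
    apply vsum_ext; intros j Hj. f_equal.
    replace (S n - j)%nat with (S (n - j)) by lia. cbn [neg_coef]. f_equal. lia. }
apply abel_lim_ext with (2 := L). intros r J.
rewrite vsum_cat, vadd_comm. f_equal.
- apply vsum_ext; intros j _. vring.
- clear L. induction J as [|J IH]; cbn [vsum].
  + rewrite iter_T_scal, !Nat.add_0_r, vscal_assoc.
    rewrite <- W_frac_reconstruction by auto. simpl (Z.of_nat 0).
    replace (Z.of_nat (S n) - Z.of_nat (S n))%Z with 0%Z by lia.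
    simpl (r ^ 0). rewrite RtoC_1. simpl (Nat.iter 0 T x). f_equal. ring.
  + rewrite <- IH. destruct (bounded_op_iter X T (S n) HT) as [TA _].
    rewrite TA, vscal_addv, iter_T_scal. f_equal.
    rewrite <- W_frac_reconstruction by auto.
    rewrite <- Nat.iter_add, vscal_assoc. f_equal.
    replace (Z.of_nat (S n + S J) - Z.of_nat (S n))%Z with (Z.of_nat (S J)) by lia.
    rewrite pow_add, RtoC_mul. ring.
Qed.

End CesaroBounded.

(** * Trigonometric sums on a uniform grid *)

Lemma Cexpi_add s t : Cexpi (s + t) = Cmul (Cexpi s) (Cexpi t).
Proof. apply Cx_eq; simpl; [apply cos_plus|rewrite sin_plus; ring]. Qed.

Lemma Cexpi_0 : Cexpi 0 = C1.
Proof. apply Cx_eq; simpl; [apply cos_0|apply sin_0]. Qed.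

Lemma Cexpi_PI : Cexpi PI = Copp C1.
Proof. apply Cx_eq; simpl; [apply cos_PI|rewrite sin_PI; ring]. Qed.

Lemma Cexpi_2PI : Cexpi (2 * PI) = C1.
Proof. apply Cx_eq; simpl; [apply cos_2PI|apply sin_2PI]. Qed.

Lemma Cexpi_opp_mul t : Cmul (Cexpi (- t)) (Cexpi t) = C1.
Proof. rewrite <- Cexpi_add, Rplus_opp_l. apply Cexpi_0. Qed.

Lemma Cexpi_nat_2PI n : Cexpi (INR n * (2 * PI)) = C1.
Proof.
induction n as [|n IH]; [rewrite Rmult_0_l; apply Cexpi_0|].
rewrite S_INR, Rmult_plus_distr_r, Cexpi_add, IH, Rmult_1_l, Cexpi_2PI. ring.
Qed.

Lemma Cexpi_Z_2PI l : Cexpi (IZR l * (2 * PI)) = C1.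
Proof.
destruct (Z.le_gt_cases 0 l) as [Hl|Hl].
- rewrite <- (Z2Nat.id l), <- INR_IZR_INZ by auto. apply Cexpi_nat_2PI.
- rewrite <- (Cexpi_opp_mul (IZR l * (2 * PI))).
  replace (- (IZR l * (2 * PI))) with (INR (Z.to_nat (- l)) * (2 * PI)).
  + rewrite Cexpi_nat_2PI. ring.
  + rewrite INR_IZR_INZ, Z2Nat.id, opp_IZR by lia. ring.
Qed.

Lemma Rabs_sin_le x : Rabs (sin x) <= Rabs x.
Proof.
assert (P : forall x, 0 <= x -> Rabs (sin x) <= x).
{ clear; intros x Hx. destruct (Rle_lt_dec x 1) as [H1|H1].
  - destruct Hx as [Hx|<-]; [|rewrite sin_0, Rabs_R0; lra].
    pose proof (sin_lt_x x Hx). pose proof PI_RGT_0. pose proof PI2_1.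
    pose proof (sin_gt_0 x Hx ltac:(lra)).
    rewrite Rabs_pos_eq; lra.
  - pose proof (SIN_bound x). apply Rabs_le; lra. }
destruct (Rle_lt_dec 0 x) as [H|H].
- rewrite (Rabs_pos_eq x); auto.
- rewrite <- Rabs_Ropp, <- sin_neg, (Rabs_left x) by auto. apply P; lra.
Qed.

(** The chord has squared length [4 sin^2 ((s - t) / 2)]. *)
Lemma Cexpi_lipschitz s t : Cnorm (Csub (Cexpi s) (Cexpi t)) <= Rabs (s - t).
Proof.
apply Cnorm_le_sqr; [apply Rabs_pos|]. simpl.
assert (E : (cos s + - cos t) * (cos s + - cos t) + (sin s + - sin t) * (sin s + - sin t)
  = 2 - 2 * cos (s - t)).
{ rewrite cos_minus. pose proof (sin2_cos2 s). pose proof (sin2_cos2 t).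
  unfold Rsqr in *. lra. }
rewrite E. replace (s - t) with (2 * ((s - t) / 2)) at 1 by field.
rewrite cos_2a_sin. pose proof (Rabs_sin_le ((s - t) / 2)) as H.
unfold Rdiv in H. rewrite Rabs_mult, (Rabs_pos_eq (/ 2)) in H by lra.
pose proof (Rabs_pos (sin ((s - t) * / 2))).
assert (Rabs (sin ((s - t) * / 2)) * Rabs (sin ((s - t) * / 2))
  = sin ((s - t) * / 2) * sin ((s - t) * / 2))
  by (rewrite <- Rabs_mult, Rabs_pos_eq; nra).
unfold Rdiv. nra.
Qed.

Lemma Cexpi_neq1 t : 0 < Rabs t < 2 * PI -> Cexpi t <> C1.
Proof.
intros Ht E. assert (Hc : cos t = 1) by exact (f_equal re E).
assert (Hc' : cos (Rabs t) = 1).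
{ unfold Rabs. destruct (Rcase_abs t); auto. now rewrite cos_neg. }
replace (Rabs t) with (2 * (Rabs t / 2)) in Hc' by field.
rewrite cos_2a_sin in Hc'.
pose proof (sin_gt_0 (Rabs t / 2) ltac:(lra) ltac:(lra)). nra.
Qed.

Definition grid (N k : nat) : R := INR k * (2 * PI / INR N).

Lemma grid_add N j k : grid N (j + k) = grid N j + grid N k.
Proof. unfold grid. rewrite plus_INR. ring. Qed.

Lemma grid_full N : grid (S N) (S N) = 2 * PI.
Proof. unfold grid. field. apply not_0_INR; lia. Qed.

(** Multiplied by [z - 1], the sum telescopes to 0. *)
Lemma Csum_geometric_periodic (u : nat -> Cx) z n :
  (forall k, u (S k) = Cmul z (u k)) -> u (S n) = u O -> z <> C1 -> Csum u n = C0.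
Proof.
intros Hu Hp Hz.
assert (E : Cmul (Csub z C1) (Csum u n) = Csub (u (S n)) (u O)).
{ clear Hp. induction n as [|n IH]; simpl.
  - rewrite Hu. ring.
  - replace (Cmul (Csub z C1) (Cadd (Csum u n) (u (S n))))
      with (Cadd (Cmul (Csub z C1) (Csum u n)) (Csub (Cmul z (u (S n))) (u (S n)))) by ring.
    rewrite IH, <- Hu. ring. }
rewrite Hp in E. apply Cnorm_eq0.
assert (H : Cnorm (Csub z C1) * Cnorm (Csum u n) = 0).
{ rewrite <- Cnorm_mul, E. replace (Csub (u O) (u O)) with C0 by ring. apply Cnorm_C0. }
destruct (Rmult_integral _ _ H) as [H1|H1]; auto.
apply Cnorm_eq0 in H1. elim Hz.
replace z with (Cadd (Csub z C1) C1) by ring. rewrite H1. ring.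
Qed.

Lemma Csum_const c n : Csum (fun _ => c) n = Cmul (RtoC (INR (S n))) c.
Proof.
induction n as [|n IH]; [simpl; rewrite RtoC_1; ring|].
cbn [Csum]. rewrite IH, (S_INR (S n)), RtoC_add, RtoC_1. ring.
Qed.

Lemma grid_orthogonality N q :
  (Z.abs q < Z.of_nat (S N))%Z ->
  Csum (fun k => Cexpi (IZR q * grid (S N) k)) N
  = if Z.eqb q 0 then RtoC (INR (S N)) else C0.
Proof.
intros Hq. destruct (Z.eqb_spec q 0) as [->|Hne].
- rewrite <- (Rmul_1_l Cx_ring (RtoC _)), (Rmul_comm Cx_ring), <- Csum_const.
  f_equal. extensionality k. rewrite Rmult_0_l. apply Cexpi_0.
- pose proof PI_RGT_0 as Hpi. pose proof (lt_0_INR (S N) ltac:(lia)) as HN.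
  apply Csum_geometric_periodic with (z := Cexpi (IZR q * grid (S N) 1)).
  + intros k. rewrite <- Cexpi_add, <- Rmult_plus_distr_l, <- grid_add. reflexivity.
  + rewrite grid_full. replace (grid (S N) 0) with 0 by (unfold grid; simpl; ring).
    now rewrite Cexpi_Z_2PI, Rmult_0_r, Cexpi_0.
  + apply Cexpi_neq1. unfold grid. rewrite Rabs_mult, <- abs_IZR.
    rewrite (Rabs_pos_eq (INR 1 * _)).
    2:{ simpl (INR 1). rewrite Rmult_1_l. apply Rlt_le, Rdiv_lt_0_compat; lra. }
    simpl (INR 1). rewrite Rmult_1_l.
    assert (1 <= IZR (Z.abs q)) by (apply IZR_le; lia).
    assert (IZR (Z.abs q) < INR (S N)) by (rewrite INR_IZR_INZ; now apply IZR_lt).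
    assert (Hs : 0 < 2 * PI / INR (S N)) by (apply Rdiv_lt_0_compat; lra).
    split; [nra|].
    apply Rlt_le_trans with (INR (S N) * (2 * PI / INR (S N))); [nra|].
    right; field; lra.
Qed.

Lemma Csum_Z_S g L :
  Csum_Z g (S L) = Cadd (Csum_Z g L) (Cadd (g (Z.of_nat (S L))) (g (- Z.of_nat (S L))%Z)).
Proof. unfold Csum_Z. cbn [Csum]. ring. Qed.

Lemma Csum_Z_0 g : Csum_Z g 0 = g 0%Z.
Proof. unfold Csum_Z. simpl. ring. Qed.

Lemma Csum_add f g n : Csum (fun i => Cadd (f i) (g i)) n = Cadd (Csum f n) (Csum g n).
Proof. induction n as [|n IH]; simpl; auto. rewrite IH. ring. Qed.

Lemma Csum_scal c f n : Csum (fun i => Cmul c (f i)) n = Cmul c (Csum f n).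
Proof. induction n as [|n IH]; simpl; auto. rewrite IH. ring. Qed.

Definition fpart (b : Z -> Cx) (L : nat) (t : R) : Cx :=
  Csum_Z (fun l => Cmul (b l) (Cexpi (IZR l * t))) L.

(** The hypothesis excludes aliasing: every frequency [p + q] with [|q| <= L] is smaller than the
    number of nodes, so the grid average is exactly a Fourier coefficient. *)
Lemma grid_coefficient b p N L :
  (Z.abs p + Z.of_nat L < Z.of_nat (S N))%Z ->
  Csum (fun k => Cmul (Cexpi (IZR p * grid (S N) k)) (fpart b L (grid (S N) k))) N
  = if Z.leb (Z.abs p) (Z.of_nat L) then Cmul (RtoC (INR (S N))) (b (- p)%Z) else C0.
Proof.
assert (D : forall q, (Z.abs (p + q) < Z.of_nat (S N))%Z ->
  Csum (fun k => Cmul (Cexpi (IZR p * grid (S N) k))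
     (Cmul (b q) (Cexpi (IZR q * grid (S N) k)))) N
  = if Z.eqb (p + q) 0 then Cmul (RtoC (INR (S N))) (b (- p)%Z) else C0).
{ intros q Hq.
  replace (fun k => Cmul (Cexpi (IZR p * grid (S N) k))
     (Cmul (b q) (Cexpi (IZR q * grid (S N) k))))
    with (fun k => Cmul (b q) (Cexpi (IZR (p + q) * grid (S N) k))).
  2:{ extensionality k. rewrite plus_IZR, Rmult_plus_distr_r, Cexpi_add. ring. }
  rewrite Csum_scal, grid_orthogonality by auto.
  destruct (Z.eqb_spec (p + q) 0); [|ring]. replace q with (- p)%Z by lia. ring. }
induction L as [|L IH]; intros HL.
- unfold fpart.
  replace (fun k => Cmul (Cexpi (IZR p * grid (S N) k)) (Csum_Z _ 0))
    with (fun k => Cmul (Cexpi (IZR p * grid (S N) k))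
      (Cmul (b 0%Z) (Cexpi (IZR 0 * grid (S N) k))))
    by (extensionality k; now rewrite Csum_Z_0).
  rewrite D by lia. destruct (Z.eqb_spec (p + 0) 0), (Z.leb_spec (Z.abs p) (Z.of_nat 0));
    auto; lia.
- unfold fpart.
  replace (fun k => Cmul (Cexpi (IZR p * grid (S N) k)) (Csum_Z _ (S L)))
    with (fun k => Cadd (Cmul (Cexpi (IZR p * grid (S N) k)) (fpart b L (grid (S N) k)))
       (Cadd (Cmul (Cexpi (IZR p * grid (S N) k)) (Cmul (b (Z.of_nat (S L)))
                (Cexpi (IZR (Z.of_nat (S L)) * grid (S N) k))))
             (Cmul (Cexpi (IZR p * grid (S N) k)) (Cmul (b (- Z.of_nat (S L))%Z)
                (Cexpi (IZR (- Z.of_nat (S L)) * grid (S N) k))))))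
    by (extensionality k; rewrite Csum_Z_S; unfold fpart; ring).
  rewrite !Csum_add, IH, !D by lia.
  destruct (Z.leb_spec (Z.abs p) (Z.of_nat L)), (Z.eqb_spec (p + Z.of_nat (S L)) 0),
    (Z.eqb_spec (p + - Z.of_nat (S L)) 0), (Z.leb_spec (Z.abs p) (Z.of_nat (S L)));
    try lia; ring.
Qed.

(** * Absolutely convergent Fourier series *)

Section FourierSeries.

Variables (b : Z -> Cx) (l : R).
Hypothesis Hl : Un_cv (Rsum_Z (fun n => Cnorm (b n))) l.

Lemma Rsum_Z_step (f : Z -> R) L :
  Rsum_Z f (S L) = Rsum_Z f L + (f (Z.of_nat (S L)) + f (- Z.of_nat (S L))%Z).
Proof. unfold Rsum_Z. rewrite !tech5. ring. Qed.

Lemma Cnorm_mul_Cexpi c t : Cnorm (Cmul c (Cexpi t)) = Cnorm c.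
Proof. rewrite Cnorm_mul, Cnorm_Cexpi. ring. Qed.

Lemma fpart_norm L t : Cnorm (fpart b L t) <= Rsum_Z (fun n => Cnorm (b n)) L.
Proof.
induction L as [|L IH]; unfold fpart.
- rewrite Csum_Z_0, Rsum_Z_0, Cnorm_mul_Cexpi. lra.
- rewrite Csum_Z_S, Rsum_Z_step. eapply Rle_trans; [apply Cnorm_add|].
  apply Rplus_le_compat; auto. eapply Rle_trans; [apply Cnorm_add|].
  rewrite !Cnorm_mul_Cexpi. lra.
Qed.

Lemma fpart_cauchy L L' t : (L <= L')%nat ->
  Cnorm (Csub (fpart b L' t) (fpart b L t))
  <= Rsum_Z (fun n => Cnorm (b n)) L' - Rsum_Z (fun n => Cnorm (b n)) L.
Proof.
induction 1 as [|L' HL IH].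
- unfold Rminus. rewrite Rplus_opp_r.
  replace (Csub (fpart b L t) (fpart b L t)) with C0 by ring. rewrite Cnorm_C0. lra.
- unfold fpart at 1. rewrite Csum_Z_S, Rsum_Z_step. fold (fpart b L' t).
  set (u := Cmul (b (Z.of_nat (S L'))) _). set (v := Cmul (b (- Z.of_nat (S L'))%Z) _).
  replace (Csub (Cadd (fpart b L' t) (Cadd u v)) (fpart b L t))
    with (Cadd (Csub (fpart b L' t) (fpart b L t)) (Cadd u v)) by ring.
  eapply Rle_trans; [apply Cnorm_add|].
  pose proof (Cnorm_add u v). unfold u, v in *. rewrite !Cnorm_mul_Cexpi in *. lra.
Qed.

Lemma fval_conv t : @vconv CxB (fun L => fpart b L t) (fval b t).
Proof.
destruct (Cx_complete (fun L => fpart b L t)) as [v Hv].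
- intros eps He. destruct (Hl (eps / 2)) as [N HN]; [lra|]. exists N.
  assert (C : forall m n, (N <= n)%nat -> (n <= m)%nat ->
    Cnorm (Csub (fpart b m t) (fpart b n t)) < eps).
  { intros m n Hn Hm. eapply Rle_lt_trans; [apply fpart_cauchy; auto|].
    pose proof (HN n Hn) as H1. pose proof (HN m ltac:(lia)) as H2.
    apply Rabs_def2 in H1, H2. lra. }
  intros m n Hm Hn. destruct (Nat.le_ge_cases n m).
  + apply C; auto.
  + rewrite <- Cnorm_opp.
    replace (Copp (Cadd (fpart b m t) (Copp (fpart b n t))))
      with (Csub (fpart b n t) (fpart b m t)) by ring. apply C; auto.
- change (fval b t) with (Clim (fun L => fpart b L t)). now rewrite (Clim_spec (fun L => fpart b L t) v).
Qed.

Lemma fval_norm t : Cnorm (fval b t) <= l.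
Proof.
apply (vconv_le CxB _ _ _ (fval_conv t)). exists O; intros n _.
eapply Rle_trans; [apply fpart_norm|].
apply growing_ineq; auto. apply Rsum_Z_growing; intros; apply Cnorm_ge0.
Qed.

Lemma fval_approx L t :
  Cnorm (Csub (fval b t) (fpart b L t)) <= l - Rsum_Z (fun n => Cnorm (b n)) L.
Proof.
apply (vconv_le CxB _ _ _ (vconv_sub CxB _ _ _ _ (fval_conv t)
  (vconv_const CxB (fpart b L t)))).
exists L; intros n Hn. eapply Rle_trans; [apply (fpart_cauchy L n t); lia|].
pose proof (growing_ineq _ _ (Rsum_Z_growing _ (fun n => Cnorm_ge0 (b n))) Hl n). lra.
Qed.

Lemma fpart_lipschitz L : exists C, 0 <= C /\ forall s t,
  Cnorm (Csub (fpart b L s) (fpart b L t)) <= C * Rabs (s - t).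
Proof.
assert (D : forall q s t, Cnorm (Csub (Cmul (b q) (Cexpi (IZR q * s)))
  (Cmul (b q) (Cexpi (IZR q * t)))) <= Cnorm (b q) * Rabs (IZR q) * Rabs (s - t)).
{ intros q s t.
  replace (Csub (Cmul (b q) (Cexpi (IZR q * s))) (Cmul (b q) (Cexpi (IZR q * t))))
    with (Cmul (b q) (Csub (Cexpi (IZR q * s)) (Cexpi (IZR q * t)))) by ring.
  rewrite Cnorm_mul, Rmult_assoc, <- Rabs_mult.
  apply Rmult_le_compat_l; [apply Cnorm_ge0|].
  eapply Rle_trans; [apply Cexpi_lipschitz|]. right; f_equal; ring. }
induction L as [|L [C [C0 IH]]]; unfold fpart.
- exists (Cnorm (b 0%Z) * Rabs (IZR 0)). split.
  + apply Rmult_le_pos; [apply Cnorm_ge0|apply Rabs_pos].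
  + intros s t. rewrite !Csum_Z_0. apply D.
- set (q := Z.of_nat (S L)).
  exists (C + Cnorm (b q) * Rabs (IZR q) + Cnorm (b (- q)%Z) * Rabs (IZR (- q))). split.
  + pose proof (Cnorm_ge0 (b q)). pose proof (Rabs_pos (IZR q)).
    pose proof (Cnorm_ge0 (b (- q)%Z)). pose proof (Rabs_pos (IZR (- q))).
    pose proof (Rmult_le_pos _ _ H H0). pose proof (Rmult_le_pos _ _ H1 H2). lra.
  + intros s t. rewrite !Csum_Z_S. fold (fpart b L s) (fpart b L t) q.
    specialize (IH s t). pose proof (D q s t). pose proof (D (- q)%Z s t).
    set (u1 := Cmul (b q) (Cexpi (IZR q * s))) in *.
    set (u2 := Cmul (b q) (Cexpi (IZR q * t))) in *.
    set (v1 := Cmul (b (- q)%Z) (Cexpi (IZR (- q) * s))) in *.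
    set (v2 := Cmul (b (- q)%Z) (Cexpi (IZR (- q) * t))) in *.
    replace (Csub (Cadd (fpart b L s) (Cadd u1 v1)) (Cadd (fpart b L t) (Cadd u2 v2)))
      with (Cadd (Csub (fpart b L s) (fpart b L t)) (Cadd (Csub u1 u2) (Csub v1 v2))) by ring.
    eapply Rle_trans; [apply Cnorm_add|].
    pose proof (Cnorm_add (Csub u1 u2) (Csub v1 v2)). lra.
Qed.

Lemma fval_uniform_continuity eps : eps > 0 ->
  exists d, d > 0 /\ forall s t, Rabs (s - t) < d ->
    Cnorm (Csub (fval b s) (fval b t)) < eps.
Proof.
intros He. destruct (Hl (eps / 4)) as [L HL]; [lra|].
specialize (HL L (Nat.le_refl L)). apply Rabs_def2 in HL.
destruct (fpart_lipschitz L) as [C [C0 HC]].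
assert (Hd : 0 < eps / (4 * (C + 1))) by (apply Rdiv_lt_0_compat; lra).
exists (eps / (4 * (C + 1))); split; auto. intros s t Hst.
pose proof (fval_approx L s) as H1. pose proof (fval_approx L t) as H2.
specialize (HC s t).
pose proof (vsub_triangle CxB (fpart b L s) (fval b s) (fval b t)) as T1.
pose proof (vsub_triangle CxB (fpart b L t) (fpart b L s) (fval b t)) as T2.
rewrite (vsub_sym CxB (fpart b L t) (fval b t)) in T2.
change (@vsub CxB) with Csub in *. change (@vnorm CxB) with Cnorm in *.
assert (E : (C + 1) * (eps / (4 * (C + 1))) = eps / 4) by (field; lra).
pose proof (Rabs_pos (s - t)). nra.
Qed.

Lemma fval_periodic t : fval b (t + 2 * PI) = fval b t.
Proof.
unfold fval. do 2 f_equal. extensionality n.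
now rewrite Rmult_plus_distr_l, Cexpi_add, Cexpi_Z_2PI, (Rmul_comm Cx_ring _ C1),
  (Rmul_1_l Cx_ring).
Qed.

End FourierSeries.

(** * The Riemann-Lebesgue estimate on a grid *)

Section GridRiemannLebesgue.

Variable X : CBanach.

Add Ring sqz_ring_inst5 : (sqz_ring X).

Lemma vsum_cyclic (u : nat -> X) N m :
  (forall k, u (S N + k)%nat = u k) -> vsum (fun k => u (m + k)%nat) N = vsum u N.
Proof.
intros Hp. induction m as [|m IH]; auto. rewrite <- IH.
pose proof (vsum_recl X (fun k => u (m + k)%nat) N) as E. cbn [vsum] in E.
replace (u (m + S N)%nat) with (u (m + 0)%nat) in E.
2:{ rewrite (Nat.add_comm m (S N)), Nat.add_0_r. symmetry. apply Hp. }
apply (vadd_cancel_l X (u (m + 0)%nat)).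
rewrite (vsum_ext X (fun k => u (S m + k)%nat) (fun i => u (m + S i)%nat)).
- rewrite <- E. apply vadd_comm.
- intros i _. f_equal. lia.
Qed.

(* Shifting the grid by half a period of [exp (i n t)] changes its sign. *)
Lemma grid_riemann_lebesgue (phi : R -> X) n m N C :
  (0 < n)%nat -> S N = (2 * n * m)%nat ->
  (forall t, phi (t + 2 * PI) = phi t) ->
  (forall t, 0 <= t <= 2 * PI -> vnorm (vsub (phi t) (phi (t + PI / INR n))) <= C) ->
  vnorm (vsum (fun k => vscal (Cexpi (INR n * grid (S N) k)) (phi (grid (S N) k))) N)
  <= INR (S N) * C / 2.
Proof.
intros Hn HN Hper HC.
pose proof (lt_0_INR n Hn) as Hn0. pose proof PI_RGT_0 as Hpi.
assert (Hm : (0 < m)%nat) by (destruct m; lia).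
pose proof (lt_0_INR m Hm) as Hm0. pose proof (lt_0_INR (S N) ltac:(lia)) as HN0.
assert (EN : INR (S N) = 2 * INR n * INR m) by (rewrite HN, !mult_INR; simpl; ring).
(* With [2 n m] nodes the half period [PI / n] is exactly [m] grid steps, so the shift permutes the
   nodes. *)
assert (Hg : forall k, grid (S N) (m + k) = grid (S N) k + PI / INR n).
{ intros k. rewrite grid_add, Rplus_comm. f_equal. unfold grid. rewrite EN.
  field. lra. }
set (u := fun k => vscal (Cexpi (INR n * grid (S N) k)) (phi (grid (S N) k))).
assert (Hcyc : vsum (fun k => u (m + k)%nat) N = vsum u N).
{ apply vsum_cyclic. intros k. unfold u. rewrite grid_add, grid_full, Rplus_comm, Hper.
  now rewrite Rmult_plus_distr_l, Cexpi_add, Cexpi_nat_2PI, (Rmul_comm Cx_ring _ C1),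
    (Rmul_1_l Cx_ring). }
assert (E : vadd (vsum u N) (vsum u N) = vsum (fun k => vscal (Cexpi (INR n * grid (S N) k))
   (vsub (phi (grid (S N) k)) (phi (grid (S N) k + PI / INR n)))) N).
{ rewrite <- Hcyc at 2. rewrite <- vsum_add. apply vsum_ext; intros k _.
  unfold u. rewrite Hg, Rmult_plus_distr_l, Cexpi_add.
  replace (INR n * (PI / INR n)) with PI by (field; lra).
  rewrite Cexpi_PI. vring. }
assert (B : vnorm (vadd (vsum u N) (vsum u N)) <= INR (S N) * C).
{ rewrite E. eapply Rle_trans; [apply vsum_norm_le with (g := fun _ => C)|].
  - intros k Hk. rewrite vnorm_scal, Cnorm_Cexpi, Rmult_1_l. apply HC.
    unfold grid. assert (Hs : 0 < 2 * PI / INR (S N)) by (apply Rdiv_lt_0_compat; lra).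
    pose proof (pos_INR k). assert (INR k <= INR (S N)) by (apply le_INR; lia).
    split; [nra|]. apply Rle_trans with (INR (S N) * (2 * PI / INR (S N))); [nra|].
    right; field; lra.
  - rewrite sum_cte. lra. }
replace (vadd (vsum u N) (vsum u N)) with (vscal (RtoC 2) (vsum u N)) in B.
- rewrite vnorm_scal, Cnorm_RtoC, Rabs_pos_eq in B by lra. lra.
- replace (RtoC 2) with (Cadd C1 C1) by (apply Cx_eq; simpl; ring).
  now rewrite vscal_adds, vscal_1.
Qed.

End GridRiemannLebesgue.

(** * Decay of the orbit coefficients *)

Section OrbitDecay.

Variables (X : CBanach) (T : X -> X) (M : R).
Hypothesis HT : bounded_op T.
Hypothesis HM0 : 0 <= M.
Hypothesis HM : forall x, vnorm (T x) <= M * vnorm x.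

Add Ring sqz_ring_inst6 : (sqz_ring X).

Lemma T_vadd x y : T (vadd x y) = vadd (T x) (T y).
Proof. apply HT. Qed.

Lemma T_vscal c x : T (vscal c x) = vscal c (T x).
Proof. apply HT. Qed.

Lemma T_vsub x y : T (vsub x y) = vsub (T x) (T y).
Proof. unfold vsub. now rewrite T_vadd, !vopp_scal, T_vscal. Qed.

Definition res_op (r t : R) (y : X) : X :=
  vsub y (vscal (Cmul (RtoC r) (Cexpi (- t))) (T y)).

(** The inverse at [Cexpi t0] bounds [T - Cexpi t0] from below, and [- Cexpi s] times [res_op r s]
    differs from that operator only by [Cexpi s - Cexpi t0] and [(1 - r) T], both small. *)
Lemma res_op_local_lower_bound t0 :
  ~ in_spectrum T (Cexpi t0) ->
  exists d, 0 < d /\ forall s r, Rabs (s - t0) < d -> 1 - d < r < 1 ->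
    forall y, d * vnorm y <= vnorm (res_op r s y).
Proof.
intros H. apply NNPP in H. destruct H as [S [[_ [_ [P HP]]] HS]].
set (Q := Rabs P + 1).
assert (HQ : 0 < Q) by (unfold Q; pose proof (Rabs_pos P); lra).
assert (L : forall y, vnorm y <= Q * vnorm (vsub (T y) (vscal (Cexpi t0) y))).
{ intros y. destruct (HS y) as [E _]. rewrite <- E at 1.
  eapply Rle_trans; [apply HP|]. apply Rmult_le_compat_r; [apply vnorm_ge0|].
  unfold Q. pose proof (Rle_abs P). lra. }
(* With [Q d (2 + M) = 1], the two perturbations use up [Q d (1 + M)] of [vnorm y] and leave
   [Q d]. *)
set (d := / (Q * (2 + M))).
assert (Hd : 0 < d) by (apply Rinv_0_lt_compat; nra).
assert (HdQ : Q * d * (2 + M) = 1) by (unfold d; field; lra).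
exists d; split; auto. intros s r Hs Hr y.
assert (E : vsub (T y) (vscal (Cexpi t0) y)
  = vadd (vscal (Copp (Cexpi s)) (res_op r s y))
      (vadd (vscal (Csub (Cexpi s) (Cexpi t0)) y) (vscal (RtoC (1 - r)) (T y)))).
{ unfold res_op. replace (RtoC (1 - r)) with (Csub C1 (RtoC r)) by (apply Cx_eq; simpl; ring).
  replace (vscal (Copp (Cexpi s)) (vsub y (vscal (Cmul (RtoC r) (Cexpi (- s))) (T y))))
    with (vadd (vscal (Copp (Cexpi s)) y)
       (vscal (Cmul (RtoC r) (Cmul (Cexpi (- s)) (Cexpi s))) (T y))) by vring.
  rewrite Cexpi_opp_mul. vring. }
specialize (L y). rewrite E in L.
pose proof (vnorm_triangle X (vscal (Copp (Cexpi s)) (res_op r s y))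
  (vadd (vscal (Csub (Cexpi s) (Cexpi t0)) y) (vscal (RtoC (1 - r)) (T y)))) as T1.
pose proof (vnorm_triangle X (vscal (Csub (Cexpi s) (Cexpi t0)) y)
  (vscal (RtoC (1 - r)) (T y))) as T2.
rewrite !vnorm_scal, Cnorm_opp, Cnorm_Cexpi in T1.
rewrite !vnorm_scal, Cnorm_RtoC, (Rabs_pos_eq (1 - r)) in T2 by lra.
pose proof (Cexpi_lipschitz s t0) as T3. pose proof (HM y) as T4.
pose proof (vnorm_ge0 X y) as Y0. pose proof (vnorm_ge0 X (T y)).
assert (B1 : Cnorm (Csub (Cexpi s) (Cexpi t0)) * vnorm y <= d * vnorm y)
  by (apply Rmult_le_compat_r; lra).
assert (B2 : (1 - r) * vnorm (T y) <= d * (M * vnorm y))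
  by (apply Rmult_le_compat; lra).
apply Rmult_le_reg_l with Q; auto.
assert (B3 : vnorm y <= Q * (vnorm (res_op r s y) + (d * vnorm y + d * (M * vnorm y)))).
{ eapply Rle_trans; [apply L|]. apply Rmult_le_compat_l; lra. }
assert (B4 : vnorm y = Q * d * (2 + M) * vnorm y) by (rewrite HdQ; ring).
nra.
Qed.

(** Compactness: around each [t], either a whole interval is sent into [U], or the local bound
    holds. The length [4 PI] leaves room for a shift by at most [PI] from [[0, 2 PI]] without
    reduction modulo the period. *)
Lemma res_op_lower_bound (U : Cx -> Prop) :
  C_open U -> (forall z, in_spectrum T z /\ Cnorm z = 1 -> U z) ->
  exists d, 0 < d <= 1 /\ forall s, 0 <= s <= 4 * PI -> ~ U (Cexpi s) ->
    forall r, 1 - d < r < 1 -> forall y, d * vnorm y <= vnorm (res_op r s y).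
Proof.
intros HU HE.
assert (H : forall t, exists d : posreal, forall s, Rabs (s - t) < d -> ~ U (Cexpi s) ->
  forall r, 1 - d < r < 1 -> forall y, d * vnorm y <= vnorm (res_op r s y)).
{ intros t. destruct (classic (U (Cexpi t))) as [Ht|Ht].
  - destruct (HU _ Ht) as [rho [H0 H1]]. exists (mkposreal rho H0). simpl.
    intros s Hs Hn. elim Hn. apply H1.
    eapply Rle_lt_trans; [apply Cexpi_lipschitz|auto].
  - assert (Hn : ~ in_spectrum T (Cexpi t)).
    { intros Hsp. apply Ht, HE. split; auto. apply Cnorm_Cexpi. }
    destruct (res_op_local_lower_bound t Hn) as [d [Hd H0]].
    exists (mkposreal d Hd). simpl. intros; now apply H0. }
set (delta := fun t => proj1_sig (constructive_indefinite_description _ (H t))).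
destruct (Compactness.compactness_value_1d 0 (4 * PI) delta) as [d Hd].
exists (Rmin d 1). pose proof (cond_pos d) as Hd0.
pose proof (Rmin_l d 1). pose proof (Rmin_r d 1).
split; [split; [apply Rmin_glb_lt; lra|auto]|].
intros s Hs Hn r Hr y.
(* The covering point is given under a double negation only, hence a proof by contradiction. *)
apply Rnot_lt_le; intros Hlt. apply (Hd s Hs). intros [t [_ [Hst Hdt]]].
assert (H3 : forall s, Rabs (s - t) < delta t -> ~ U (Cexpi s) ->
  forall r, 1 - delta t < r < 1 -> forall y, delta t * vnorm y <= vnorm (res_op r s y))
  by exact (proj2_sig (constructive_indefinite_description _ (H t))).
specialize (H3 s Hst Hn r ltac:(lra) y).
pose proof (vnorm_ge0 X y). nra.
Qed.

(** A truncated Neumann series in place of the resolvent at [x]. It is a polynomial in [exp(-it)],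
    so finite grids recover its coefficients. *)
Definition res_part (r : R) (x : X) (J : nat) (t : R) : X :=
  vsum (fun j => vscal (Cmul (RtoC (r ^ j)) (Cexpi (- (INR j * t)))) (Nat.iter j T x)) J.

Lemma res_part_eq r x J t :
  res_op r t (res_part r x J t)
  = vsub x (vscal (Cmul (RtoC (r ^ S J)) (Cexpi (- (INR (S J) * t)))) (Nat.iter (S J) T x)).
Proof.
induction J as [|J IH].
- unfold res_op, res_part. cbn [vsum]. rewrite T_vscal. simpl.
  replace (- (0 * t)) with 0 by ring. replace (- (1 * t)) with (- t) by ring.
  rewrite Cexpi_0, RtoC_1, Rmult_1_r. vring.
- unfold res_part. cbn [vsum]. fold (res_part r x J t).
  set (p := vscal (Cmul (RtoC (r ^ S J)) (Cexpi (- (INR (S J) * t)))) (Nat.iter (S J) T x)) in *.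
  replace (res_op r t (vadd (res_part r x J t) p))
    with (vadd (res_op r t (res_part r x J t)) (res_op r t p)).
  2:{ unfold res_op. rewrite T_vadd. vring. }
  rewrite IH. unfold res_op, p. rewrite T_vscal.
  change (T (Nat.iter (S J) T x)) with (Nat.iter (S (S J)) T x).
  replace (- (INR (S (S J)) * t)) with (- t + - (INR (S J) * t))
    by (rewrite (S_INR (S J)); ring).
  change (r ^ S (S J)) with (r * r ^ S J).
  rewrite Cexpi_add, RtoC_mul. vring.
Qed.

Lemma res_part_periodic r x J t : res_part r x J (t + 2 * PI) = res_part r x J t.
Proof.
unfold res_part. apply vsum_ext; intros j _. do 2 f_equal.
replace (- (INR j * (t + 2 * PI))) with (- (INR j * t) + IZR (- Z.of_nat j) * (2 * PI)).
- rewrite Cexpi_add, Cexpi_Z_2PI. ring.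
- rewrite opp_IZR, <- INR_IZR_INZ. ring.
Qed.

Lemma res_part_norm r x J t : 0 <= r <= 1 ->
  vnorm (res_part r x J t) <= sum_f_R0 (fun j => vnorm (Nat.iter j T x)) J.
Proof.
intros Hr. apply vsum_norm_le; intros j _.
rewrite vnorm_scal, Cnorm_mul_Cexpi, Cnorm_RtoC.
assert (0 <= r ^ j) by (apply pow_le; lra).
assert (r ^ j <= 1) by (rewrite <- (pow1 j); now apply pow_incr).
rewrite Rabs_pos_eq by auto. pose proof (vnorm_ge0 X (Nat.iter j T x)). nra.
Qed.

(** * Equicontinuity of the truncated symbol and decay of its coefficients *)

Section Symbol.

Variables (b : Z -> Cx) (l : R) (U : Cx -> Prop) (d : R).
Hypothesis Hl : Un_cv (Rsum_Z (fun n => Cnorm (b n))) l.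
Hypothesis HU : forall t, U (Cexpi t) -> fval b t = C0.
Hypothesis Hd : 0 < d <= 1.
Hypothesis Hlow : forall s, 0 <= s <= 4 * PI -> ~ U (Cexpi s) ->
  forall r, 1 - d < r < 1 -> forall y, d * vnorm y <= vnorm (res_op r s y).

Definition sym_part (r : R) (x : X) (J : nat) (t : R) : X :=
  vscal (fval b t) (res_part r x J t).

(** At a point of [U] the function vanishes, whatever the Neumann sum is. Outside, the lower bound
    gives [2 vnorm x / d] for that sum, the residual being at most [vnorm x]. The term in [om] is
    the variation of [fval b]; the term in [l] is that of the Neumann sum, with [2 h] from two
    residuals and [2 h M / d] from moving [t] to [s]. *)
Lemma sym_part_continuity r x J h om s t :
  1 - d < r < 1 -> 0 <= h ->
  r ^ S J * vnorm (Nat.iter (S J) T x) <= Rmin h 1 * vnorm x ->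
  0 <= s <= 4 * PI -> 0 <= t <= 4 * PI -> Rabs (s - t) <= h ->
  Cnorm (Csub (fval b s) (fval b t)) <= om ->
  vnorm (vsub (sym_part r x J s) (sym_part r x J t))
  <= (2 * om / d + l * (2 * h + 2 * h * M / d) / d) * vnorm x.
Proof.
intros Hr Hh Heta Hs Ht Hst Hom.
pose proof (vnorm_ge0 X x) as Hx. pose proof (Cnorm_ge0 (Csub (fval b s) (fval b t))).
assert (Hom0 : 0 <= om) by lra.
assert (Hl0 : 0 <= l) by (eapply Rle_trans; [apply Cnorm_ge0|apply (fval_norm b l Hl 0)]).
pose proof (Rmin_l h 1) as Hm1. pose proof (Rmin_r h 1) as Hm2.
assert (Hr0 : 0 <= r ^ S J) by (apply pow_le; lra).
assert (Hres : forall u, vnorm (vsub (res_op r u (res_part r x J u)) x) <= Rmin h 1 * vnorm x).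
{ intros u. rewrite res_part_eq, vsub_sym.
  replace (vsub x (vsub x _)) with (vscal (Cmul (RtoC (r ^ S J))
    (Cexpi (- (INR (S J) * u)))) (Nat.iter (S J) T x)) by vring.
  rewrite vnorm_scal, Cnorm_mul_Cexpi, Cnorm_RtoC, Rabs_pos_eq; auto. }
assert (Hy : forall u, 0 <= u <= 4 * PI -> ~ U (Cexpi u) ->
  vnorm (res_part r x J u) <= 2 * vnorm x / d).
{ intros u Hu Hn. apply Rmult_le_reg_l with d; [lra|].
  replace (d * (2 * vnorm x / d)) with (2 * vnorm x) by (field; lra).
  eapply Rle_trans; [apply (Hlow u Hu Hn r Hr)|].
  eapply Rle_trans; [apply (vnorm_le_sub X x)|]. specialize (Hres u). nra. }
assert (Hpos1 : 0 <= 2 * vnorm x / d) by (apply Rmult_le_pos; [lra|apply Rlt_le, Rinv_0_lt_compat; lra]).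
assert (HhM : 0 <= h * M) by now apply Rmult_le_pos.
assert (Hpos2 : 0 <= (2 * h * vnorm x + h * M * (2 * vnorm x / d)) / d).
{ apply Rmult_le_pos; [|apply Rlt_le, Rinv_0_lt_compat; lra].
  pose proof (Rmult_le_pos _ _ HhM Hpos1). nra. }
assert (Goal1 : om * (2 * vnorm x / d)
   + l * ((2 * h * vnorm x + h * M * (2 * vnorm x / d)) / d)
  = (2 * om / d + l * (2 * h + 2 * h * M / d) / d) * vnorm x) by (field; lra).
rewrite <- Goal1. clear Goal1.
pose proof (Rmult_le_pos _ _ Hom0 Hpos1). pose proof (Rmult_le_pos _ _ Hl0 Hpos2).
unfold sym_part.
destruct (classic (U (Cexpi s))) as [Us|Us]; destruct (classic (U (Cexpi t))) as [Ut|Ut].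
- rewrite (HU s Us), (HU t Ut), !vscal_0l, vsub_self, vnorm_vzero. lra.
- rewrite (HU s Us), vscal_0l. rewrite (HU s Us) in Hom.
  replace (vsub vzero (vscal (fval b t) (res_part r x J t)))
    with (vscal (Csub C0 (fval b t)) (res_part r x J t)) by vring.
  rewrite vnorm_scal. specialize (Hy t Ht Ut).
  assert (Cnorm (Csub C0 (fval b t)) * vnorm (res_part r x J t) <= om * (2 * vnorm x / d))
    by (apply Rmult_le_compat; auto using Cnorm_ge0, vnorm_ge0). lra.
- rewrite (HU t Ut), vscal_0l. rewrite (HU t Ut) in Hom.
  replace (vsub (vscal (fval b s) (res_part r x J s)) vzero)
    with (vscal (Csub (fval b s) C0) (res_part r x J s)) by vring.
  rewrite vnorm_scal. specialize (Hy s Hs Us).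
  assert (Cnorm (Csub (fval b s) C0) * vnorm (res_part r x J s) <= om * (2 * vnorm x / d))
    by (apply Rmult_le_compat; auto using Cnorm_ge0, vnorm_ge0). lra.
- set (ys := res_part r x J s). set (yt := res_part r x J t).
  replace (vsub (vscal (fval b s) ys) (vscal (fval b t) yt))
    with (vadd (vscal (Csub (fval b s) (fval b t)) ys) (vscal (fval b t) (vsub ys yt))) by vring.
  eapply Rle_trans; [apply vnorm_triangle|]. rewrite !vnorm_scal.
  apply Rplus_le_compat.
  + apply Rmult_le_compat; auto using Cnorm_ge0, vnorm_ge0. now apply Hy.
  + apply Rmult_le_compat; auto using Cnorm_ge0, vnorm_ge0.
    { apply (fval_norm b l Hl). }
    apply Rmult_le_reg_l with d; [lra|].
    replace (d * ((2 * h * vnorm x + h * M * (2 * vnorm x / d)) / d))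
      with (2 * h * vnorm x + h * M * (2 * vnorm x / d)) by (field; lra).
    eapply Rle_trans; [apply (Hlow s Hs Us r Hr)|].
    (* The resolvent identity, with the two residuals as correction. *)
    replace (res_op r s (vsub ys yt)) with
      (vadd (vsub (vsub (res_op r s ys) x) (vsub (res_op r t yt) x))
        (vscal (Cmul (RtoC r) (Csub (Cexpi (- s)) (Cexpi (- t)))) (T yt))).
    2:{ unfold res_op. rewrite T_vsub. vring. }
    eapply Rle_trans; [apply vnorm_triangle|].
    apply Rplus_le_compat.
    * eapply Rle_trans; [apply vnorm_vsub|].
      pose proof (Hres s) as R1. pose proof (Hres t) as R2.
      fold ys in R1. fold yt in R2. nra.
    * rewrite vnorm_scal, Cnorm_mul, Cnorm_RtoC, Rabs_pos_eq by lra.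
      pose proof (Cexpi_lipschitz (- s) (- t)) as Hc.
      replace (- s - - t) with (- (s - t)) in Hc by ring. rewrite Rabs_Ropp in Hc.
      pose proof (Cnorm_ge0 (Csub (Cexpi (- s)) (Cexpi (- t)))).
      replace (h * M * (2 * vnorm x / d)) with (h * (M * (2 * vnorm x / d))) by ring.
      apply Rmult_le_compat; auto using vnorm_ge0.
      -- apply Rmult_le_pos; lra.
      -- nra.
      -- eapply Rle_trans; [apply HM|]. apply Rmult_le_compat_l; auto.
         apply Hy; auto.
Qed.

(** The first condition puts all the coefficients [b (j - n)] with [j <= J] into the partial sum of
    order [L]; the second one excludes aliasing. *)
Lemma grid_orbit r x J n N L :
  (Z.of_nat n + Z.of_nat J <= Z.of_nat L)%Z ->
  (Z.of_nat n + Z.of_nat J + Z.of_nat L < Z.of_nat (S N))%Z ->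
  vsum (fun k => vscal (Cexpi (INR n * grid (S N) k))
     (vscal (fpart b L (grid (S N) k)) (res_part r x J (grid (S N) k)))) N
  = vscal (RtoC (INR (S N))) (vsum (fun j => vscal (Cmul (b (Z.of_nat j - Z.of_nat n)%Z)
     (RtoC (r ^ j))) (Nat.iter j T x)) J).
Proof.
intros HL HN.
rewrite (vsum_ext X _ (fun k => vsum (fun j => vscal (Cmul (RtoC (r ^ j))
    (Cmul (Cexpi (IZR (Z.of_nat n - Z.of_nat j) * grid (S N) k)) (fpart b L (grid (S N) k))))
    (Nat.iter j T x)) J)).
2:{ intros k _. unfold res_part. rewrite <- !vsum_scal. apply vsum_ext; intros j _.
    replace (IZR (Z.of_nat n - Z.of_nat j) * grid (S N) k)
      with (INR n * grid (S N) k + - (INR j * grid (S N) k))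
      by (rewrite minus_IZR, <- !INR_IZR_INZ; ring).
    rewrite Cexpi_add. vring. }
rewrite vsum_exchange, <- vsum_scal. apply vsum_ext; intros j Hj.
rewrite vsum_scal_vec, Csum_scal, grid_coefficient by lia.
destruct (Z.leb_spec (Z.abs (Z.of_nat n - Z.of_nat j)) (Z.of_nat L)); [|lia].
replace (- (Z.of_nat n - Z.of_nat j))%Z with (Z.of_nat j - Z.of_nat n)%Z by lia.
vring.
Qed.

(** Replacing [fval b] by its partial sum makes the grid average exact, at the cost of a tail of
    [b]. The bound [C / 2] does not depend on the grid, so the order [L] and the grid can be refined
    together. *)
Lemma orbit_part_bound r x J n C :
  0 <= r <= 1 -> (0 < n)%nat ->
  (forall t, 0 <= t <= 2 * PI ->
     vnorm (vsub (sym_part r x J t) (sym_part r x J (t + PI / INR n))) <= C) ->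
  vnorm (vsum (fun j => vscal (Cmul (b (Z.of_nat j - Z.of_nat n)%Z)
     (RtoC (r ^ j))) (Nat.iter j T x)) J) <= C / 2.
Proof.
intros Hr Hn HC. set (Z0 := vsum _ J).
set (Y := sum_f_R0 (fun j => vnorm (Nat.iter j T x)) J).
assert (HY : 0 <= Y) by (apply sum_f_R0_ge0; intros; apply vnorm_ge0).
assert (B : forall L, (n + J <= L)%nat ->
  vnorm Z0 <= C / 2 + (l - Rsum_Z (fun n => Cnorm (b n)) L) * Y).
(* Any large [m] works: the number of nodes must be a multiple of [2 n] exceeding [n + J + L]. *)
{ intros L HL. set (m := (n + J + L + 1)%nat). set (N := (2 * n * m - 1)%nat).
  assert (HN : S N = (2 * n * m)%nat) by (unfold N, m; nia).
  assert (HNL : (n + J + L < S N)%nat) by (rewrite HN; unfold m; nia).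
  pose proof (lt_0_INR (S N) ltac:(lia)) as HN0.
  pose proof (grid_orbit r x J n N L ltac:(lia) ltac:(lia)) as E. fold Z0 in E.
  pose proof (grid_riemann_lebesgue X (sym_part r x J) n m N C Hn HN) as RL.
  specialize (RL ltac:(intros t; unfold sym_part;
    rewrite fval_periodic, res_part_periodic; reflexivity) HC).
  assert (D : vnorm (vsub (vscal (RtoC (INR (S N))) Z0) (vsum (fun k => vscal
    (Cexpi (INR n * grid (S N) k)) (sym_part r x J (grid (S N) k))) N))
    <= INR (S N) * ((l - Rsum_Z (fun n => Cnorm (b n)) L) * Y)).
  { rewrite <- E, <- vsum_sub. eapply Rle_trans; [apply vsum_norm_le with
      (g := fun _ => (l - Rsum_Z (fun n => Cnorm (b n)) L) * Y)|].
    - intros k _. unfold sym_part. set (t := grid (S N) k).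
      replace (vsub _ _) with (vscal (Cexpi (INR n * t))
        (vscal (Csub (fpart b L t) (fval b t)) (res_part r x J t))) by vring.
      rewrite !vnorm_scal, Cnorm_Cexpi, Rmult_1_l.
      apply Rmult_le_compat; auto using Cnorm_ge0, vnorm_ge0.
      + pose proof (fval_approx b l Hl L t) as F.
        rewrite <- Cnorm_opp in F.
        now replace (Copp (Csub (fval b t) (fpart b L t)))
          with (Csub (fpart b L t) (fval b t)) in F by ring.
      + now apply res_part_norm.
    - rewrite sum_cte. lra. }
  pose proof (vnorm_le_sub X (vsum (fun k => vscal
    (Cexpi (INR n * grid (S N) k)) (sym_part r x J (grid (S N) k))) N)
    (vscal (RtoC (INR (S N))) Z0)) as Tr.
  rewrite vnorm_scal, Cnorm_RtoC, Rabs_pos_eq in Tr by lra.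
  apply Rmult_le_reg_l with (INR (S N)); auto. lra. }
apply Rnot_lt_le; intros Hlt.
assert (He : 0 < (vnorm Z0 - C / 2) / (Y + 1)) by (apply Rdiv_lt_0_compat; lra).
destruct (Hl _ He) as [L HL].
specialize (HL (L + n + J)%nat ltac:(lia)). specialize (B (L + n + J)%nat ltac:(lia)).
unfold Rdist in HL. apply Rabs_def2 in HL.
assert (E : (vnorm Z0 - C / 2) / (Y + 1) * (Y + 1) = vnorm Z0 - C / 2) by (field; lra).
nra.
Qed.

(** The threshold [n0] is independent of [r], [J] and [x]: this lets the estimate survive the Abel
    limit and be uniform in [x]. *)
Lemma orbit_part_decay eps : eps > 0 ->
  exists n0, (0 < n0)%nat /\ forall n, (n >= n0)%nat -> forall r x J,
    1 - d < r < 1 ->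
    r ^ S J * vnorm (Nat.iter (S J) T x) <= Rmin (PI / INR n) 1 * vnorm x ->
    vnorm (vsum (fun j => vscal (Cmul (b (Z.of_nat j - Z.of_nat n)%Z)
       (RtoC (r ^ j))) (Nat.iter j T x)) J) <= eps * vnorm x.
Proof.
intros He. pose proof PI_RGT_0 as Hpi.
assert (Hl0 : 0 <= l) by (eapply Rle_trans; [apply Cnorm_ge0|apply (fval_norm b l Hl 0)]).
(* Makes the first part of the modulus, [2 om / d], equal to [eps / 2]; below, [h <= h0] does the
   same for the second part [q * h]. *)
set (om := eps * d / 4). assert (Hom : om > 0) by (unfold om; nra).
destruct (fval_uniform_continuity b l Hl om Hom) as [dl [Hdl Hcont]].
set (q := l * (2 + 2 * M / d) / d).
assert (HMd : 0 <= M / d) by (apply Rmult_le_pos; [auto|apply Rlt_le, Rinv_0_lt_compat; lra]).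
assert (Hq : 0 <= q).
{ unfold q. apply Rmult_le_pos; [|apply Rlt_le, Rinv_0_lt_compat; lra].
  apply Rmult_le_pos; auto. unfold Rdiv in *. lra. }
set (h0 := Rmin (dl / 2) (eps / (2 * (q + 1)))).
assert (Hh0 : 0 < h0).
{ apply Rmin_glb_lt; [lra|apply Rdiv_lt_0_compat; lra]. }
destruct (INR_unbounded (PI / h0)) as [n0 Hn0].
exists (S n0). split; [lia|]. intros n Hn r x J Hr Heta.
assert (Hn1 : 0 < INR n) by (apply lt_0_INR; lia).
assert (Hnn : INR n0 <= INR n) by (apply le_INR; lia).
set (h := PI / INR n) in *.
assert (Hh : 0 < h) by (apply Rdiv_lt_0_compat; auto).
assert (Hhh : h <= h0).
{ apply Rmult_le_reg_r with (INR n); auto. unfold h.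
  replace (PI / INR n * INR n) with PI by (field; lra).
  apply Rle_trans with (h0 * (PI / h0)); [right; field; lra|nra]. }
(* Keeps [t + h] inside [[0, 4 PI]], where the lower bound is available. *)
assert (Hhpi : h <= PI).
{ unfold h. apply Rmult_le_reg_r with (INR n); auto.
  replace (PI / INR n * INR n) with PI by (field; lra).
  assert (1 <= INR n) by (apply (le_INR 1); lia). nra. }
pose proof (Rmin_l (dl / 2) (eps / (2 * (q + 1)))) as M1.
pose proof (Rmin_r (dl / 2) (eps / (2 * (q + 1)))) as M2. fold h0 in M1, M2.
pose proof (vnorm_ge0 X x).
eapply Rle_trans; [apply orbit_part_bound with
  (C := (2 * om / d + l * (2 * h + 2 * h * M / d) / d) * vnorm x); [lra|lia|]|].
- intros t Ht. fold h.
  assert (Ha : Rabs (t - (t + h)) = h)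
    by (replace (t - (t + h)) with (- h) by ring; rewrite Rabs_Ropp, Rabs_pos_eq; lra).
  apply sym_part_continuity; auto; try lra.
  apply Rlt_le, Hcont. lra.
- assert (E1 : 2 * om / d = eps / 2) by (unfold om; field; lra).
  assert (E2 : l * (2 * h + 2 * h * M / d) / d = q * h) by (unfold q; field; lra).
  rewrite E1, E2.
  assert (E3 : (q + 1) * (eps / (2 * (q + 1))) = eps / 2) by (field; lra).
  assert (q * h <= eps / 2) by nra. nra.
Qed.

End Symbol.

End OrbitDecay.

(** * Cesàro means *)

(** Regularity of the Cesàro method. Up to [J], [kk_ratio] bounds the weights by [alpha / (n - J)]
    relative to [kk (alpha + 1) n]; beyond [J], the weights sum to at most [kk (alpha + 1) n]. Each
    part costs one [e]. *)
Lemma cesaro_eventually_small alpha (u : nat -> R) e J :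
  0 < alpha -> 0 < e -> (forall j, 0 <= u j) -> (forall j, (J < j)%nat -> u j <= e) ->
  exists n1, forall n, (n >= n1)%nat ->
    rconv (kk alpha) u n <= 2 * e * kk (alpha + 1) n.
Proof.
intros Ha He Hu HJ. set (B := sum_f_R0 u J).
assert (HB : 0 <= B) by (apply sum_f_R0_ge0; auto).
destruct (INR_unbounded (alpha * B / e)) as [p0 Hp0].
exists (S J + p0)%nat; intros n Hn.
assert (Hk := kk_pos (alpha + 1) n ltac:(lra)).
set (p := (n - S J)%nat).
assert (Hp : INR p0 <= INR p) by (apply le_INR; unfold p; lia).
assert (En : n = (S J + p)%nat) by (unfold p; lia).
unfold rconv.
assert (E := sum_f_R0_cat
  (fun j => kk alpha (n - j) * u j) J p).
rewrite <- En in E. rewrite E.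
assert (H1 : sum_f_R0 (fun j => kk alpha (n - j) * u j) J <= e * kk (alpha + 1) n).
{ apply Rle_trans with (sum_f_R0 (fun j => kk (alpha + 1) n * (alpha / INR (S p)) * u j) J).
  - apply sum_f_R0_le; intros j Hj. apply Rmult_le_compat_r; auto.
    assert (Hs : 0 < INR (S p)) by (apply lt_0_INR; lia).
    assert (Hsj : INR (S p) <= INR (n - j)) by (apply le_INR; lia).
    pose proof (kk_ratio alpha (n - j)) as R1.
    pose proof (kk_le_index (alpha + 1) (n - j) n ltac:(lra) ltac:(lia)) as R2.
    pose proof (kk_ge0 alpha (n - j) ltac:(lra)).
    apply Rmult_le_reg_r with (INR (S p)); auto.
    replace (kk (alpha + 1) n * (alpha / INR (S p)) * INR (S p))
      with (alpha * kk (alpha + 1) n) by (field; lra).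
    apply Rle_trans with (kk alpha (n - j) * (alpha + INR (n - j))); [nra|].
    rewrite R1. nra.
  - rewrite sum_f_R0_scal. fold B.
    assert (Hs : 0 < INR (S p)) by (apply lt_0_INR; lia).
    replace (kk (alpha + 1) n * (alpha / INR (S p)) * B)
      with ((alpha * B / INR (S p)) * kk (alpha + 1) n) by (field; lra).
    apply Rmult_le_compat_r; [lra|].
    apply Rmult_le_reg_r with (INR (S p)); auto.
    replace (alpha * B / INR (S p) * INR (S p)) with (e * (alpha * B / e)) by (field; lra).
    apply Rmult_le_compat_l; [lra|]. rewrite S_INR. lra. }
assert (H2 : sum_f_R0 (fun i => kk alpha (n - (S J + i)) * u (S J + i)%nat) p
  <= e * kk (alpha + 1) n).
{ rewrite <- kk_conv, <- rconv_scal_r. unfold rconv.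
  assert (E' := sum_f_R0_cat
    (fun j => kk alpha (n - j) * (e * kk 1 j)) J p).
  rewrite <- En in E'. rewrite E'.
  assert (0 <= sum_f_R0 (fun j => kk alpha (n - j) * (e * kk 1 j)) J).
  { apply sum_f_R0_ge0; intros i _. rewrite kk_1. pose proof (kk_ge0 alpha (n - i)).
    apply Rmult_le_pos; lra. }
  assert (sum_f_R0 (fun i => kk alpha (n - (S J + i)) * u (S J + i)%nat) p
    <= sum_f_R0 (fun i => kk alpha (n - (S J + i)) * (e * kk 1 (S J + i))) p).
  { apply sum_f_R0_le; intros i _. rewrite kk_1. apply Rmult_le_compat_l.
    - apply kk_ge0; lra.
    - rewrite Rmult_1_r. apply HJ; lia. }
  lra. }
lra.
Qed.

(** * From orbit coefficients to Cesàro means *)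

Section Conclusion.

Variables (X : CBanach) (alpha : R) (T : X -> X) (K : R).
Hypothesis Halpha : 0 < alpha.
Hypothesis HT : bounded_op T.
Hypothesis HK : 0 <= K.
Hypothesis HDelta : forall n x,
  vnorm (DeltaT alpha T n x) <= K * kk (alpha + 1) n * vnorm x.

Add Ring sqz_ring_inst7 : (sqz_ring X).

(** A relation between vectors: the approximant [b] is treated one [x] at a time, with constants
    that do not depend on [x]. *)
Definition is_theta (b : Z -> Cx) (x y : X) : Prop :=
  vser (fun n => vscal (W_frac alpha b (Z.of_nat n)) (DeltaT alpha T n x)) y.

Lemma theta_terms_bound (w : nat -> Cx) A x N :
  wsumm_by (alpha + 1) w A ->
  sum_f_R0 (fun n => vnorm (vscal (w n) (DeltaT alpha T n x))) N <= K * A * vnorm x.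
Proof.
intros HA. replace (K * A * vnorm x) with (K * vnorm x * A) by ring.
apply Rle_trans with (K * vnorm x * sum_f_R0 (fun i => kk (alpha + 1) i * Cnorm (w i)) N).
- rewrite <- sum_f_R0_scal. apply sum_f_R0_le; intros n _. rewrite vnorm_scal.
  pose proof (Cnorm_ge0 (w n)). specialize (HDelta n x). nra.
- apply Rmult_le_compat_l; [|apply HA]. apply Rmult_le_pos; auto using vnorm_ge0.
Qed.

Lemma theta_exists b x : in_A alpha b -> exists y, is_theta b x y.
Proof.
intros [_ Hb].
destruct (vser_abs X (fun n => vscal (W_frac alpha b (Z.of_nat n)) (DeltaT alpha T n x))
  (K * A_norm alpha b * vnorm x)) as [y [Hy _]].
- intros N. apply (theta_terms_bound (fun n => W_frac alpha b (Z.of_nat n))).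
  now apply A_norm_bound.
- now exists y.
Qed.

Lemma theta_bound b x y :
  in_A alpha b -> is_theta b x y -> vnorm y <= K * A_norm alpha b * vnorm x.
Proof.
intros [_ Hb] Hy. apply (vser_norm_le X _ _ _ Hy). intros N.
apply (theta_terms_bound (fun n => W_frac alpha b (Z.of_nat n))).
now apply A_norm_bound.
Qed.

Lemma theta_sub a b x y z :
  in_A alpha a -> in_A alpha b -> is_theta a x y -> is_theta b x z ->
  is_theta (fun n => Csub (a n) (b n)) x (vsub y z).
Proof.
intros Ha Hb Hy Hz. eapply vconv_ext; [|apply (vser_sub X _ _ _ _ Hy Hz)].
intros N. apply vsum_ext; intros n _. rewrite W_frac_sub by auto. vring.
Qed.

(** The majorants of the powers of [r T] form a convergent series. This supplies the small Neumann
    residual for large [J]. *)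
Lemma power_null r eps x : 0 <= r < 1 -> eps > 0 ->
  exists J0, forall J, (J >= J0)%nat ->
    r ^ S J * vnorm (Nat.iter (S J) T x) <= eps * vnorm x.
Proof.
intros Hr He.
destruct (kk_geometric r (2 * alpha + 1) Hr ltac:(lra)) as [G HG].
assert (Hpos : forall i, 0 <= r ^ i * kk (2 * alpha + 1) i)
  by (intros; apply Rmult_le_pos; [apply pow_le; lra|apply kk_ge0; lra]).
assert (Hc : 0 < eps / (K + 1)) by (apply Rdiv_lt_0_compat; lra).
destruct (sum_f_R0_tail _ G Hpos HG _ Hc) as [J0 HJ0].
exists J0; intros J HJ. specialize (HJ0 J (S J) HJ ltac:(lia)). rewrite tech5 in HJ0.
pose proof (power_growth X alpha T K Halpha HDelta (S J) x) as P.
assert (0 <= r ^ S J) by (apply pow_le; lra).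
apply Rle_trans with (r ^ S J * (K * kk (2 * alpha + 1) (S J) * vnorm x));
  [now apply Rmult_le_compat_l|].
replace (r ^ S J * (K * kk (2 * alpha + 1) (S J) * vnorm x))
  with (K * (r ^ S J * kk (2 * alpha + 1) (S J)) * vnorm x) by ring.
apply Rmult_le_compat_r; [apply vnorm_ge0|].
assert (E : (K + 1) * (eps / (K + 1)) = eps) by (field; lra).
specialize (Hpos (S J)). nra.
Qed.

Lemma orbit_coef_decay b U :
  in_A alpha b -> C_open U -> (forall z, in_spectrum T z /\ Cnorm z = 1 -> U z) ->
  (forall t, U (Cexpi t) -> fval b t = C0) ->
  forall eps, eps > 0 -> exists n0, forall n, (n >= n0)%nat -> forall x y,
    is_theta b x y -> vnorm (orbit_coef X T b y x n) <= eps * vnorm x.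
Proof.
intros Hb HU HE Hf eps He.
destruct (HT) as [_ [_ [M0 HM0]]].
assert (HM : forall x, vnorm (T x) <= Rabs M0 * vnorm x).
{ intros x. eapply Rle_trans; [apply HM0|].
  apply Rmult_le_compat_r; [apply vnorm_ge0|apply Rle_abs]. }
destruct (res_op_lower_bound X T (Rabs M0) (Rabs_pos M0) HM U HU HE) as [d [Hd Hlow]].
destruct (Hb) as [[l Hl] _].
destruct (orbit_part_decay X T (Rabs M0) HT (Rabs_pos M0) HM b l U d Hl Hf Hd Hlow eps He)
  as [n0 [Hn0 Hdec]].
exists n0; intros n Hn x y Hy. destruct n as [|n]; [lia|].
apply (abel_lim_norm_le X _ _ _ d (proj1 Hd)
  (orbit_coef_abel_lim X alpha T K Halpha HT HK HDelta b x y n Hb Hy)).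
intros r Hr.
destruct (power_null r (Rmin (PI / INR (S n)) 1) x ltac:(lra)) as [J0 HJ0].
{ apply Rmin_glb_lt; [|lra]. apply Rdiv_lt_0_compat; [apply PI_RGT_0|apply lt_0_INR; lia]. }
exists J0; intros J HJ. apply Hdec; auto.
Qed.

(** A bound at a fixed index, uniform in [x] only; it serves the finitely many indices that precede
    the decay. *)
Lemma orbit_coef_bound b n :
  in_A alpha b -> exists C, 0 <= C /\ forall x y, is_theta b x y ->
    vnorm (orbit_coef X T b y x n) <= C * vnorm x.
Proof.
intros Hb.
set (A := Rabs (A_norm alpha b)).
set (V := sum_f_R0 (fun j => Cnorm (neg_coef b (n - j)) * (K * kk (2 * alpha + 1) j)) n).
assert (Hk : forall j, 0 <= K * kk (2 * alpha + 1) j)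
  by (intros; apply Rmult_le_pos; auto; apply kk_ge0; lra).
assert (HV : 0 <= V).
{ apply sum_f_R0_ge0; intros. apply Rmult_le_pos; auto using Cnorm_ge0. }
exists (K * kk (2 * alpha + 1) n * (K * A) + V). split.
{ pose proof (Rabs_pos (A_norm alpha b)). fold A in H.
  pose proof (Rmult_le_pos _ _ (Hk n) (Rmult_le_pos _ _ HK H)). lra. }
intros x y Hy. unfold orbit_coef.
eapply Rle_trans; [apply vnorm_triangle|]. rewrite Rmult_plus_distr_r.
apply Rplus_le_compat.
- eapply Rle_trans; [apply (power_growth X alpha T K Halpha HDelta)|].
  rewrite (Rmult_assoc _ (K * A)). apply Rmult_le_compat_l; auto.
  eapply Rle_trans; [apply (theta_bound b x y Hb Hy)|].
  apply Rmult_le_compat_r; [apply vnorm_ge0|]. apply Rmult_le_compat_l; auto. apply Rle_abs.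
- rewrite Rmult_comm. unfold V. rewrite <- sum_f_R0_scal.
  apply vsum_norm_le; intros j _. rewrite vnorm_scal.
  pose proof (power_growth X alpha T K Halpha HDelta j x) as P.
  pose proof (Cnorm_ge0 (neg_coef b (n - j))). nra.
Qed.

(** Formally the Cesàro sum of order [n] times the two-sided sum of [b(k) T^k], expanded, with only
    nonnegative powers of [T] kept. *)
Definition theta_mean (b : Z -> Cx) (y x : X) (n : nat) : X :=
  vadd (DeltaT alpha T n y) (vcv (neg_coef b) (fun j => DeltaT alpha T j x) n).

(** Convolution with [kk alpha] commutes with convolution with the negative coefficients, so it can
    be moved onto the powers of [T]. *)
Lemma theta_mean_rcv b y x n :
  theta_mean b y x n = rcv (kk alpha) (orbit_coef X T b y x) n.
Proof.
unfold orbit_coef, rcv. rewrite vcv_add. unfold theta_mean. f_equal.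
rewrite (vcv_assoc X (fun i => RtoC (kk alpha i)) (neg_coef b)).
rewrite (vcv_ext X _ (Ccv (neg_coef b) (fun i => RtoC (kk alpha i)))
  _ (fun j => Nat.iter j T x) n (fun i _ => Ccv_comm _ _ i)) by auto.
rewrite <- vcv_assoc. reflexivity.
Qed.

Lemma theta_mean_decay b U :
  in_A alpha b -> C_open U -> (forall z, in_spectrum T z /\ Cnorm z = 1 -> U z) ->
  (forall t, U (Cexpi t) -> fval b t = C0) ->
  forall eps, eps > 0 -> exists n0, forall n, (n >= n0)%nat -> forall x y,
    is_theta b x y -> vnorm (theta_mean b y x n) <= eps * kk (alpha + 1) n * vnorm x.
Proof.
intros Hb HU HE Hf eps He.
destruct (orbit_coef_decay b U Hb HU HE Hf (eps / 2)) as [J HJ]; [lra|].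
set (Cb := fun j => proj1_sig (constructive_indefinite_description _ (orbit_coef_bound b j Hb))).
assert (HC : forall j, 0 <= Cb j /\ forall x y, is_theta b x y ->
    vnorm (orbit_coef X T b y x j) <= Cb j * vnorm x)
  by exact (fun j => proj2_sig
       (constructive_indefinite_description _ (orbit_coef_bound b j Hb))).
(* A scalar majorant of the orbit coefficients common to all [x], so that Cesàro averaging is done
   once, on reals. *)
set (u := fun j => if Nat.leb j J then Cb j else eps / 2).
assert (Hu : forall j, 0 <= u j).
{ intros j. unfold u. destruct (Nat.leb j J); [apply HC|lra]. }
destruct (cesaro_eventually_small alpha u (eps / 2) J Halpha ltac:(lra) Hu) as [n1 Hn1].
{ intros j Hj. unfold u. destruct (Nat.leb_spec j J); [lia|lra]. }
exists n1; intros n Hn x y Hy. rewrite theta_mean_rcv.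
eapply Rle_trans; [apply rcv_norm_le with (c' := kk alpha) (u := fun j => vnorm x * u j)|].
- intros i _. rewrite Rabs_pos_eq; [lra|apply kk_ge0; lra].
- intros j _. rewrite Rmult_comm. unfold u.
  destruct (Nat.leb_spec j J); [now apply HC|apply HJ; auto; lia].
- rewrite rconv_scal_r, Rmult_comm. apply Rmult_le_compat_r; [apply vnorm_ge0|].
  specialize (Hn1 n Hn). lra.
Qed.

(** As [a] has no negative coefficients, those of [b] are, up to sign, those of [a - b]. The zero at
    index 0 of [neg_coef] accounts for the shift against [neg_part]. *)
Lemma neg_coef_sum a b n :
  in_A alpha a -> in_A alpha b -> (forall n, (n < 0)%Z -> a n = C0) ->
  sum_f_R0 (fun i => Cnorm (neg_coef b i)) n
  <= A_norm alpha (fun n => Csub (a n) (b n)).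
Proof.
intros Ha Hb Ha0. pose proof (in_A_sub alpha Halpha a b Ha Hb) as Hc.
assert (E : forall i, Cnorm (neg_part (fun n => Csub (a n) (b n)) i)
  = Cnorm (neg_coef b (S i))).
{ intros i. unfold neg_part. rewrite Ha0 by lia. cbn [neg_coef].
  rewrite <- Cnorm_opp. f_equal. unfold Csub. ring. }
pose proof (neg_part_A_norm alpha Halpha _ (pred n) Hc) as H.
destruct n as [|n].
- cbn [sum_f_R0 neg_coef pred] in *. rewrite Cnorm_C0.
  pose proof (Cnorm_ge0 (neg_part (fun n => Csub (a n) (b n)) 0)). lra.
- assert (E' := sum_f_R0_recl
    (fun i => Cnorm (neg_coef b i)) n).
  rewrite E'. cbn [neg_coef].
  rewrite Cnorm_C0, Rplus_0_l. eapply Rle_trans; [|exact H]. cbn [pred].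
  right; apply sum_eq; intros i _. symmetry. apply E.
Qed.

Lemma neg_coef_mean_bound a b x n :
  in_A alpha a -> in_A alpha b -> (forall n, (n < 0)%Z -> a n = C0) ->
  vnorm (vcv (neg_coef b) (fun j => DeltaT alpha T j x) n)
  <= K * A_norm alpha (fun n => Csub (a n) (b n)) * kk (alpha + 1) n * vnorm x.
Proof.
intros Ha Hb Ha0.
pose proof (kk_ge0 (alpha + 1) n ltac:(lra)) as Hk.
pose proof (vnorm_ge0 X x) as Hx.
assert (HKk : 0 <= K * kk (alpha + 1) n * vnorm x)
  by (repeat apply Rmult_le_pos; auto).
apply Rle_trans with (sum_f_R0 (fun j => K * kk (alpha + 1) n * vnorm x
   * Cnorm (neg_coef b (n - j))) n).
- apply vsum_norm_le; intros j Hj. rewrite vnorm_scal, Rmult_comm.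
  apply Rmult_le_compat_r; [apply Cnorm_ge0|].
  eapply Rle_trans; [apply HDelta|]. apply Rmult_le_compat_r; auto.
  apply Rmult_le_compat_l; auto. apply kk_le_index; [lra|lia].
- rewrite sum_f_R0_scal.
  assert (E := sum_f_R0_rev
    (fun i => Cnorm (neg_coef b i)) n).
  rewrite <- E.
  pose proof (neg_coef_sum a b n Ha Hb Ha0) as H. nra.
Qed.

End Conclusion.

Theorem theorem3p4 (X : CBanach) (alpha : R) (Halpha : 0 < alpha)
  (T : X -> X) (HT : bounded_op T) (HCb : Cesaro_bounded alpha T)
  (a : Z -> Cx) (Ha : in_Aplus alpha a)
  (Hsyn : spectral_synthesis alpha a
            (fun z => in_spectrum T z /\ Cnorm z = 1))
  (Theta : X -> X)
  (HTheta : forall x : X,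
     vconv (vsum (fun n => vscal (W_frac alpha a (Z.of_nat n)) (DeltaT alpha T n x))) (Theta x)) :
  forall eps, eps > 0 -> exists N : nat, forall n : nat, (n >= N)%nat ->
    forall x : X, vnorm (MT alpha T n (Theta x)) <= eps * vnorm x.
Proof.
intros eps He. destruct HCb as [K0 HK0]. destruct Ha as [Ha Ha0].
set (K := Rabs K0). assert (HK : 0 <= K) by apply Rabs_pos.
assert (Hkpos : forall n, 0 < kk (alpha + 1) n) by (intros; apply kk_pos; lra).
assert (EM : forall n x, vnorm (MT alpha T n x)
  = / kk (alpha + 1) n * vnorm (DeltaT alpha T n x)).
{ intros n x. unfold MT. rewrite vnorm_scal, Cnorm_RtoC, Rabs_pos_eq; auto.
  apply Rlt_le, Rinv_0_lt_compat; auto. }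
assert (HDelta : forall n x,
  vnorm (DeltaT alpha T n x) <= K * kk (alpha + 1) n * vnorm x).
{ intros n x. specialize (HK0 n x). rewrite EM in HK0.
  apply Rmult_le_reg_l with (/ kk (alpha + 1) n); [now apply Rinv_0_lt_compat|].
  eapply Rle_trans; [apply HK0|].
  replace (/ kk (alpha + 1) n * (K * kk (alpha + 1) n * vnorm x)) with (K * vnorm x)
    by (field; specialize (Hkpos n); lra).
  apply Rmult_le_compat_r; [apply vnorm_ge0|apply Rle_abs]. }
(* [K * K] comes from a Cesàro sum applied to theta of [a - b], [K] from the negative coefficients
   of [b]; the 1 keeps the denominator positive. *)
set (e := eps / (2 * (K * K + K + 1))).
assert (Hden : 0 < K * K + K + 1) by nra.
assert (He1 : e > 0) by (apply Rdiv_lt_0_compat; lra).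
destruct (Hsyn e He1) as [b [Hb [Hab [U [HU [HE Hf]]]]]].
destruct (theta_mean_decay X alpha T K Halpha HT HK HDelta b U Hb HU HE Hf (eps / 2))
  as [N HN]; [lra|].
exists N; intros n Hn x.
destruct (theta_exists X alpha T K Halpha HK HDelta b x Hb) as [y Hy].
specialize (HN n Hn x y Hy).
set (A := A_norm alpha (fun n => Csub (a n) (b n))) in *.
assert (B1 : vnorm (vsub (Theta x) y) <= K * A * vnorm x).
{ apply (theta_bound X alpha T K Halpha HK HDelta (fun n => Csub (a n) (b n)) x).
  - now apply in_A_sub.
  - apply theta_sub; auto. apply HTheta. }
pose proof (neg_coef_mean_bound X alpha T K Halpha HK HDelta a b x n Ha Hb Ha0) as B2.
fold A in B2.
pose proof (HDelta n (vsub (Theta x) y)) as B3.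
pose proof (vnorm_ge0 X x) as Hx. specialize (Hkpos n).
(* Replace [a] by [b], then add and subtract the negative coefficients to reach the decaying
   quantity [theta_mean]. *)
assert (E : DeltaT alpha T n (Theta x)
  = vadd (DeltaT alpha T n (vsub (Theta x) y))
      (vsub (theta_mean X alpha T b y x n)
         (vcv (neg_coef b) (fun j => DeltaT alpha T j x) n))).
{ unfold theta_mean. set (q := vcv _ _ n).
  assert (Ed : DeltaT alpha T n (vsub (Theta x) y)
    = vsub (DeltaT alpha T n (Theta x)) (DeltaT alpha T n y)).
  { unfold DeltaT. rewrite <- vsum_sub. apply vsum_ext; intros j _.
    destruct (bounded_op_iter X T j HT) as [TA [TS _]].
    unfold vsub. now rewrite TA, !vopp_scal, TS, vscal_addv, !vscal_assoc,
      (Rmul_comm Cx_ring (RtoC _)). }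
  rewrite Ed. unfold vsub. rewrite !vopp_scal.
  set (p := DeltaT alpha T n (Theta x)). set (s := DeltaT alpha T n y).
  rewrite <- (vadd_assoc X p), <- (vadd_assoc X s).
  rewrite <- (vopp_scal X q), vadd_opp, vadd_0, (vadd_comm X _ s),
    <- (vopp_scal X s), vadd_opp. now rewrite vadd_0. }
rewrite EM, E.
pose proof (vnorm_triangle X (DeltaT alpha T n (vsub (Theta x) y))
  (vsub (theta_mean X alpha T b y x n)
     (vcv (neg_coef b) (fun j => DeltaT alpha T j x) n))) as T1.
pose proof (vnorm_vsub X (theta_mean X alpha T b y x n)
  (vcv (neg_coef b) (fun j => DeltaT alpha T j x) n)) as T2.
apply Rmult_le_reg_l with (kk (alpha + 1) n); auto.
rewrite <- Rmult_assoc, Rinv_r, Rmult_1_l by lra.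
assert (B4 : K * kk (alpha + 1) n * vnorm (vsub (Theta x) y)
   <= K * kk (alpha + 1) n * (K * A * vnorm x))
  by (apply Rmult_le_compat_l; [apply Rmult_le_pos; lra|auto]).
assert (B5 : (K * K + K) * A <= eps / 2).
{ apply Rle_trans with ((K * K + K) * e); [apply Rmult_le_compat_l; nra|].
  apply Rle_trans with ((K * K + K + 1) * e); [nra|].
  right; unfold e; field; lra. }
assert (B6 : (K * K + K) * A * (kk (alpha + 1) n * vnorm x)
   <= eps / 2 * (kk (alpha + 1) n * vnorm x))
  by (apply Rmult_le_compat_r; [apply Rmult_le_pos; lra|auto]).
lra.
Qed.
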